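(* Let $G$ be the simple algebraic group of type $G_2$ over $\mathbb{C}$. For each $i\in\{1,2\}$, let $\mathcal{A}_i=\bigoplus_{n\ge 0}V_{n\omega_i}$ be the (multi-)homogeneous coordinate ring $\mathbb{C}[P_j^-\backslash G]$, $\{j\}=\{1,2\}\setminus\{i\}$, let $\underline{\Sigma_i}$ be the explicit seed described in the context, and let $S_i=\{(\Delta^{\omega_i})^n : n\ge 0\}$. Then the complexified cluster algebra $\mathcal{A}(\underline{\Sigma_i})_{\mathbb{C}}$ associated to the seed $\underline{\Sigma_i}$ is isomorphic to the localization of $\mathcal{A}_i$ at the multiplicative subset $S_i$; with the cluster variables and coefficients of $\underline{\Sigma_i}$ being the functions listed in the context, $$\mathcal{A}(\underline{\Sigma_i})_{\mathbb{C}} = S_i^{-1}\mathcal{A}_i .$$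
   Context: **Group.** $G$ is simple of type $G_2$ over $\mathbb{C}$, $\mathfrak{g}$ its Lie algebra, $B^{\pm}$ opposite Borel subgroups with unipotent radicals $N^{\pm}$, $H=B^+\cap B^-$, Chevalley generators $f_1,f_2,h_1,h_2,e_1,e_2$, $x_i(t)=\exp(te_i)$, $y_i(t)=\exp(tf_i)$. Simple roots $\alpha_1$ (short), $\alpha_2$ (long); fundamental weights $\omega_1=2\alpha_1+\alpha_2$, $\omega_2=3\alpha_1+2\alpha_2$; Weyl group $W=\langle s_1,s_2\rangle$ with longest element $w_0$. $P_i^-$ is the parabolic subgroup generated by $B^-$ and $x_i(t)$. $V_\lambda$ is the irreducible finite-dimensional $G$-module of highest weight $\lambda$. One has $\mathbb{C}[N^-\backslash G]=\bigoplus_{m,n\ge0}V_{m\omega_1+n\omega_2}$ (left $N^-$-invariant regular functions on $G$, with $G$ acting by right translation), and $\mathcal{A}_i=\mathbb{C}[P_j^-\backslash G]=\bigoplus_{n\ge0}V_{n\omega_i}$ ($\{j\}=\{1,2\}\setminus\{i\}$) is viewed as a subalgebra of it. **Minors and operators.** For $X\in\mathfrak{g}$ put $(X^\dagger f)(x)=\frac{d}{dt}f(x\exp(tX))|_{t=0}$. For $x=[x]_-[x]_0[x]_+\in N^-HN^+$ set $\Delta^{\omega_i}(x)=[x]_0^{\omega_i}$ (it extends to a regular function on $G$). Let $\varphi_i:SL_2(\mathbb{C})\to G$ send $\begin{pmatrix}1&t\\0&1\end{pmatrix}\mapsto x_i(t)$, $\begin{pmatrix}1&0\\t&1\end{pmatrix}\mapsto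 y_i(t)$; $\overline{s_i}=\varphi_i\begin{pmatrix}0&-1\\1&0\end{pmatrix}$ and $\overline{w}=\overline{s_{i_1}}\cdots\overline{s_{i_l}}$ for a reduced word of $w$. Put $\Delta^{w\omega_i}(x)=\Delta^{\omega_i}(x\overline{w})$; it is a weight vector of $V_{\omega_i}$ of weight $w\omega_i$. Put $X_0=\frac12 f_1^\dagger f_2^\dagger f_1^\dagger\Delta^{\omega_1}$. **Cluster algebras.** A seed is a pair (extended cluster, exchange matrix): a set of free generators $x_k$ of a field of rational functions, some being cluster variables (mutable indices) and the others coefficients (frozen indices), and an integer matrix $(b_{kl})$ with rows indexed by all indices and columns by mutable ones, whose square mutable part is skew-symmetrizable. Mutation $\mu_k$ at mutable $k$ replaces $x_k$ by $x_k'$ with $x_kx_k'=\prod_i x_i^{[b_{ik}]_+}+\prod_i x_i^{[-b_{ik}]_+}$ ($[b]_+=\max(0,b)$), and the matrix by $b'_{ij}=-b_{ij}$ if $i=k$ or $j=k$, and $b'_{ij}=b_{ij}+\mathrm{sgn}(b_{ik})[b_{ik}b_{kj}]_+$ otherwise. For a ground ring $R$ between the polynomial and Laurent polynomial ring over $\mathbb{Z}$ in the coefficients, $\mathcal{A}(\Sigma)$ is the $R$-subalgebra generated by all cluster variables of all seeds obtained from $\Sigma$ by sequences of mutations; $\mathcal{A}(\Sigma)_{\mathbb{C}}$ denotes its extension of scalars to $\mathbb{C}$. In both seeds below mutable indices are $1,2,3$ and frozen indices $-1,-2,-3$. Each row of the exchange matrix is listed as (column 1, column 2, column 3). **Seed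 $\underline{\Sigma_1}$.** Ground ring $\mathbb{Z}[X_{-1},X_{-2},X_{-3}^{\pm1}]$. Matrix rows: $1:(0,-3,1)$; $2:(1,0,-1)$; $3:(-1,3,0)$; $-1:(1,0,0)$; $-2:(-1,1,0)$; $-3:(0,-3,2)$. Functions: $X_{-1}=\Delta^{w_0\omega_1}$, $X_{-3}=\Delta^{\omega_1}$, $X_1=\Delta^{s_2s_1s_2s_1\omega_1}$, $X_3=\Delta^{s_2s_1\omega_1}$, $X_{-2}=X_0(\Delta^{\omega_1}\Delta^{w_0\omega_1}+\Delta^{s_1\omega_1}\Delta^{s_2s_1s_2s_1\omega_1})-\Delta^{\omega_1}\Delta^{s_1s_2s_1\omega_1}\Delta^{s_2s_1s_2s_1\omega_1}-\Delta^{s_1\omega_1}\Delta^{s_2s_1\omega_1}\Delta^{w_0\omega_1}$, $X_2=\Delta^{s_1\omega_1}(\Delta^{s_2s_1\omega_1})^2-\Delta^{\omega_1}\Delta^{s_2s_1\omega_1}X_0-(\Delta^{\omega_1})^2\Delta^{s_2s_1s_2s_1\omega_1}$. **Seed $\underline{\Sigma_2}$.** Ground ring $\mathbb{Z}[Y_{-1},Y_{-2},Y_{-3}^{\pm1}]$. Matrix rows: $1:(0,-1,1)$; $2:(3,0,-3)$; $3:(-1,1,0)$; $-1:(1,0,0)$; $-2:(-3,1,0)$; $-3:(0,-1,2)$. Functions: $Y_{-1}=\Delta^{w_0\omega_2}$, $Y_{-3}=\Delta^{\omega_2}$, $Y_1=\Delta^{s_1s_2s_1s_2\omega_2}$, $Y_2=\frac16(f_1^\dagger)^2f_2^\dagger\Delta^{\omega_2}$,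 $Y_3=\Delta^{s_1s_2\omega_2}$, $Y_{-2}=(2f_1^\dagger f_2^\dagger-f_2^\dagger f_1^\dagger)Y_2$. *)

(* Defs.v *)
From HB Require Import structures.
From mathcomp Require Import all_boot all_order all_algebra.
From mathcomp Require Import all_classical reals topology normedtype derive.
From mathcomp Require Import complex.
From mathcomp Require mpoly.
From mathcomp Require Import ring.

Set Implicit Arguments.
Unset Strict Implicit.
Unset Printing Implicit Defensive.

Import Order.TTheory GRing.Theory Num.Theory.
Import numFieldNormedType.Exports.

Local Open Scope classical_set_scope.
Local Open Scope ring_scope.

Definition i1 : 'I_2 := ord0.
Definition i2 : 'I_2 := ord_max.

Lemma ord2P (i : 'I_2) : i = i1 \/ i = i2.
Proof. by case: i => [[|[|//]]] p; [left|right]; apply: val_inj. Qed.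

Section Chevalley.
Variable K : numFieldType.

(* The group is realised in the fundamental representation of highest weight
   omega_1, of dimension 7.  The basis v_0, ..., v_6 consists of weight vectors,
   of weights omega_1, alpha_1 + alpha_2, alpha_1, 0 and the opposite ones. *)
Definition Emx (i j : nat) : 'M[K]_7 := delta_mx (inord i) (inord j).

Definition che (i : 'I_2) : 'M[K]_7 :=
  if i == i1 then Emx 0 1 + 2 *: Emx 2 3 + Emx 3 4 + Emx 5 6
  else Emx 1 2 + Emx 4 5.
Definition chf (i : 'I_2) : 'M[K]_7 :=
  if i == i1 then Emx 1 0 + Emx 3 2 + 2 *: Emx 4 3 + Emx 6 5
  else Emx 2 1 + Emx 5 4.
Definition chh (i : 'I_2) : 'M[K]_7 :=
  if i == i1 then
    Emx 0 0 - Emx 1 1 + 2 *: Emx 2 2 - 2 *: Emx 4 4 + Emx 5 5 - Emx 6 6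
  else Emx 1 1 - Emx 2 2 + Emx 4 4 - Emx 5 5.

Definition cartan (i j : 'I_2) : int :=
  if i == j then 2 else if i == i1 then -3 else -1.

Definition brk (A B : 'M[K]_7) : 'M[K]_7 := A * B - B * A.

Lemma EE i j k l : (i < 7)%N -> (j < 7)%N -> (k < 7)%N -> (l < 7)%N ->
  Emx i j * Emx k l = if j == k then Emx i l else 0.
Proof.
move=> *; rewrite /Emx -[_ * _]/(_ *m _) mul_delta_mx_cond -val_eqE /= !inordK //.
by case: eqP; rewrite ?mulr1n ?mulr0n.
Qed.

(* Integral combinations of the matrices Emx i j, given by lists so that products
   can be computed. *)
Definition lc (s : seq (nat * nat * int)) : 'M[K]_7 :=
  \sum_(x <- s) x.2%:~R *: Emx x.1.1 x.1.2.

Definition lcok (s : seq (nat * nat * int)) :=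
  all (fun x => (x.1.1 < 7) && (x.1.2 < 7))%N s.

Definition lccoef (s : seq (nat * nat * int)) (i j : nat) : int :=
  foldr (fun x a => if (x.1.1 == i) && (x.1.2 == j) then x.2 + a else a) 0 s.

Definition lcmul (s t : seq (nat * nat * int)) : seq (nat * nat * int) :=
  flatten [seq [seq (a.1.1, b.1.2, a.2 * b.2) | b <- t & a.1.2 == b.1.1]
          | a <- s].

Definition lcopp (s : seq (nat * nat * int)) : seq (nat * nat * int) :=
  [seq (a.1, - a.2) | a <- s].

Lemma lcM s t : lcok s -> lcok t -> lc s * lc t = lc (lcmul s t).
Proof.
elim: s => [|[[i j] a] s IH] /=; first by rewrite /lc big_nil mul0r.
move=> /andP[/andP[hi hj] hs] ht.
have {IH hs} := IH hs ht; rewrite /lc /lcmul /= big_cons big_cat /= mulrDl => ->.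
congr (_ + _); rewrite big_map big_filter mulr_sumr [RHS]big_mkcond /=.
elim: t ht => [|[[k l] b] t IHt] /=; first by rewrite !big_nil.
move=> /andP[/andP[hk hl] ht]; rewrite !big_cons IHt //=; congr (_ + _).
rewrite -scalerAl -scalerAr EE // scalerA intrM.
by case: ifP => //; rewrite scaler0.
Qed.

Lemma lcN s : - lc s = lc (lcopp s).
Proof.
rewrite /lc big_map -sumrN; apply: eq_bigr => x _ /=.
by rewrite mulrNz scaleNr.
Qed.

Lemma lcD s t : lc s + lc t = lc (s ++ t).
Proof. by rewrite /lc big_cat. Qed.

Lemma lcE s (i j : 'I_7) : lcok s -> lc s i j = (lccoef s i j)%:~R.
Proof.
elim: s => [|[[k l] a] s IH] /=; first by rewrite /lc big_nil mxE.
move=> /andP[/andP[hk hl] hs].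
rewrite /lc big_cons mxE -/(lc s) IH // !mxE /=.
rewrite -!(inj_eq val_inj) /= !inordK // (eq_sym k) (eq_sym l).
by case: ifP => _; rewrite ?mulr1 ?mulr0 ?add0r ?intrD.
Qed.

Lemma lc_eq s t : lcok s -> lcok t ->
  all (fun i => all (fun j => lccoef s i j == lccoef t i j) (iota 0 7))
    (iota 0 7) -> lc s = lc t.
Proof.
move=> hs ht /allP H; apply/matrixP => i j; rewrite !lcE //.
have/H/allP/(_ j) : val i \in iota 0 7 by rewrite mem_iota ltn_ord.
by rewrite mem_iota ltn_ord => /(_ isT) /eqP ->.
Qed.

Definition ent (i j : nat) (a : int) := (i, j, a).

Definition tab_e (i : 'I_2) : seq (nat * nat * int) :=
  if i == i1 then [:: ent 0 1 1; ent 2 3 2; ent 3 4 1; ent 5 6 1]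
  else [:: ent 1 2 1; ent 4 5 1].
Definition tab_f (i : 'I_2) : seq (nat * nat * int) :=
  if i == i1 then [:: ent 1 0 1; ent 3 2 1; ent 4 3 2; ent 6 5 1]
  else [:: ent 2 1 1; ent 5 4 1].
Definition tab_h (i : 'I_2) : seq (nat * nat * int) :=
  if i == i1 then
    [:: ent 0 0 1; ent 1 1 (-1); ent 2 2 2; ent 4 4 (-2); ent 5 5 1; ent 6 6 (-1)]
  else [:: ent 1 1 1; ent 2 2 (-1); ent 4 4 1; ent 5 5 (-1)].

Lemma cheE i : che i = lc (tab_e i).
Proof.
by have [->|->] := ord2P i; rewrite /che /tab_e /lc /= !big_cons big_nil /=
  ?scale1r ?addr0 ?addrA.
Qed.

Lemma chfE i : chf i = lc (tab_f i).
Proof.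
by have [->|->] := ord2P i; rewrite /chf /tab_f /lc /= !big_cons big_nil /=
  ?scale1r ?addr0 ?addrA.
Qed.

Lemma chhE i : chh i = lc (tab_h i).
Proof.
by have [->|->] := ord2P i; rewrite /chh /tab_h /lc /= !big_cons big_nil /=
  ?mulrNz ?scaleNr ?scale1r ?addr0 ?addrA.
Qed.

Lemma lcbrk s t : lcok s -> lcok t ->
  brk (lc s) (lc t) = lc (lcmul s t ++ lcopp (lcmul t s)).
Proof. by move=> hs ht; rewrite /brk !lcM // lcN lcD. Qed.

Ltac lcsolve := apply: lc_eq; vm_compute; reflexivity.

(* The matrices above satisfy the Chevalley-Serre presentation of the simple
   Lie algebra of type G2, with alpha_1 short. *)
Lemma chevalley_serre :
  [/\ forall i j, brk (che i) (chf j) = if i == j then chh i else 0,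
      forall i j, brk (chh i) (chh j) = 0,
      forall i j, brk (chh i) (che j) = (cartan i j)%:~R *: che j /\
                  brk (chh i) (chf j) = - (cartan i j)%:~R *: chf j,
      iter 4 (brk (che i1)) (che i2) = 0 /\ iter 2 (brk (che i2)) (che i1) = 0
    & iter 4 (brk (chf i1)) (chf i2) = 0 /\ iter 2 (brk (chf i2)) (chf i1) = 0].
Proof.
have lc0 : 0 = lc [::] by rewrite /lc big_nil.
have lcZ (n : int) s : n%:~R *: lc s = lc [seq (x.1, n * x.2) | x <- s].
  rewrite /lc big_map scaler_sumr; apply: eq_bigr => x _ /=.
  by rewrite scalerA intrM.
have ok i : [/\ lcok (tab_e i), lcok (tab_f i) & lcok (tab_h i)].
  by have [->|->] := ord2P i.
split=> [i j|i j|i j||].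
- have [[? ? ?] [? ? ?]] := (ok i, ok j); rewrite cheE chfE chhE lcbrk //.
  by have [->|->] := ord2P i; have [->|->] := ord2P j; rewrite ?lc0 /=; lcsolve.
- have [[? ? ?] [? ? ?]] := (ok i, ok j); rewrite !chhE lcbrk //.
  by have [->|->] := ord2P i; have [->|->] := ord2P j; rewrite ?lc0 /=; lcsolve.
- have [[? ? ?] [? ? ?]] := (ok i, ok j).
  rewrite chhE cheE chfE -intrN !lcbrk // !lcZ.
  by have [->|->] := ord2P i; have [->|->] := ord2P j; split; lcsolve.
- by rewrite /= !cheE; split; do 4?[rewrite lcbrk //]; rewrite ?lc0; lcsolve.
- by rewrite /= !chfE; split; do 4?[rewrite lcbrk //]; rewrite ?lc0; lcsolve.
Qed.

(* Exponential of a nilpotent 7 x 7 matrix. *)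
Definition nexp (X : 'M[K]_7) : 'M[K]_7 := \sum_(k < 7) (k`!%:R)^-1 *: X ^+ k.

Definition root_mx (b : bool) (i : 'I_2) (t : K) : 'M[K]_7 :=
  nexp (t *: if b then che i else chf i).

Lemma root_cube (b : bool) i : (if b then che i else chf i) ^+ 3 = 0.
Proof.
have lc0 : 0 = lc [::] by rewrite /lc big_nil.
rewrite !exprS expr0 mulr1 lc0.
by case: b; rewrite ?cheE ?chfE; have [->|->] := ord2P i;
  rewrite !lcM //; lcsolve.
Qed.

Lemma root_mxE b i t (X := if b then che i else chf i) :
  root_mx b i t = 1 + t *: X + (t ^+ 2 / 2) *: X ^+ 2.
Proof.
have X0 k : X ^+ (3 + k) = 0 by rewrite exprD root_cube mul0r.
rewrite /root_mx /nexp -/X !big_ord_recl big_ord0 /= /bump /= !add1n.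
rewrite !exprZn (X0 0%N) (X0 1%N) (X0 2%N) (X0 3%N) !scaler0 !addr0 addrA.
by rewrite expr0 !expr1 !factS fact0 !muln1 invr1 !scale1r scalerA mulrC.
Qed.

Lemma root_mxNr b i t : root_mx b i t * root_mx b i (- t) = 1.
Proof.
rewrite !root_mxE sqrrN; set X := if b then _ else _.
have X3 : X * X ^+ 2 = 0 by rewrite -exprS root_cube.
have X3' : X ^+ 2 * X = 0 by rewrite -exprSr root_cube.
have X4 : X ^+ 2 * X ^+ 2 = 0 by rewrite {1}expr2 -mulrA X3 mulr0.
rewrite scaleNr; set Y := t *: X; set Z := _ *: _.
have YY : Y * Y = Z + Z.
  rewrite -scalerAl -scalerAr scalerA -expr2 -scalerDl; congr (_ *: _).
  by field.
have YZ : Y * Z = 0 by rewrite -scalerAl -scalerAr X3 !scaler0.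
have ZY : Z * Y = 0 by rewrite -scalerAl -scalerAr X3' !scaler0.
have ZZ : Z * Z = 0 by rewrite -scalerAl -scalerAr X4 !scaler0.
rewrite !(mulrDl, mulrDr) !mulrN YY YZ ZY ZZ !mul1r !mulr1 oppr0 !addr0.
have -> : Y - (Z + Z) = Y - Z - Z by rewrite opprD addrA.
by rewrite -addrA subrK addrACA subrK subrr addr0.
Qed.

Lemma root_mxVr b i t : root_mx b i (- t) * root_mx b i t = 1.
Proof. by have := root_mxNr b i (- t); rewrite opprK. Qed.

(* G is the subgroup of GL_7 generated by the one-parameter subgroups of the
   Chevalley generators.  It is a closed connected subgroup, with Lie algebra
   generated by the matrices che i and chf i. *)
Definition G2_pred : {pred 'M[K]_7} := [pred g | `[< exists
  w : seq (bool * 'I_2 * K), g = \prod_(l <- w) root_mx l.1.1 l.1.2 l.2 >]].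

Record G2 := MkG2 { G2val :> 'M[K]_7; G2valP : G2val \in G2_pred }.
HB.instance Definition _ := [isSub for G2val].
HB.instance Definition _ := [Choice of G2 by <:].

Lemma G2_1 : 1 \in G2_pred.
Proof. by apply/asboolP; exists [::]; rewrite big_nil. Qed.

Lemma G2_M g h : g \in G2_pred -> h \in G2_pred -> g * h \in G2_pred.
Proof.
move=> /asboolP[w ->] /asboolP[w' ->]; apply/asboolP.
by exists (w ++ w'); rewrite big_cat.
Qed.

Lemma G2_root b i t : root_mx b i t \in G2_pred.
Proof. by apply/asboolP; exists [:: (b, i, t)]; rewrite big_seq1. Qed.

Lemma G2_unitV (g : 'M[K]_7) : g \in G2_pred ->
  g \is a GRing.unit /\ g^-1 \in G2_pred.
Proof.
move=> /asboolP[w ->]; elim: w => [|[[b i] t] w [IHu IHv]].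
  by rewrite big_nil invr1 unitr1 G2_1.
have ru : root_mx b i t \is a GRing.unit.
  apply/unitrP; exists (root_mx b i (- t)).
  by rewrite root_mxNr root_mxVr.
have rv : (root_mx b i t)^-1 = root_mx b i (- t).
  by apply: (mulrI ru); rewrite divrr // root_mxNr.
rewrite big_cons /=; split; first by rewrite unitrMl.
by rewrite invrM // rv G2_M // G2_root.
Qed.

Definition G2mul (g h : G2) := MkG2 (G2_M (G2valP g) (G2valP h)).
Definition G2inv (g : G2) := MkG2 (G2_unitV (G2valP g)).2.
Definition G2one := MkG2 G2_1.

Fact G2mulA : associative G2mul.
Proof. by move=> g h k; apply: val_inj; rewrite /= mulrA. Qed.
Fact G2mul1 : left_id G2one G2mul.
Proof. by move=> g; apply: val_inj; rewrite /= mul1r. Qed.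
Fact G2mulr1 : right_id G2one G2mul.
Proof. by move=> g; apply: val_inj; rewrite /= mulr1. Qed.
Fact G2mulV : left_inverse G2one G2inv G2mul.
Proof.
by move=> g; apply: val_inj; rewrite /= mulVr //; case: (G2_unitV (G2valP g)).
Qed.
Fact G2mulrV : right_inverse G2one G2inv G2mul.
Proof.
by move=> g; apply: val_inj; rewrite /= divrr //; case: (G2_unitV (G2valP g)).
Qed.

HB.instance Definition _ := isGroup.Build G2
  G2mulA G2mul1 G2mulr1 G2mulV G2mulrV.
HB.instance Definition _ := isPointed.Build G2 G2one.

Definition xG (i : 'I_2) (t : K) : G2 := MkG2 (G2_root true i t).
Definition yG (i : 'I_2) (t : K) : G2 := MkG2 (G2_root false i t).

(* The images under phi_i : SL_2 -> G of the matrices (0 -1; 1 0) and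
   diag(t, t^-1), written as products of elementary matrices. *)
Definition sbar (i : 'I_2) : G2 := (xG i (-1) * yG i 1 * xG i (-1))%g.
Definition coroot (i : 'I_2) (t : K) : G2 :=
  (xG i t * yG i (- t^-1) * xG i t * sbar i)%g.

Lemma corootE i t : \val (coroot i t) =
  root_mx true i t * root_mx false i (- t^-1) * root_mx true i t *
  (root_mx true i (-1) * root_mx false i 1 * root_mx true i (-1)).
Proof. by []. Qed.

Definition wbar (w : seq 'I_2) : G2 := (\big[*%g/1]_(i <- w) sbar i)%g.

Definition subgroup_closed (A : set G2) :=
  [/\ A 1%g, forall g h, A g -> A h -> A (g * h)%g
    & forall g, A g -> A (g^-1)%g].
Definition Nplus : set G2 :=
  smallest subgroup_closed [set g | exists i t, g = xG i t].
Definition Nminus : set G2 :=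
  smallest subgroup_closed [set g | exists i t, g = yG i t].

(* The element a_1^(alpha_1^vee) a_2^(alpha_2^vee) of H, where a_1, a_2 != 0;
   as G is simply connected, every element of H has a unique such form. *)
Definition torus (a : 'I_2 -> K) : G2 :=
  (coroot i1 (a i1) * coroot i2 (a i2))%g.
(* Value at torus a of the weight lam i1 * omega_1 + lam i2 * omega_2. *)
Definition weight (lam : 'I_2 -> nat) (a : 'I_2 -> K) : K :=
  \prod_i a i ^+ lam i.
Definition omega (n : nat) (i : 'I_2) : 'I_2 -> nat :=
  fun j => if j == i then n else 0%N.

(* Regular functions on the closed subgroup G of SL_7: the polynomials in the
   matrix entries. *)
Definition subalgebra_closed (A : set (G2 -> K)) :=
  [/\ forall c, A (cst c), forall f g, A f -> A g -> A (f + g)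
    & forall f g, A f -> A g -> A (f * g)].
Definition regular : {pred (G2 -> K)} := [pred f | `[< smallest
  subalgebra_closed [set f | exists i j, f = fun g : G2 => g i j] f >]].

Lemma regularP f : reflect (smallest subalgebra_closed
  [set f | exists i j, f = fun g : G2 => g i j] f) (f \in regular).
Proof. exact: asboolP. Qed.

Lemma regular_cst c : cst c \in regular.
Proof. by apply/regularP => A [[+ _ _] _]; apply. Qed.

Lemma regular_entry i j : (fun g : G2 => g i j) \in regular.
Proof. by apply/regularP => A [_]; apply; exists i, j. Qed.

Lemma regularD f g : f \in regular -> g \in regular -> f + g \in regular.
Proof.
move=> /regularP hf /regularP hg; apply/regularP => A hA.
by have [[_ AD _] _] := hA; apply: AD; [exact: hf|exact: hg].
Qed.

Lemma regularM f g : f \in regular -> g \in regular -> f * g \in regular.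
Proof.
move=> /regularP hf /regularP hg; apply/regularP => A hA.
by have [[_ _ AM] _] := hA; apply: AM; [exact: hf|exact: hg].
Qed.

Lemma regular_ind (P : (G2 -> K) -> Prop) :
  (forall c, P (cst c)) ->
  (forall f g, f \in regular -> g \in regular -> P f -> P g -> P (f + g)) ->
  (forall f g, f \in regular -> g \in regular -> P f -> P g -> P (f * g)) ->
  (forall i j, P (fun g : G2 => g i j)) -> forall f, f \in regular -> P f.
Proof.
move=> hc hD hM he f /regularP hf.
have [] // : f \in regular /\ P f.
apply: (hf [set f | f \in regular /\ P f]); split; last first.
  by move=> _ [i [j ->]]; split; [exact: regular_entry|exact: he].
split=> [c|h k [hr hP] [kr kP]|h k [hr hP] [kr kP]].
- by split; [exact: regular_cst|exact: hc].
- by split; [exact: regularD|exact: hD].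
- by split; [exact: regularM|exact: hM].
Qed.

Lemma regular_sum (I : Type) (r : seq I) (F : I -> G2 -> K) :
  (forall i, F i \in regular) -> (fun g => \sum_(i <- r) F i g) \in regular.
Proof.
move=> hF; rewrite -fct_sumE; elim/big_rec: _ => [|i f _ hf].
  exact: (regular_cst 0).
by apply: regularD.
Qed.

Fact regular_subring : subring_closed regular.
Proof.
split=> [|f g hf hg|f g]; first exact: (regular_cst 1).
  rewrite -[- g]mulN1r -[X in X * g]/(- cst 1 : G2 -> K).
  apply: regularD => //; apply: regularM => //; exact: (regular_cst (-1)).
exact: regularM.
Qed.
HB.instance Definition _ := GRing.isSubringClosed.Build (G2 -> K) regular
  regular_subring.

Record CG := MkCG { CGval :> G2 -> K; CGvalP : CGval \in regular }.
HB.instance Definition _ := [isSub for CGval].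
HB.instance Definition _ := [Choice of CG by <:].
HB.instance Definition _ := [SubChoice_isSubComNzRing of CG by <:].

Definition CGunit : {pred CG} := [pred f | `[< exists g, g * f = 1 >]].
Definition CGinv (f : CG) : CG :=
  if pselect (exists g, g * f = 1) is left h then projT1 (cid h) else f.

Fact CG_mulVx : {in CGunit, left_inverse 1 CGinv *%R}.
Proof.
move=> f /asboolP hf; rewrite /CGinv; case: pselect => // h.
by case: (cid h).
Qed.
Fact CG_unitPl (f g : CG) : g * f = 1 -> CGunit f.
Proof. by move=> gf; apply/asboolP; exists g. Qed.
Fact CG_invr_out : {in [predC CGunit], CGinv =1 id}.
Proof. by move=> f /asboolP hf; rewrite /CGinv; case: pselect. Qed.
HB.instance Definition _ := GRing.ComNzRing_hasMulInverse.Build CG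
  CG_mulVx CG_unitPl CG_invr_out.

Definition polyfun (h : K -> K) := exists p : {poly K}, forall s, h s = p.[s].

Lemma polyfun_sum (I : finType) (F : I -> K -> K) :
  (forall k, polyfun (F k)) -> polyfun (fun s => \sum_k F k s).
Proof.
move=> /choice[p hp]; exists (\sum_k p k) => s.
by rewrite horner_sum; apply: eq_bigr => k _; rewrite hp.
Qed.

Lemma polyfunM h k : polyfun h -> polyfun k -> polyfun (fun s => h s * k s).
Proof. by move=> [p hp] [q hq]; exists (p * q) => s; rewrite hornerM hp hq. Qed.

Lemma polyfunD h k : polyfun h -> polyfun k -> polyfun (fun s => h s + k s).
Proof. by move=> [p hp] [q hq]; exists (p + q) => s; rewrite hornerD hp hq. Qed.

Definition curve (g : G2) (w : seq (bool * 'I_2 * K)) (s : K) : 'M[K]_7 :=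
  \val g * \prod_(l <- w) root_mx l.1.1 l.1.2 (s * l.2).

Lemma curve_in g w s : curve g w s \in G2_pred.
Proof.
apply: G2_M; first exact: valP.
elim: w => [|l w IH]; rewrite ?big_nil ?G2_1 // big_cons.
by apply: G2_M => //; apply: G2_root.
Qed.

Lemma curve_poly g w i j : polyfun (fun s => curve g w s i j).
Proof.
have mulP (A B : K -> 'M[K]_7) :
    (forall i j, polyfun (fun s => A s i j)) ->
    (forall i j, polyfun (fun s => B s i j)) ->
    forall i j, polyfun (fun s => (A s * B s) i j).
  move=> hA hB k l.
  have [p hp] := polyfun_sum (fun m => polyfunM (hA k m) (hB m l)).
  by exists p => s; rewrite -hp mxE.
rewrite /curve; move: i j; apply: (mulP _ _) => [i j|].
  by exists (\val g i j)%:P => s; rewrite hornerC.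
elim: w => [|l w IH] i j.
  by exists ((1 : 'M[K]_7) i j)%:P => s; rewrite big_nil hornerC.
have [|p hp] := mulP (fun s => root_mx l.1.1 l.1.2 (s * l.2)) _ _ IH i j.
  move=> a b; set X := if l.1.1 then che l.1.2 else chf l.1.2.
  exists (((1 : 'M[K]_7) a b)%:P + (l.2 * X a b) *: 'X
    + (l.2 ^+ 2 / 2 * (X ^+ 2) a b) *: 'X^2) => s.
  have gen (A B D : 'M[K]_7) u v :
      (A + u *: B + v *: D) a b = A a b + u * B a b + v * D a b.
    by rewrite !mxE.
  by rewrite root_mxE -/X gen !hornerE /=; ring.
by exists p => s; rewrite big_cons hp.
Qed.

(* G is irreducible, being generated by one-parameter subgroups. *)
Fact CG_integral : GRing.integral_domain_axiom CG.
Proof.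
move=> f1 f2 f0; case: (boolP (_ || _)) => // /norP[n1 n2]; exfalso.
have ex (f : CG) : f != 0 -> exists g, f g != 0.
  move=> nf; apply: contrapT => hn; case/eqP: nf; apply: val_inj.
  apply/funext => g /=; apply: contrapT => /eqP fg; apply: hn; by exists g.
have [g1 h1] := ex _ n1; have [g2 h2] := ex _ n2.
have /asboolP[w hw] : \val (g1^-1 * g2)%g \in G2_pred := valP (g1^-1 * g2)%g.
pose c s : G2 := MkG2 (curve_in g1 w s).
have c0 : c 0 = g1.
  apply: val_inj => /=; rewrite /curve big1 ?mulr1 // => l _.
  by rewrite mul0r root_mxE scale0r expr0n mul0r scale0r !addr0.
have c1 : c 1 = g2.
  rewrite -[g2](mulVKg g1); apply: val_inj => /=; rewrite /curve.
  congr (_ * _); rewrite -[RHS]/(\val (g1^-1 * g2)%g) hw.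
  by apply: eq_bigr => l _; rewrite mul1r.
have poly (f : CG) : polyfun (fun s => f (c s)).
  move: (valP f) => /=; move: (f : G2 -> K).
  apply: regular_ind => [a|h k _ _|h k _ _|i j].
  - by exists a%:P => s; rewrite hornerC.
  - exact: polyfunD.
  - exact: polyfunM.
  - exact: curve_poly.
have [p hp] := poly f1; have [q hq] := poly f2.
have pq0 : p * q = 0.
  apply: contrapT => /eqP npq.
  pose r := [seq (k%:R : K) | k <- iota 0 (size (p * q))].
  have : (size r < size (p * q)%R)%N.
    apply: max_poly_roots => //.
      apply/allP => _ /mapP[k _ ->]; rewrite /root hornerM -hp -hq.
      by rewrite -[_ * _]/(\val (f1 * f2) (c k%:R)) f0 eqxx.
    rewrite map_inj_uniq ?iota_uniq // => a b /eqP.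
    by rewrite eqr_nat => /eqP.
  by rewrite size_map size_iota ltnn.
move/eqP: pq0; rewrite mulf_eq0 => /orP[]/eqP z.
  by move: h1; rewrite -c0 hp z horner0 eqxx.
by move: h2; rewrite -c1 hq z horner0 eqxx.
Qed.
HB.instance Definition _ := GRing.ComUnitRing_isIntegral.Build CG CG_integral.

Lemma fdag_poly i f : f \in regular -> exists2 f', f' \in regular &
  forall g, exists p : {poly K},
    (forall t, f (g * yG i t)%g = p.[t]) /\ p^`().[0] = f' g.
Proof.
have y0 : yG i 0 = 1%g.
  apply: val_inj; rewrite /= root_mxE scale0r expr0n mul0r scale0r !addr0 //.
move: f; apply: regular_ind => [c|h k _ _ [h' hr hh] [k' kr kh]
    |h k hreg kreg [h' hr hh] [k' kr kh]|a b].
- exists (cst 0); first exact: regular_cst.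
  move=> g; exists c%:P; split=> [t|]; first by rewrite hornerC.
  by rewrite derivC horner0.
- exists (h' + k'); first exact: regularD.
  move=> g; have [p [hp dp]] := hh g; have [q [hq dq]] := kh g.
  exists (p + q); split=> [t|]; first by rewrite hornerD -hp -hq.
  by rewrite derivD hornerD dp dq.
- exists (h' * k + h * k'); first by apply: regularD; apply: regularM.
  move=> g; have [p [hp dp]] := hh g; have [q [hq dq]] := kh g.
  exists (p * q); split=> [t|]; first by rewrite hornerM -hp -hq.
  rewrite derivM hornerD !hornerM dp dq -hp -hq y0 mulg1.
  by [].
- exists (fun g : G2 => \sum_k g a k * chf i k b).
    apply: regular_sum => k; apply: regularM; first exact: regular_entry.
    exact: (regular_cst (chf i k b)).
  move=> g; set X := chf i.
  exists ((\val g a b)%:P + ((\val g * X) a b) *: 'X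
    + (2^-1 * (\val g * X ^+ 2) a b) *: 'X^2).
  have gen (A B D : 'M[K]_7) u v :
      (A + u *: B + v *: D) a b = A a b + u * B a b + v * D a b.
    by rewrite !mxE.
  split=> [t|].
    rewrite -[LHS]/((\val g * root_mx false i t) a b) root_mxE -/X.
    rewrite !mulrDr mulr1 -!scalerAr gen !hornerE /=; ring.
  rewrite !derivD derivC !derivZ derivX derivXn /= !hornerE /=.
  by rewrite mxE.
Qed.

Lemma derive_horner (p : {poly K}) x :
  derivable (horner p) x 1 /\ 'D_1 (horner p) x = p^`().[x].
Proof.
elim/poly_ind: p => [|p c [dp hp]].
  have -> : horner (0 : {poly K}) = cst 0 by apply/funext=> y; rewrite horner0.
  by split; [exact: derivable_cst|rewrite derive_cst deriv0 horner0].
have -> : horner (p * 'X + c%:P) = horner p * id + cst c.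
  by apply/funext => y; rewrite !hornerE.
have dX : derivable (horner p * (id : K -> K)) x 1.
  by apply: derivableM => //; exact: derivable_id.
have dc : derivable (cst c : K -> K) x 1 by exact: derivable_cst.
split; first exact: (derivableD dX dc).
rewrite (deriveD dX dc).
have di : derivable (id : K -> K) x 1 by exact: derivable_id.
rewrite derive_cst addr0 (deriveM dp di).
rewrite derive_id hp derivD derivC addr0 derivM derivX !hornerE.
by rewrite -[_ *: 1]/(_ * 1) -[x *: _]/(x * _) mulr1 addrC mulrC.
Qed.

(* (f_i^dagger f)(g) is the derivative of f (g y_i(t)) at t = 0. *)
Definition dag_fun (i : 'I_2) (f : G2 -> K) : G2 -> K :=
  fun g => 'D_1 (fun t : K => f (g * yG i t)%g) 0.

Fact dag_regular i f : f \in regular -> dag_fun i f \in regular.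
Proof.
move=> /(fdag_poly i)[f' f'r hf']; suff -> : dag_fun i f = f' by [].
apply/funext => g; have [p [hp dp]] := hf' g; rewrite /dag_fun -dp.
have -> : (fun t : K => f (g * yG i t)%g) = horner p by apply/funext.
by case: (derive_horner p 0).
Qed.

Definition fdag (i : 'I_2) (f : CG) : CG := MkCG (dag_regular i (valP f)).

Fact rtrans_regular (h : G2) f : f \in regular ->
  (fun g => f (g * h)%g) \in regular.
Proof.
move: f; apply: regular_ind => [c|f k _ _|f k _ _|i j].
- exact: (regular_cst c).
- exact: regularD.
- exact: regularM.
have -> : (fun g : G2 => (g * h)%g i j) = (fun g : G2 => \sum_k g i k * h k j).
  by apply/funext => g; rewrite mxE.
apply: regular_sum => k; apply: regularM; first exact: regular_entry.
exact: (regular_cst (h k j)).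
Qed.

Definition rtrans (h : G2) (f : CG) : CG :=
  MkCG (rtrans_regular h (valP f)).

Definition cstG (c : K) : CG := MkCG (regular_cst c).

Definition CNG : set CG :=
  [set f | forall n g, Nminus n -> f (n * g)%g = f g].

Definition submodule (M : set CG) :=
  [/\ M 0, forall f g, M f -> M g -> M (f + g),
      forall c f, M f -> M (cstG c * f) & forall h f, M f -> M (rtrans h f)].

Definition fin_dim (M : set CG) := exists s : seq CG, forall f, M f ->
  exists c : nat -> K, f = \sum_(k < size s) cstG (c k) * s`_k.

Definition irreducible (M : set CG) := (exists2 f, M f & f != 0) /\
  forall M', submodule M' -> M' `<=` M -> M' = [set 0] \/ M' = M.

Definition highest_weight (lam : 'I_2 -> nat) (M : set CG) :=
  exists v, [/\ M v, v != 0, forall u, Nplus u -> rtrans u v = v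
    & forall a, (forall i, a i != 0) ->
        rtrans (torus a) v = cstG (weight lam a) * v].

(* V_lam inside C[N^- \ G], where it occurs exactly once: there is a single
   submodule M as below. *)
Definition Vhw (lam : 'I_2 -> nat) : set CG :=
  [set f | exists M, [/\ submodule M, M `<=` CNG, fin_dim M,
                        irreducible M & highest_weight lam M] /\ M f].

Definition coord_ring (i : 'I_2) : set CG :=
  [set f | exists s : seq (nat * CG),
     (forall x, x \in s -> Vhw (omega x.1 i) x.2) /\ f = \sum_(x <- s) x.2].

Definition minor_spec (i : 'I_2) : set CG := [set f | forall n a u,
  Nminus n -> (forall j, a j != 0) -> Nplus u ->
  f (n * torus a * u)%g = weight (omega 1 i) a].

(* Delta^(omega_i), the regular extension of a function given on the big cell;
   it is unique since the big cell is dense, and exists by minorP below. *)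
Definition minor (i : 'I_2) : CG := xget 0 (minor_spec i).

Definition minorw (w : seq 'I_2) (i : 'I_2) : CG :=
  rtrans (wbar w) (minor i).

Lemma Emx_lc i j : Emx i j = lc [:: ent i j 1].
Proof. by rewrite /lc big_seq1 scale1r. Qed.

Lemma lc_nil : lc [::] = 0.
Proof. by rewrite /lc big_nil. Qed.

Lemma entryE (M : 'M[K]_7) i j :
  (Emx 0 i * M * Emx j 0) (inord 0) (inord 0) = M (inord i) (inord j).
Proof.
rewrite mxE (bigD1 (inord j)) //= [X in _ + X]big1 ?addr0; last first.
  by move=> k kj; rewrite [Emx j 0 _ _]mxE (negbTE kj) mulr0.
rewrite [Emx j 0 _ _]mxE !eqxx mulr1 mxE (bigD1 (inord i)) //=.
rewrite [X in _ + X]big1 ?addr0; last first.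
  by move=> k ki; rewrite [Emx 0 i _ _]mxE (negbTE ki) andbF mul0r.
by rewrite [Emx 0 i _ _]mxE !eqxx mul1r.
Qed.

Definition rootX (b : bool) (i : 'I_2) := if b then che i else chf i.

Lemma root_actl b i t u v : rootX b i * u = v -> rootX b i * v = 0 ->
  root_mx b i t * u = u + t *: v.
Proof.
move=> uv v0; rewrite root_mxE -/(rootX b i) !mulrDl mul1r -!scalerAl uv.
by rewrite expr2 -mulrA uv v0 scaler0 addr0.
Qed.

Lemma root_actr b i t u v : u * rootX b i = v -> v * rootX b i = 0 ->
  u * root_mx b i t = u + t *: v.
Proof.
move=> uv v0; rewrite root_mxE -/(rootX b i) !mulrDr mulr1 -!scalerAr uv.
by rewrite expr2 mulrA uv v0 scaler0 addr0.
Qed.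

Lemma coroot_act1 i t u : che i * u = 0 -> chf i * u = 0 ->
  \val (coroot i t) * u = u.
Proof.
move=> eu fu.
have he s : root_mx true i s * u = u.
  by rewrite (@root_actl true i s u 0) ?scaler0 ?addr0 ?mulr0.
have hf s : root_mx false i s * u = u.
  by rewrite (@root_actl false i s u 0) ?scaler0 ?addr0 ?mulr0.
by rewrite corootE -!mulrA he hf he he hf he.
Qed.

Lemma coroot_act2 i t u v : t != 0 -> che i * u = 0 -> chf i * u = v ->
  che i * v = u -> chf i * v = 0 ->
  \val (coroot i t) * u = t *: u /\ \val (coroot i t) * v = t^-1 *: v.
Proof.
move=> t0 eu fu ev fv.
have heu s : root_mx true i s * u = u.
  by rewrite (@root_actl true i s u 0) ?scaler0 ?addr0 ?mulr0.
have hfv s : root_mx false i s * v = v.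
  by rewrite (@root_actl false i s v 0) ?scaler0 ?addr0 ?mulr0.
have hfu s : root_mx false i s * u = u + s *: v by exact: root_actl.
have hev s : root_mx true i s * v = v + s *: u by exact: root_actl.
pose P c d := c *: u + d *: v.
have hx s c d : root_mx true i s * P c d = P (c + s * d) d.
  rewrite /P mulrDr -!scalerAr heu hev scalerDr scalerA [d *: v + _]addrC.
  by rewrite addrA -scalerDl [d * s]mulrC.
have hy s c d : root_mx false i s * P c d = P c (d + s * c).
  rewrite /P mulrDr -!scalerAr hfv hfu scalerDr scalerA -addrA -scalerDl.
  by rewrite [c * s]mulrC [s * c + d]addrC.
have hP c d : \val (coroot i t) * P c d = P (t * c) (t^-1 * d).
  rewrite corootE -!mulrA.
  rewrite hx hy hx hx hy hx; congr (_ *: _ + _ *: _).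
    by field.
  by field.
split.
  by have := hP 1 0; rewrite /P !scale0r mulr0 scale0r !addr0 mulr1 scale1r.
by have := hP 0 1; rewrite /P !scale0r mulr0 scale0r !add0r mulr1 scale1r.
Qed.

Lemma Nplus_cols u : Nplus u -> \val u * Emx 0 0 = Emx 0 0 /\
  exists c, \val u * Emx 1 0 = Emx 1 0 + c *: Emx 0 0.
Proof.
move=> /(_ [set u : G2 | \val u * Emx 0 0 = Emx 0 0 /\
  exists c, \val u * Emx 1 0 = Emx 1 0 + c *: Emx 0 0]); apply; split.
  split.
  - by split; [rewrite mul1r|exists 0; rewrite mul1r scale0r addr0].
  - move=> g h [g0 [c gc]] [h0 [d hd]]; split; first by rewrite /= -mulrA h0.
    exists (c + d); rewrite /= -mulrA hd mulrDr gc -scalerAr g0.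
    by rewrite -addrA -scalerDl.
  - move=> g [g0 [c gc]].
    have gu : (\val g)^-1 * \val g = 1.
      by have := mulVg g => /(congr1 val).
    have g0' : (\val g)^-1 * Emx 0 0 = Emx 0 0.
      by rewrite -{1}g0 mulrA gu mul1r.
    split=> //; exists (- c).
    have -> : Emx 1 0 = \val g * Emx 1 0 + (- c) *: Emx 0 0.
      by rewrite gc scaleNr addrK.
    rewrite mulrDr mulrA gu mul1r -scalerAr g0' gc.
    by rewrite scaleNr addrK.
move=> _ [i [t ->]]; rewrite !Emx_lc; have [->|->] := ord2P i; split=> /=.
- rewrite (@root_actl true i1 t _ 0) ?scaler0 ?addr0 ?mulr0 //.
  by rewrite /rootX cheE lcM // -lc_nil; lcsolve.
- exists t; apply: (@root_actl true i1); rewrite /rootX cheE lcM // -?lc_nil;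
  lcsolve.
- rewrite (@root_actl true i2 t _ 0) ?scaler0 ?addr0 ?mulr0 //.
  by rewrite /rootX cheE lcM // -lc_nil; lcsolve.
- exists 0; rewrite scale0r addr0.
  rewrite (@root_actl true i2 t _ 0) ?scaler0 ?addr0 ?mulr0 //.
  by rewrite /rootX cheE lcM // -lc_nil; lcsolve.
Qed.

Lemma Nminus_rows n : Nminus n -> Emx 0 0 * \val n = Emx 0 0 /\
  exists c, Emx 0 1 * \val n = Emx 0 1 + c *: Emx 0 0.
Proof.
move=> /(_ [set n : G2 | Emx 0 0 * \val n = Emx 0 0 /\
  exists c, Emx 0 1 * \val n = Emx 0 1 + c *: Emx 0 0]); apply; split.
  split.
  - by split; [rewrite mulr1|exists 0; rewrite mulr1 scale0r addr0].
  - move=> g h [g0 [c gc]] [h0 [d hd]]; split; first by rewrite /= mulrA g0.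
    exists (d + c); rewrite /= mulrA gc mulrDl hd -scalerAl h0.
    by rewrite -addrA -scalerDl.
  - move=> g [g0 [c gc]].
    have gu : \val g * (\val g)^-1 = 1.
      by have := mulgV g => /(congr1 val).
    have g0' : Emx 0 0 * (\val g)^-1 = Emx 0 0.
      by rewrite -{1}g0 -mulrA gu mulr1.
    split=> //; exists (- c).
    have -> : Emx 0 1 = Emx 0 1 * \val g + (- c) *: Emx 0 0.
      by rewrite gc scaleNr addrK.
    rewrite mulrDl -mulrA gu mulr1 -scalerAl g0' gc.
    by rewrite scaleNr addrK.
move=> _ [i [t ->]]; rewrite !Emx_lc; have [->|->] := ord2P i; split=> /=.
- rewrite (@root_actr false i1 t _ 0) ?scaler0 ?addr0 ?mul0r //.
  by rewrite /rootX chfE lcM // -lc_nil; lcsolve.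
- exists t; apply: (@root_actr false i1); rewrite /rootX chfE lcM // -?lc_nil;
  lcsolve.
- rewrite (@root_actr false i2 t _ 0) ?scaler0 ?addr0 ?mul0r //.
  by rewrite /rootX chfE lcM // -lc_nil; lcsolve.
- exists 0; rewrite scale0r addr0.
  rewrite (@root_actr false i2 t _ 0) ?scaler0 ?addr0 ?mul0r //.
  by rewrite /rootX chfE lcM // -lc_nil; lcsolve.
Qed.

Lemma torus_cols a : (forall j, a j != 0) ->
  \val (torus a) * Emx 0 0 = a i1 *: Emx 0 0 /\
  \val (torus a) * Emx 1 0 = ((a i1)^-1 * a i2) *: Emx 1 0.
Proof.
move=> a0.
have [h1 h2] : \val (coroot i1 (a i1)) * Emx 0 0 = a i1 *: Emx 0 0 /\
    \val (coroot i1 (a i1)) * Emx 1 0 = (a i1)^-1 *: Emx 1 0.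
  apply: coroot_act2; rewrite // ?cheE ?chfE !Emx_lc lcM // -?lc_nil; lcsolve.
have h3 : \val (coroot i2 (a i2)) * Emx 0 0 = Emx 0 0.
  apply: coroot_act1; rewrite // ?cheE ?chfE !Emx_lc lcM // -?lc_nil; lcsolve.
have [h4 _] : \val (coroot i2 (a i2)) * Emx 1 0 = a i2 *: Emx 1 0 /\
    \val (coroot i2 (a i2)) * Emx 2 0 = (a i2)^-1 *: Emx 2 0.
  apply: coroot_act2; rewrite // ?cheE ?chfE !Emx_lc lcM // -?lc_nil; lcsolve.
have gen (A B : 'M[K]_7) x y z : A * Emx 0 0 = x *: Emx 0 0 ->
    A * Emx 1 0 = y *: Emx 1 0 -> B * Emx 0 0 = Emx 0 0 ->
    B * Emx 1 0 = z *: Emx 1 0 ->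
    A * B * Emx 0 0 = x *: Emx 0 0 /\ A * B * Emx 1 0 = (y * z) *: Emx 1 0.
  move=> A0 A1 B0 B1; rewrite -!mulrA B0 B1 A0 -scalerAr A1 scalerA.
  by rewrite [z * y]mulrC.
exact: gen h1 h2 h3 h4.
Qed.

Definition entry (i j : nat) : CG := MkCG (regular_entry (inord i) (inord j)).

Lemma big_cell_entries (A B C : 'M[K]_7) (x y c d : K) :
  Emx 0 0 * A = Emx 0 0 -> Emx 0 1 * A = Emx 0 1 + d *: Emx 0 0 ->
  B * Emx 0 0 = x *: Emx 0 0 -> B * Emx 1 0 = y *: Emx 1 0 ->
  C * Emx 0 0 = Emx 0 0 -> C * Emx 1 0 = Emx 1 0 + c *: Emx 0 0 ->
  let M := A * B * C in
  [/\ M (inord 0) (inord 0) = x, M (inord 0) (inord 1) = c * x,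
      M (inord 1) (inord 0) = d * x & M (inord 1) (inord 1) = y + d * c * x].
Proof.
move=> A0 A1 B0 B1 C0 C1 M.
have asc k l : Emx 0 k * M * Emx l 0 = (Emx 0 k * A) * (B * (C * Emx l 0)).
  by rewrite /M !mulrA.
have e1 : Emx 0 0 (inord 0) (inord 0) = 1 :> K by rewrite mxE !eqxx.
have sc z : (z *: Emx 0 0) (inord 0) (inord 0) = z by rewrite mxE e1 mulr1.
split; rewrite -entryE asc.
- by rewrite A0 C0 B0 -scalerAr EE //= sc.
- rewrite A0 C1 mulrDr B1 -scalerAr B0 mulrDr -!scalerAr !EE //=.
  by rewrite scaler0 add0r scalerA sc.
- rewrite A1 C0 B0 -scalerAr mulrDl -scalerAl !EE //=.
  by rewrite add0r scalerA sc mulrC.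
- rewrite A1 C1 mulrDr B1 -scalerAr B0 mulrDr !mulrDl -!(scalerAr, scalerAl).
  rewrite !EE //= !scaler0 !addr0 !add0r !scalerA -scalerDl sc.
  by rewrite -[(d * c) *: x]/(d * c * x); ring.
Qed.

Lemma minor_exists i : exists f, minor_spec i f.
Proof.
have big n a u : Nminus n -> (forall j, a j != 0) -> Nplus u ->
    exists c d, [/\ entry 0 0 (n * torus a * u)%g = a i1,
      entry 0 1 (n * torus a * u)%g = c * a i1,
      entry 1 0 (n * torus a * u)%g = d * a i1 &
      entry 1 1 (n * torus a * u)%g = (a i1)^-1 * a i2 + d * c * a i1].
  move=> /Nminus_rows[n0 [d nd]] a0 /Nplus_cols[u0 [c uc]].
  have [t0 t1] := torus_cols a0; exists c, d.
  exact: (big_cell_entries n0 nd t0 t1 u0 uc).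
have w1 (a : 'I_2 -> K) : weight (omega 1 i1) a = a i1.
  by rewrite /weight !big_ord_recl big_ord0 /omega /= expr1 expr0 !mulr1.
have w2 (a : 'I_2 -> K) : weight (omega 1 i2) a = a i2.
  rewrite /weight !big_ord_recl big_ord0 /omega /= expr0 mul1r mulr1 expr1.
  by congr a; apply: val_inj.
have [->|->] := ord2P i.
  by exists (entry 0 0) => n a u hn a0 hu; have [c [d []]] := big n a u hn a0 hu;
    rewrite w1.
exists (entry 0 0 * entry 1 1 - entry 0 1 * entry 1 0) => n a u hn a0 hu.
have [c [d [h1 h2 h3 h4]]] := big n a u hn a0 hu.
set g := (n * torus a * u)%g in h1 h2 h3 h4 *.
rewrite -[LHS]/(entry 0 0 g * entry 1 1 g - entry 0 1 g * entry 1 0 g).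
by rewrite h1 h2 h3 h4 w2; field; apply: a0.
Qed.

Lemma minorP i : minor_spec i (minor i).
Proof. by rewrite /minor; have [f /(xgetI 0)] := minor_exists i. Qed.

End Chevalley.

Arguments coord_ring : clear implicits.

Section ClusterAlgebra.
Variables (K F : fieldType) (iota : K -> F) (I J : finType).

Record seed := Seed { svar : I + J -> F; smat : I + J -> I -> int }.

(* The extended cluster is algebraically independent over K. *)
Definition is_seed (s : seed) :=
  injective (mpoly.mmap iota (fun k => svar s (enum_val k))
    : mpoly.mpoly #|{: I + J}| K -> F) /\
  exists2 d : I -> int, forall i, 0 < d i &
    forall i j, d i * smat s (inl i) j = - (d j * smat s (inl j) i).

Definition ppart (b : int) : nat := absz (Num.max 0 b).

Definition mutate (k : I) (s : seed) : seed := {|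
  svar := fun i => if i == inl k then
      (\prod_i svar s i ^+ ppart (smat s i k)
       + \prod_i svar s i ^+ ppart (- smat s i k)) / svar s (inl k)
    else svar s i;
  smat := fun i j => if (i == inl k) || (j == k) then - smat s i j
    else smat s i j
         + Num.sg (smat s i k) * Num.max 0 (smat s i k * smat s (inl k) j) |}.

Definition mutations (w : seq I) (s : seed) : seed :=
  foldl (fun t k => mutate k t) s w.

Definition subring_closed_set (A : set F) :=
  [/\ A 1, forall x y, A x -> A y -> A (x - y)
    & forall x y, A x -> A y -> A (x * y)].
Definition subspace_closed_set (A : set F) :=
  [/\ A 0, forall x y, A x -> A y -> A (x + y)
    & forall c x, A x -> A (iota c * x)].

(* The ground ring is generated over Z by the coefficients and by the inverses
   of the coefficients with index in L. *)
Definition cluster_algebra (L : {set J}) (s : seed) : set F :=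
  smallest subring_closed_set
    ([set x | exists j, x = svar s (inr j)] `|`
     [set x | exists2 j, j \in L & x = (svar s (inr j))^-1] `|`
     [set x | exists w i, x = svar (mutations w s) (inl i)]).

(* Extension of scalars.  The cluster algebra A lies in Q(x), where x is the
   extended cluster of s; when K has characteristic 0 and x is algebraically
   independent over K, the map from the tensor product of Q(x) and K over Q
   to K(x) is injective, so that the K-span of A in F is the tensor product of A
   and K over Z. *)
Definition cluster_algebra_ext (L : {set J}) (s : seed) : set F :=
  smallest subspace_closed_set (cluster_algebra L s).

End ClusterAlgebra.

Section Seeds.
Variable K : numFieldType.

Local Notation "x %:F" := (FracField.tofrac x).

(* The scalars of the field of rational functions on G. *)
Definition scal (c : K) : {fraction (CG K)} := (cstG c)%:F.

(* Words in the simple reflections, with 1 and 2 standing for s_1 and s_2. *)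
Definition Delta (i : 'I_2) (w : seq nat) : CG K :=
  minorw K [seq if k == 1%N then i1 else i2 | k <- w] i.
Definition w0 : seq nat := [:: 1; 2; 1; 2; 1; 2]%N.

Definition X0 : CG K :=
  cstG 2^-1 * fdag i1 (fdag i2 (fdag i1 (minor K i1))).

Definition seed_of (xs ys : seq (CG K)) (b : seq (seq int)) :
  seed {fraction (CG K)} 'I_3 'I_3 := {|
  svar := fun k : 'I_3 + 'I_3 =>
    (match k with inl i => nth 0 xs i | inr j => nth 0 ys j end)%:F;
  smat := fun k (l : 'I_3) =>
    nth 0 (nth [::] b match k with inl i => i | inr j => (3 + j)%N end) l |}.

(* The lists run over the indices 1, 2, 3, then -1, -2, -3. *)
Definition Sigma1 : seed {fraction (CG K)} 'I_3 'I_3 := seed_of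
  [:: Delta i1 [:: 2; 1; 2; 1]%N;
      Delta i1 [:: 1]%N * Delta i1 [:: 2; 1]%N ^+ 2
      - Delta i1 [::] * Delta i1 [:: 2; 1]%N * X0
      - Delta i1 [::] ^+ 2 * Delta i1 [:: 2; 1; 2; 1]%N;
      Delta i1 [:: 2; 1]%N]
  [:: Delta i1 w0;
      X0 * (Delta i1 [::] * Delta i1 w0
            + Delta i1 [:: 1]%N * Delta i1 [:: 2; 1; 2; 1]%N)
      - Delta i1 [::] * Delta i1 [:: 1; 2; 1]%N * Delta i1 [:: 2; 1; 2; 1]%N
      - Delta i1 [:: 1]%N * Delta i1 [:: 2; 1]%N * Delta i1 w0;
      Delta i1 [::]]
  [:: [:: 0; -3; 1]; [:: 1; 0; -1]; [:: -1; 3; 0];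
      [:: 1; 0; 0]; [:: -1; 1; 0]; [:: 0; -3; 2]].

Definition Y2 : CG K :=
  cstG 6^-1 * fdag i1 (fdag i1 (fdag i2 (minor K i2))).

Definition Sigma2 : seed {fraction (CG K)} 'I_3 'I_3 := seed_of
  [:: Delta i2 [:: 1; 2; 1; 2]%N; Y2; Delta i2 [:: 1; 2]%N]
  [:: Delta i2 w0;
      2 * fdag i1 (fdag i2 Y2) - fdag i2 (fdag i1 Y2);
      Delta i2 [::]]
  [:: [:: 0; -1; 1]; [:: 3; 0; -3]; [:: -1; 1; 0];
      [:: 1; 0; 0]; [:: -3; 1; 0]; [:: 0; -1; 2]].

Definition Sigma (i : 'I_2) := if i == i1 then Sigma1 else Sigma2.

Definition localization (A S : set (CG K)) : set {fraction (CG K)} :=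
  [set z | exists a s, [/\ A a, S s & z = a%:F / s%:F]].

End Seeds.

(* Main.v *)
Require Import Defs.
From HB Require Import structures.
From mathcomp Require Import all_boot all_order all_algebra.
From mathcomp Require Import all_classical reals complex.
From mathcomp Require mpoly.
From mathcomp Require Import zify ring.

(* Both sides are equal to the same ring B = K[t^+-1, a, b, c, d, e], where t is the
   minor Delta^(omega_i): the open subset t <> 0 of P^- \ G is an affine space of
   dimension 5.

   Localization.  The coordinates of the fundamental representation V carry a
   Hermitian form that is contravariant for the compact form of G.  By positivity, the
   translates of the highest weight vector t^n span the space of all polynomials of
   degree n in the coordinates, so that this space is irreducible, hence equal to
   V_(n omega_i).  The localization is therefore generated by the coordinates and t^-1;
   the invariant quadric, the Pluecker relations and the vanishing of the
   cross product of the first two rows express the coordinates in terms of six of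
   them, which are algebraically independent because root vectors act on them in a
   triangular way.

   Cluster algebra.  For the inclusion in B, the argument of the Starfish lemma is
   used for B itself: the conditions that the members of the extended cluster are
   pairwise coprime in B, and that B is contained in the algebras generated by
   the neighbour of x_r, all members of the extended cluster and the inverses of those
   other than x_r, are inherited by mutation.  For the other inclusion, the generators
   of B are recovered from a few cluster variables. *)

Set Implicit Arguments.
Unset Strict Implicit.
Unset Printing Implicit Defensive.
Import Order.TTheory GRing.Theory Num.Theory.

Local Open Scope classical_set_scope.
Local Open Scope ring_scope.

(** * Subalgebras and derivations of a field *)

Section Subalgebras.
Variables (K : numFieldType) (F : fieldType) (iota : {rmorphism K -> F}).

(** The usual proof of the Starfish lemma takes the target ring normal or factorial and argues with
    primes of height one. Here every ring is a subset of one field, and coprimality of a and b means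
    that b is not a zero divisor modulo a, a statement about quotients only. Three conditions have
    to be carried along together, since each is used to mutate the others: coprimality, membership
    of the neighbours in B, and the inclusions of B. The delicate pair is x_r and the neighbour of
    x_k when x_r does not occur in the exchange relation: then 1 + u, with u a Laurent monomial,
    must be regular modulo x_r. This follows from a grading in which u has degree 1 while x_r and
    all other neighbours are homogeneous; it exists because the exchange matrix has full rank over
    the integers. Independence is expressed by derivations with prescribed values: a coordinate is
    exchanged for another by computing one partial derivative, and on the group the derivations are
    root vectors of the Lie algebra. *)

Definition Ksubalg (A : set F) :=
  [/\ forall c, A (iota c), forall x y, A x -> A y -> A (x + y)
    & forall x y, A x -> A y -> A (x * y)].

Definition alg (G : set F) : set F := smallest Ksubalg G.

Lemma alg_closed G : Ksubalg (alg G).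
Proof.
split=> [c|x y hx hy|x y hx hy] A [cA GA]; have [cA1 cA2 cA3] := cA.
- exact: cA1.
- by apply: cA2; [exact: hx|exact: hy].
- by apply: cA3; [exact: hx|exact: hy].
Qed.

Lemma alg_gen (G : set F) x : G x -> alg G x.
Proof. by move=> Gx A [_]; apply. Qed.

Lemma alg_min (G A : set F) : Ksubalg A -> G `<=` A -> alg G `<=` A.
Proof. by move=> cA GA x; apply; split. Qed.

Section Closed.
Variables (A : set F) (cA : Ksubalg A).

Lemma sa_const c : A (iota c). Proof. by case: cA. Qed.
Lemma saD x y : A x -> A y -> A (x + y). Proof. by case: cA => _ + _; apply. Qed.
Lemma saM x y : A x -> A y -> A (x * y). Proof. by case: cA => _ _; apply. Qed.
Lemma sa1 : A 1. Proof. by rewrite -(rmorph1 iota); apply: sa_const. Qed.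
Lemma sa0 : A 0. Proof. by rewrite -(rmorph0 iota); apply: sa_const. Qed.
Lemma saN x : A x -> A (- x).
Proof.
move=> hx; rewrite -mulN1r; apply: saM => //.
by rewrite -(rmorphN1 iota); apply: sa_const.
Qed.
Lemma saB x y : A x -> A y -> A (x - y).
Proof. by move=> hx hy; apply: saD => //; apply: saN. Qed.
Lemma saX x n : A x -> A (x ^+ n).
Proof.
move=> hx; elim: n => [|n IH]; rewrite ?expr0 ?exprS; first exact: sa1.
exact: saM.
Qed.
Lemma sa_nat n : A n%:R.
Proof. by rewrite -(rmorph_nat iota); apply: sa_const. Qed.
Lemma sa_prod (T : Type) (r : seq T) (P : pred T) (f : T -> F) :
  (forall i, P i -> A (f i)) -> A (\prod_(i <- r | P i) f i).
Proof.
move=> hf; elim/big_rec: _ => [|i x Pi hx]; first exact: sa1.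
by apply: saM => //; apply: hf.
Qed.
Lemma sa_sum (T : Type) (r : seq T) (P : pred T) (f : T -> F) :
  (forall i, P i -> A (f i)) -> A (\sum_(i <- r | P i) f i).
Proof.
move=> hf; elim/big_rec: _ => [|i x Pi hx]; first exact: sa0.
by apply: saD => //; apply: hf.
Qed.

(* [cop a b] says that b is regular modulo a in A. *)
Definition cop (a b : F) := forall p, A p -> A (p * b / a) -> A (p / a).

(** The test element is the quotient p a / b: its product with b is p a, which is divisible by a. *)
Lemma cop_sym a b : a != 0 -> b != 0 -> cop a b -> cop b a.
Proof.
move=> a0 b0 h p hp hpa.
have -> : p / b = (p * a / b) / a by field; rewrite a0 b0.
apply: h => //; suff -> : p * a / b * b / a = p by [].
by field; rewrite a0 b0.
Qed.

Lemma copM a b c : A b -> cop a b -> cop a c -> cop a (b * c).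
Proof.
move=> hb hab hac p hp; rewrite mulrA => h; apply: hab => //.
by apply: hac => //; apply: saM.
Qed.

Lemma cop1 a : cop a 1.
Proof. by move=> p _; rewrite mulr1. Qed.

Lemma copX a b n : A b -> cop a b -> cop a (b ^+ n).
Proof.
move=> hb hab; elim: n => [|n IH]; rewrite ?expr0 ?exprS; first exact: cop1.
exact: copM.
Qed.

(** Serves with b a cluster variable and c its neighbour: the product is the exchange binomial,
    whose coprimality to a is visible. *)
Lemma cop_factor a b c : A c -> cop a (b * c) -> cop a b.
Proof.
move=> hc h p hp hb; apply: h => //.
have -> : p * (b * c) / a = p * b / a * c by rewrite mulrA mulrAC.
exact: saM.
Qed.

Lemma cop_inv a b : b != 0 -> A b^-1 -> cop a b.
Proof.
move=> b0 hb p hp h; have -> : p / a = p * b / a * b^-1.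
  by rewrite mulrAC mulfK.
exact: saM.
Qed.

Lemma cop_invl a b : A a^-1 -> cop a b.
Proof. by move=> ha p hp _; apply: saM. Qed.

Lemma cop_addl a b c : a != 0 -> A c -> cop a b -> cop a (b + a * c).
Proof.
move=> a0 hc h p hp hs; apply: h => //.
have -> : p * b / a = p * (b + a * c) / a - p * c by field.
by apply: saB => //; apply: saM.
Qed.

Lemma cop_prod (T : Type) (r : seq T) (P : pred T) (f : T -> F) a :
  (forall i, P i -> A (f i)) -> (forall i, P i -> cop a (f i)) ->
  cop a (\prod_(i <- r | P i) f i).
Proof.
move=> hA hf; suff [] : A (\prod_(i <- r | P i) f i) /\
  cop a (\prod_(i <- r | P i) f i) by [].
elim/big_rec: _ => [|i x Pi [Ax hx]]; first by split; [exact: sa1|exact: cop1].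
by split; [apply: saM => //; apply: hA|apply: copM => //; [apply: hA|apply: hf]].
Qed.
End Closed.
End Subalgebras.

(** * Derivations, and the gradings given by their eigenvalues *)

Section Derivations.
Variables (K : numFieldType) (F : fieldType) (iota : {rmorphism K -> F}).

Definition der (D : F -> F) := [/\ forall x y, D (x + y) = D x + D y,
  forall x y, D (x * y) = D x * y + x * D y & forall c, D (iota c) = 0].

Lemma der_sum D E a b : der D -> der E -> der (fun x => a * D x + b * E x).
Proof.
move=> [D1 D2 D3] [E1 E2 E3]; split=> [x y|x y|c].
- by rewrite D1 E1; ring.
- by rewrite D2 E2; ring.
- by rewrite D3 E3; ring.
Qed.

Lemma der_brk D E : der D -> der E -> der (fun x => D (E x) - E (D x)).
Proof.
move=> [D1 D2 D3] [E1 E2 E3].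
have D0 : D 0 = 0 by have := D3 0; rewrite rmorph0.
have E0 : E 0 = 0 by have := E3 0; rewrite rmorph0.
split=> [x y|x y|c].
- by rewrite E1 D1 D1 E1; ring.
- by rewrite E2 D1 !D2 E1 !E2; ring.
- by rewrite D3 E3 D0 E0 subrr.
Qed.

Section OneDerivation.
Variables (D : F -> F) (hD : der D).

Lemma derD x y : D (x + y) = D x + D y. Proof. by case: hD. Qed.
Lemma derM x y : D (x * y) = D x * y + x * D y. Proof. by case: hD. Qed.
Lemma derC c : D (iota c) = 0. Proof. by case: hD. Qed.
Lemma der0 : D 0 = 0. Proof. by have := derC 0; rewrite rmorph0. Qed.
Lemma der1 : D 1 = 0. Proof. by have := derC 1; rewrite rmorph1. Qed.
Lemma der_nat n : D n%:R = 0. Proof. by rewrite -(rmorph_nat iota) derC. Qed.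
Lemma derN x : D (- x) = - D x.
Proof. by apply/eqP; rewrite -subr_eq0 opprK -derD addNr der0. Qed.
Lemma derB x y : D (x - y) = D x - D y. Proof. by rewrite derD derN. Qed.
Lemma der_bigsum (T : Type) (r : seq T) (P : pred T) (f : T -> F) :
  D (\sum_(i <- r | P i) f i) = \sum_(i <- r | P i) D (f i).
Proof. by apply: (big_morph D derD der0). Qed.
Lemma derX x n : D (x ^+ n) = n%:R * x ^+ n.-1 * D x.
Proof.
elim: n => [|n IH]; first by rewrite expr0 der1 !mul0r.
rewrite exprS derM IH /=; case: n {IH} => [|n] /=; last first.
  by rewrite -[n.+2%:R]natr1 !exprS; ring.
by rewrite expr0; ring.
Qed.
Lemma derV x : x != 0 -> D x^-1 = - D x / x ^+ 2.
Proof.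
move=> x0; have : D (x * x^-1) = 0 by rewrite divff // der1.
rewrite derM => /eqP; rewrite addrC addr_eq0 => /eqP e.
by apply: (mulfI x0); rewrite e; field.
Qed.

(** D plays the Euler field of a grading, and its eigenvectors of eigenvalue n are the homogeneous
    elements of degree n. *)
Definition eigen (n : int) (z : F) := D z = n%:~R * z.

Lemma eigen1 : eigen 0 1. Proof. by rewrite /eigen der1 mul0r. Qed.
Lemma eigenC c : eigen 0 (iota c). Proof. by rewrite /eigen derC mul0r. Qed.
Lemma eigenM m n y z : eigen m y -> eigen n z -> eigen (m + n) (y * z).
Proof. by rewrite /eigen derM intrD => -> ->; ring. Qed.
Lemma eigenD n y z : eigen n y -> eigen n z -> eigen n (y + z).
Proof. by rewrite /eigen derD => -> ->; ring. Qed.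
Lemma eigenV n z : z != 0 -> eigen n z -> eigen (- n) z^-1.
Proof. by rewrite /eigen => z0 h; rewrite derV // h intrN; field. Qed.
Lemma eigenX n z k : eigen n z -> eigen (k%:Z * n) (z ^+ k).
Proof.
move=> h; elim: k => [|k IH]; first by rewrite expr0 mul0r; apply: eigen1.
by rewrite exprS -add1n PoszD mulrDl mul1r; apply: eigenM.
Qed.
Lemma eigen_prod (T : finType) (d : T -> int) (x : T -> F) (g : T -> nat) :
  (forall r, eigen (d r) (x r)) ->
  eigen (\sum_r (g r)%:Z * d r) (\prod_r x r ^+ g r).
Proof.
move=> h; elim/big_rec2: _ => [|r n z _ hz]; first exact: eigen1.
by apply: eigenM => //; apply: eigenX.
Qed.

(* A D-stable subspace contains the components of its elements for the grading by
   the eigenvalues of D. *)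
Lemma eigen_components (I : set F) (q : nat -> F) (a : int) (N : nat) :
  (forall x y, I x -> I y -> I (x + y)) -> (forall c x, I x -> I (iota c * x)) ->
  (forall x, I x -> I (D x)) -> (forall i, eigen (a + i%:Z) (q i)) ->
  I (\sum_(i < N) q i) -> forall i, (i < N)%N -> I (q i).
Proof.
move=> ID IZ IDer; elim: N q => [//|N IH] q hq hs.
have Iz n x : I x -> I (n%:~R * x).
  by move=> hx; rewrite -(rmorph_int iota); apply: IZ.
have hlt i : (i < N)%N -> I (q i).
  (* Applying D - (a + N) to the sum kills q N and multiplies every other q i by i - N, which is
     invertible in characteristic 0. *)
  move=> iN; pose q' i := ((i%:Z - N%:Z)%:~R : F) * q i.
  have hq' j : eigen (a + j%:Z) (q' j).
    rewrite /q' -[X in eigen X]add0r -(rmorph_int iota).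
    by apply: eigenM => //; apply: eigenC.
  have h hs' : I (q' i) := IH q' hq' hs' i iN; rewrite /q' in h.
  have c0 : ((i%:Z - N%:Z)%:~R : K) != 0 by rewrite intr_eq0; lia.
  suff -> : q i = iota ((i%:Z - N%:Z)%:~R^-1) * (((i%:Z - N%:Z)%:~R : F) * q i).
    apply: IZ; apply: h.
    have -> : \sum_(j < N) ((j%:Z - N%:Z)%:~R : F) * q j =
      D (\sum_(j < N.+1) q j) + (- (a + N%:Z))%:~R * \sum_(j < N.+1) q j.
      rewrite der_bigsum mulr_sumr -big_split /= big_ord_recr /=.
      rewrite (hq N) -mulrDl -intrD subrr mul0r addr0.
      apply: eq_bigr => j _; rewrite (hq j) -mulrDl -intrD; congr (_%:~R * _).
      lia.
    by apply: ID; [exact: IDer|exact: Iz].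
  by rewrite mulrA -(rmorph_int iota) -rmorphM /= mulVf // rmorph1 mul1r.
move=> i; rewrite ltnS leq_eqVlt => /orP[/eqP ->|]; last exact: hlt.
have -> : q N = \sum_(i < N.+1) q i + (-1)%:~R * \sum_(i < N) q i.
  by rewrite big_ord_recr /= mulrN1z mulN1r addrAC subrr add0r.
apply: (ID) => //; apply: (Iz); elim/big_rec: _ => [|j x _ hx].
  by have := Iz 0 _ hs; rewrite mul0r.
by apply: ID => //; apply: hlt.
Qed.

Section Graded.
Variables (C : set F) (cC : Ksubalg iota C).

Definition homsum (z : F) := exists l : seq (int * F),
  (forall p, p \in l -> C p.2 /\ eigen p.1 p.2) /\ z = \sum_(p <- l) p.2.

Lemma homsum_eigen n z : C z -> eigen n z -> homsum z.
Proof.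
move=> hz hn; exists [:: (n, z)]; rewrite big_seq1; split=> // p.
by rewrite inE => /eqP ->.
Qed.

Lemma homsum_closed : Ksubalg iota homsum.
Proof.
split=> [c|x y [l [hl ->]] [k [hk ->]]|x y [l [hl ->]] [k [hk ->]]].
- by apply: (@homsum_eigen 0); [exact: (sa_const cC)|exact: eigenC].
- exists (l ++ k); rewrite big_cat; split=> // p.
  by rewrite mem_cat => /orP[/hl|/hk].
- exists [seq (p.1 + r.1, p.2 * r.2) | p <- l, r <- k]; split.
    move=> p /allpairsP[[r s] /= [/hl[r1 r2] /hk[s1 s2] ->]] /=.
    by split; [exact: (saM cC)|exact: eigenM].
  rewrite big_allpairs_dep mulr_suml; apply: eq_bigr => p _.
  by rewrite mulr_sumr.
Qed.

(** Collecting the terms of equal degree gives consecutive degrees from -N on, the form that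
    [eigen_components] expects. *)
Lemma homsumE z : homsum z -> exists (N M : nat) (q : nat -> F),
  (forall i, C (q i) /\ eigen (- N%:Z + i%:Z) (q i)) /\ z = \sum_(i < M) q i.
Proof.
move=> [l [hl ->]].
have [N hN] : exists N : nat, forall p, p \in l -> (`|p.1| < N)%N.
  elim: l {hl} => [|p l [N hN]]; first by exists 0%N.
  exists (N + (absz p.1).+1)%N => r; rewrite inE => /orP[/eqP ->|/hN h].
    by rewrite addnS ltnS leq_addl.
  by apply: leq_trans h _; rewrite leq_addr.
exists N, (N + N)%N, (fun i => \sum_(p <- l | p.1 == - N%:Z + i%:Z) p.2); split.
  move=> i; rewrite big_seq_cond; split.
    by apply: (sa_sum cC) => p /andP[/hl[]].
  elim/big_rec: _ => [|p x /andP[pl /eqP <-] hx].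
    by rewrite /eigen der0 mulr0.
  by apply: eigenD => //; have [] := hl _ pl.
rewrite /= (exchange_big_dep xpredT) //= [LHS]big_seq [RHS]big_seq; apply: eq_bigr => p pl.
have := hN _ pl; set m : int := p.1 => hm.
have iP : (absz (m + N%:Z)%R < N + N)%N by lia.
rewrite (bigD1 (Ordinal iP)) /=; last by apply/eqP; lia.
rewrite big1 ?addr0 // => i /andP[/eqP e /eqP]; case.
apply: val_inj => /=; lia.
Qed.

(** The ideal x C is D-stable, hence homogeneous. If it contains z (1 + u), it contains the
    components q_i + q_(i-1) u, and induction from the lowest degree puts every q_i into it. *)
Lemma graded_cop x d u : (forall z, C z -> homsum z) -> x != 0 -> C x ->
  eigen d x -> C u -> eigen 1 u -> cop C x (1 + u).
Proof.
move=> hC x0 Cx dx Cu du z Cz hz.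
pose I := [set z | C (z / x)].
have CDer y : C y -> C (D y).
  move=> /hC[l [hl ->]]; rewrite der_bigsum big_seq.
  apply: (sa_sum cC) => p /hl[p1 p2]; rewrite p2 -(rmorph_int iota).
  by apply: (saM cC) => //; apply: (sa_const cC).
have ID y w : I y -> I w -> I (y + w).
  by rewrite /I /= mulrDl => ? ?; apply: (saD cC).
have IZ c y : I y -> I (iota c * y).
  rewrite /I /= -mulrA => hy; apply: (saM cC) => //; exact: (sa_const cC).
have IDer y : I y -> I (D y).
  rewrite /I /= => hy; have -> : D y / x = iota d%:~R * (y / x) + D (y / x).
    by rewrite derM derV // dx rmorph_int; field.
  by apply: (saD cC); [apply: (saM cC) => //; apply: (sa_const cC)|exact: CDer].
have [N [M [q [hq zE]]]] := homsumE (hC _ Cz).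
pose r i := (if (i < M)%N then q i else 0) + (if i is j.+1 then q j * u else 0).
have hr i : eigen (- N%:Z + i%:Z) (r i).
  apply: eigenD.
    by case: ifP => _; [have [] := hq i|rewrite /eigen der0 mulr0].
  case: i => [|i]; first by rewrite /eigen der0 mulr0.
  have [_ qi] := hq i; rewrite -addn1 PoszD addrA; exact: eigenM.
have sr : \sum_(i < M.+1) r i = z * (1 + u).
  rewrite big_split /= big_ord_recr /= ltnn addr0 [X in _ + X]big_ord_recl add0r.
  rewrite mulrDr mulr1 zE mulr_suml; congr (_ + _).
  by apply: eq_bigr => i _; rewrite ltn_ord.
have Ir : forall i, (i < M.+1)%N -> I (r i).
  by apply: (eigen_components ID IZ IDer hr); rewrite sr.
have Iq i : (i < M)%N -> I (q i).
  elim: i => [|i IH] iM; first by have := Ir 0%N isT; rewrite /r iM addr0.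
  have := Ir _ (leqW iM); rewrite /r iM => h.
  have -> : q i.+1 = (q i.+1 + q i * u) + iota (-1) * (q i * u).
    by rewrite rmorphN1 mulN1r addrK.
  apply: ID => //; apply: IZ; rewrite /I /= mulrAC; apply: (saM cC) => //.
  by apply: IH; apply: ltnW.
rewrite zE mulr_suml; apply: (sa_sum cC) => i _; exact: Iq.
Qed.
End Graded.
End OneDerivation.
End Derivations.

(** * Mutation *)

Section Seeds.
Variables (K : numFieldType) (F : fieldType) (iota : {rmorphism K -> F}).
Variables (I J : finType).
Local Notation idx := (I + J)%type.
Local Notation seed := (seed F I J).
Implicit Type s : seed.

(** The two monomials of the exchange relation at k; [nx s k] is the neighbour x_k' of x_k. *)
Definition Mp s k := \prod_i svar s i ^+ ppart (smat s i k).
Definition Mm s k := \prod_i svar s i ^+ ppart (- smat s i k).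
Definition nx s k := svar (mutate k s) (inl k).

Lemma nxE s k : nx s k = (Mp s k + Mm s k) / svar s (inl k).
Proof. by rewrite /nx /= eqxx. Qed.

(** Changing the sign of the matrix swaps the two exchange monomials and commutes with mutation;
    this gives the symmetry used in [rank2_mutation]. *)
Definition neg s : seed := Seed (svar s) (fun i j => - smat s i j).

Lemma ppartE b : (ppart b)%:Z = Num.max 0 b.
Proof. by rewrite /ppart gez0_abs // le_max lexx. Qed.

Lemma ppart_nat (n : nat) : ppart n = n.
Proof. by apply/eqP; rewrite -eqz_nat ppartE; lia. Qed.

Lemma ppartN_nat (n : nat) : ppart (- n%:Z) = 0%N.
Proof. by apply/eqP; rewrite -eqz_nat ppartE; lia. Qed.

(** The minimum measures the cancellation when n is added to the entry b; with the next lemma, this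
    is the count of exponents behind [rank2_mutation]. *)
Lemma ppart_add b n : (minn (ppart (- b)) n + ppart (b + n%:Z) = ppart b + n)%N.
Proof. have := ppartE b; have := ppartE (- b); have := ppartE (b + n); lia. Qed.

Lemma ppart_sub b n : (minn (ppart (- b)) n + ppart (- (b + n%:Z)) = ppart (- b))%N.
Proof. have := ppartE (- b); have := ppartE (- (b + n)); lia. Qed.

Definition bmut (a b : int) : int := Num.sg a * Num.max 0 (a * b).

Lemma smat_mut s k i j : smat (mutate k s) i j =
  if (i == inl k) || (j == k) then - smat s i j
  else smat s i j + bmut (smat s i k) (smat s (inl k) j).
Proof. by []. Qed.

Lemma bmut_pp a b : 0 <= a -> 0 <= b -> bmut a b = a * b.
Proof.
rewrite /bmut le_eqVlt => /predU1P[<-|a0] b0; first by rewrite sgr0 !mul0r.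
by rewrite gtr0_sg // mul1r max_r // mulr_ge0 // ltW.
Qed.

Lemma bmutN a b : bmut (- a) (- b) = - bmut a b.
Proof. by rewrite /bmut mulrNN sgrN mulNr. Qed.

Lemma bmut_nn a b : a <= 0 -> b <= 0 -> bmut a b = - (a * b).
Proof.
move=> a0 b0; rewrite -[a]opprK -[b]opprK bmutN bmut_pp ?oppr_ge0 //.
by rewrite !opprK mulrNN.
Qed.

Lemma bmut_np a b : a <= 0 -> 0 <= b -> bmut a b = 0.
Proof. by move=> a0 b0; rewrite /bmut max_l ?mulr0 // mulr_le0_ge0. Qed.

Lemma bmut_pn a b : 0 <= a -> b <= 0 -> bmut a b = 0.
Proof. by move=> a0 b0; rewrite /bmut max_l ?mulr0 // mulr_ge0_le0. Qed.

Lemma seed_eq s t : svar s = svar t -> smat s = smat t -> s = t.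
Proof. by case: s => v m; case: t => w n /= -> ->. Qed.

Lemma neg_mutate s k : mutate k (neg s) = neg (mutate k s).
Proof.
apply: seed_eq; apply/funext => i /=.
  case: ifP => // _; congr (_ / _); rewrite addrC; congr (_ + _).
  by apply: eq_bigr => j _; rewrite opprK.
apply/funext => j; case: ifP => // _.
by rewrite -!/(bmut _ _) opprD bmutN.
Qed.

Lemma mutateK s k : smat s (inl k) k = 0 -> svar s (inl k) != 0 ->
  nx s k != 0 -> mutate k (mutate k s) = s.
Proof.
move=> b0 x0 nx0; apply: seed_eq; apply/funext => i.
  rewrite /=; case: ifP => [/eqP ->|->] //.
  (* Used with f the identity and the opposite. The exponent of x_k itself is f 0 = 0, so its
     replacement by x_k' leaves the exchange monomials unchanged. *)
  have e (f : int -> int) : f 0 = 0 ->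
    \prod_(j : idx) (if j == inl k then
       (Mp s k + Mm s k) / svar s (inl k) else svar s j) ^+
      ppart (f (if (j == inl k) || (k == k) then - smat s j k
        else smat s j k + bmut (smat s j k) (smat s (inl k) k))) =
    \prod_(j : idx) svar s j ^+ ppart (f (- smat s j k)).
    move=> f0; apply: eq_bigr => j _; rewrite eqxx orbT.
    by case: eqP => // ->; rewrite b0 oppr0 f0.
  rewrite (e id) // (e -%R) ?oppr0 //.
  have -> : \prod_(j : idx) svar s j ^+ ppart (- smat s j k) = Mm s k by [].
  have -> : \prod_(j : idx) svar s j ^+ ppart (- - smat s j k) = Mp s k.
    by apply: eq_bigr => j _; rewrite opprK.
  move: nx0; rewrite nxE mulf_eq0 negb_or => /andP[p0 _].
  rewrite [Mm s k + _]addrC; set a := Mp s k + Mm s k in p0 *.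
  by rewrite eqxx invf_div mulrC divfK.
apply/funext => j; rewrite !smat_mut.
rewrite !eqxx orbT /=; case: ifP => h; first by rewrite h opprK.
by rewrite h bmutN addrK.
Qed.

Definition sskew s := exists2 d : I -> int, forall i, 0 < d i &
    forall i j, d i * smat s (inl i) j = - (d j * smat s (inl j) i).

Lemma sskew_diag s k : sskew s -> smat s (inl k) k = 0.
Proof. by move=> [d d0 /(_ k k)]; have := d0 k; nia. Qed.

Lemma sskew_sign s j k : sskew s ->
  (0 < smat s (inl k) j -> smat s (inl j) k < 0) /\
  (smat s (inl k) j = 0 -> smat s (inl j) k = 0).
Proof. by move=> [d d0 /(_ k j)]; have := d0 k; have := d0 j; split; nia. Qed.

Lemma sskew_mutate s k : sskew s -> sskew (mutate k s).
Proof.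
move=> [d d0 hd]; exists d => // i j; rewrite !smat_mut.
have -> : (inl j == inl k :> idx) = (j == k) by [].
have -> : (inl i == inl k :> idx) = (i == k) by [].
rewrite [(j == k) || _]orbC; case: ifP => _; first by rewrite !mulrN hd.
rewrite !mulrDr opprD hd; congr (_ + _).
have := hd i k; have := hd k j; have := d0 i; have := d0 j; have := d0 k.
move: (d i) (d j) (d k) (smat s (inl i) k) (smat s (inl k) j)
  (smat s (inl j) k) (smat s (inl k) i) => x y z A B E C z0 y0 x0 hBE hAC.
have [A0|A0] := leP 0 A; have [B0|B0] := leP 0 B.
- by rewrite bmut_pp // bmut_nn; nia.
- by rewrite bmut_pn ?bmut_pn //; nia.
- by rewrite bmut_np ?bmut_np //; nia.
- by rewrite bmut_nn ?bmut_pp //; nia.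
Qed.

Definition xmon s (g : idx -> nat) := \prod_r svar s r ^+ g r.

Lemma xmonD s g h : xmon s (fun r => g r + h r)%N = xmon s g * xmon s h.
Proof. by rewrite /xmon -big_split; apply: eq_bigr => r _; rewrite exprD. Qed.

Lemma xmonX s g n : xmon s (fun r => n * g r)%N = xmon s g ^+ n.
Proof.
by rewrite /xmon -prodrXl; apply: eq_bigr => r _; rewrite mulnC exprM.
Qed.

Lemma xmon1 s q n : xmon s (fun r => if r == q then n else 0%N) = svar s q ^+ n.
Proof.
rewrite /xmon (bigD1 q) //= eqxx big1 ?mulr1 // => r /negPf ->.
by rewrite expr0.
Qed.

Lemma svar_mut s k r : r != inl k -> svar (mutate k s) r = svar s r.
Proof. by move=> /negPf h; rewrite /= h. Qed.

(* Mutating at k and then at j moves x_j to an element of the algebra of the old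
   extended cluster and of the neighbour of x_j, up to a monomial without x_j. *)
Lemma rank2_mutation s j k : sskew s -> j != k ->
  (forall r, svar s r != 0) ->
  exists2 g : idx -> nat, g (inl j) = 0%N &
  alg iota ([set svar s r | r in setT] `|` [set nx s j])
    (xmon s g * nx (mutate k s) j).
Proof.
(* After a change of sign of the matrix, b_kj is some n >= 0, and x_k' enters only the negative
   monomial of the new exchange relation at j. *)
wlog b0 : s / 0 <= smat s (inl k) j => [hwlog sk jk x0|sk jk x0].
  have [|b0] := leP 0 (smat s (inl k) j); first by move=> h; apply: hwlog.
  have nxN t i : nx (neg t) i = nx t i.
    by rewrite /nx neg_mutate.
  have [||//|//|g gj hg] := hwlog (neg s); first by rewrite /= oppr_ge0 ltW.
  - by have [d d0 hd] := sk; exists d => // i i'; rewrite /= !mulrN hd.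
  by exists g => //; move: hg; rewrite neg_mutate !nxN.
have [n bn] : exists n : nat, smat s (inl k) j = n%:Z.
  by exists (absz (smat s (inl k) j)); rewrite gez0_abs.
have bkk := sskew_diag k sk; have bjj := sskew_diag j sk.
have kj : (inl j == inl k :> idx) = false by apply/negbTE.
(* The monomial lost by cancellation when n [b_rk]_+ is added to b_rj. Multiplied by it, both new
   exchange monomials factor through those of s: these are [hp] and [hm]. *)
pose g r := if r == inl k then 0%N
  else minn (ppart (- smat s r j)) (n * ppart (smat s r k)).
have bj r : r != inl k ->
    smat (mutate k s) r j = smat s r j + (n * ppart (smat s r k))%N%:Z.
  move=> /negPf rk; rewrite smat_mut rk (negPf jk) /= bn; congr (_ + _).
  have [a0|a0] := leP 0 (smat s r k).
    by rewrite bmut_pp // mulrC PoszM ppartE max_r.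
  rewrite bmut_np //; last exact: ltW.
  by rewrite PoszM ppartE max_l ?mulr0 // ltW.
have bk : smat (mutate k s) (inl k) j = - n%:Z by rewrite smat_mut eqxx bn.
have bM (a b : idx -> F) :
    (\prod_r a r) * (\prod_r b r) = \prod_r (a r * b r).
  by rewrite big_split.
have hp : xmon s g * Mp (mutate k s) j * svar s (inl k) ^+ n
    = Mp s j * Mp s k ^+ n.
  have -> : Mp s k ^+ n = xmon s (fun r => n * ppart (smat s r k))%N.
    by rewrite xmonX.
  rewrite -(xmon1 s) /Mp /xmon !bM.
  apply: eq_bigr => r _; rewrite /g.
  case: (eqVneq r (inl k)) => [->|rk].
    by rewrite bk ppartN_nat bkk bn ppart_nat (ppart_nat 0) muln0 !expr0 !mul1r mulr1.

  rewrite svar_mut // expr0 mulr1 bj // -!exprD; congr (_ ^+ _).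
  exact: ppart_add.
have hm : xmon s g * Mm (mutate k s) j = Mm s j * nx s k ^+ n.
  have -> : nx s k ^+ n =
      \prod_(r : idx) (if r == inl k then nx s k else 1) ^+ n.
    rewrite (bigD1 (inl k)) //= eqxx big1 ?mulr1 // => r /negPf ->.
    by rewrite expr1n.
  rewrite !bM; apply: eq_bigr => r _; rewrite /g.
  case: (eqVneq r (inl k)) => [->|rk].
    rewrite bk bn opprK ppart_nat ppartN_nat !expr0 !mul1r.
    by [].
  rewrite svar_mut // expr1n mulr1 bj // -!exprD; congr (_ ^+ _).
  exact: ppart_sub.
set A := alg _ _; have cA : Ksubalg iota A by apply: alg_closed.
have Ax r : A (svar s r) by apply: alg_gen; left; exists r.
have Anx : A (nx s j) by apply: alg_gen; right.
have AM h : A (xmon s h) by apply: (sa_prod cA) => r _; apply: (saX cA).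
have AMp i : A (Mp s i) by exact: AM.
have AMm i : A (Mm s i) by exact: AM.
(* The factor x_k^n clears the denominator of x_k'^n. The variable x_j stays absent because b_jk <=
   0 when b_kj >= 0. *)
exists (fun r => g r + if r == inl k then n else 0)%N.
  rewrite kj addn0 /g kj; apply/eqP; rewrite -leqn0 geq_min.
  have [b1 b2] := sskew_sign j k sk; apply/orP; right.
  have : smat s (inl j) k <= 0.
    have [h|h|h] := ltgtP 0 (smat s (inl k) j).
    - by apply: ltW; apply: b1.
    - by move: h; rewrite ltNge b0.
    - by rewrite b2.
  by have := ppartE (smat s (inl j) k); case: ppart => [|m]; nia.
have Xj0 := x0 (inl j).
rewrite xmonD (xmon1 s) nxE svar_mut ?kj // -mulrA mulrCA mulrC.
have -> : xmon s g * ((Mp (mutate k s) j + Mm (mutate k s) j) / svar s (inl j))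
    * svar s (inl k) ^+ n = (Mp s j * Mp s k ^+ n
      + Mm s j * (Mp s k + Mm s k) ^+ n) / svar s (inl j).
  have -> : Mp s k + Mm s k = svar s (inl k) * nx s k.
    by rewrite nxE mulrC divfK.
  transitivity ((xmon s g * Mp (mutate k s) j * svar s (inl k) ^+ n +
    xmon s g * Mm (mutate k s) j * svar s (inl k) ^+ n) / svar s (inl j)).
    by ring.
  by rewrite hp hm exprMn; ring.
have powD (a b : F) m : A a -> A b ->
    exists2 Q, A Q & (a + b) ^+ m = a ^+ m + b * Q.
  move=> Aa Ab; elim: m => [|m [Q AQ IH]].
    by exists 0; [exact: (sa0 cA)|rewrite mulr0 addr0].
  exists (a ^+ m + (a + b) * Q).
    by apply: (saD cA); [exact: (saX cA)|apply: (saM cA) => //; apply: (saD cA)].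
  by rewrite !exprS IH; ring.
(* For n > 0 one has b_jk < 0, so x_j divides M^-_k and the n-th power of the binomial at k is
   (M^+_k)^n modulo x_j. What remains is (M^+_k)^n times the old exchange binomial at j. *)
have [M' AM' ->] : exists2 M', A M' &
    (Mp s k + Mm s k) ^+ n = Mp s k ^+ n + svar s (inl j) * M'.
  have [n0|n0] := posnP n.
    by exists 0; [exact: (sa0 cA)|rewrite n0 !expr0 mulr0 addr0].
  have [Q AQ ->] := powD _ _ n (AMp k) (AMm k).
  have bjk : smat s (inl j) k < 0.
    by have [b1 _] := sskew_sign j k sk; apply: b1; rewrite bn.
  have [m hm'] : exists m, ppart (- smat s (inl j) k) = m.+1.
    by exists (ppart (- smat s (inl j) k)).-1;
      have := ppartE (- smat s (inl j) k); lia.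
  exists (xmon s (fun r => if r == inl j then m else ppart (- smat s r k)) * Q).
    by apply: (saM cA).
  rewrite mulrA; congr (_ + _ * _).
  rewrite /Mm /xmon (bigD1 (inl j)) //= [in RHS](bigD1 (inl j)) //= eqxx.
  rewrite hm' exprS -!mulrA; congr (_ * (_ * _)).
  by apply: eq_bigr => r /negPf ->.
have -> : (Mp s j * Mp s k ^+ n + Mm s j * (Mp s k ^+ n + svar s (inl j) * M'))
   / svar s (inl j) = Mp s k ^+ n * nx s j + Mm s j * M'.
  by rewrite nxE; field.
by apply: (saD cA); apply: (saM cA) => //; apply: (saX cA).
Qed.

End Seeds.

(** * Independence through derivations *)

Section Independence.
Variables (K : numFieldType) (F : fieldType) (iota : {rmorphism K -> F}).

(* In characteristic 0 this is algebraic independence over K. *)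
Definition indep (T : eqType) (x : T -> F) := forall e : T -> F,
  exists2 D, der iota D & forall r, D (x r) = e r.

(** Adding a multiple of the partial derivative along [x r0] adjusts the value on y and does not
    change the values on the other x r. *)
Lemma indep_replace (T : eqType) (x : T -> F) r0 y : indep x ->
  (forall D, der iota D -> (forall r, D (x r) = (r == r0)%:R) -> D y != 0) ->
  indep (fun r => if r == r0 then y else x r).
Proof.
move=> ix hy e.
have [D0 dD0 hD0] := ix e; have [D1 dD1 hD1] := ix (fun r => (r == r0)%:R).
have y0 := hy _ dD1 hD1.
exists (fun z => 1 * D0 z + ((e r0 - D0 y) / D1 y) * D1 z); first exact: der_sum.
move=> r; case: eqP => [->|/eqP/negPf rr0].
  by rewrite mul1r divfK // addrC subrK.
by rewrite hD1 rr0 mulr0 addr0 mul1r.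
Qed.

Lemma eigen0_prod (T : finType) (D : F -> F) (x : T -> F) (g : T -> nat) :
  der iota D -> (forall r, D (x r) = 0 \/ g r = 0%N) -> D (\prod_r x r ^+ g r) = 0.
Proof.
move=> dD h; elim/big_rec: _ => [|r z _ hz]; first exact: (der1 dD).
rewrite (derM dD) hz mulr0 addr0; case: (h r) => [e|->].
  by rewrite (derX dD) e mulr0 mul0r.
by rewrite expr0 (der1 dD) mul0r.
Qed.
End Independence.

(** * Coprimality with an exchange binomial *)

Section Invariant.
Variables (K : numFieldType) (F : fieldType) (iota : {rmorphism K -> F}).
Variables (I J : finType).
Local Notation idx := (I + J)%type.
Local Notation seed := (seed F I J).
Implicit Type s : seed.

Definition Cgen s r : set F :=
  [set x | exists2 q, q != r & x = svar s q \/ x = (svar s q)^-1] `|`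
  [set svar s r] `|` [set x | exists2 j, r = inl j & x = nx s j].

(* All elements of the extended cluster but the one of index r are inverted, and
   the neighbour of x_r is added. *)
Definition Calg s r := alg iota (Cgen s r).

Lemma Calg_closed s r : Ksubalg iota (Calg s r). Proof. exact: alg_closed. Qed.
Lemma Calg_inv s r q : q != r -> Calg s r (svar s q)^-1.
Proof. by move=> qr; apply: alg_gen; left; left; exists q => //; right. Qed.
Lemma Calg_var s r q : Calg s r (svar s q).
Proof.
apply: alg_gen; left; case: (eqVneq q r) => [->|qr]; [by right|left].
by exists q => //; left.
Qed.
Lemma Calg_nx s j : Calg s (inl j) (nx s j).
Proof. by apply: alg_gen; right; exists j. Qed.
Lemma Calg_mon s r g : Calg s r (xmon s g).
Proof.
have cC := Calg_closed s r.
by apply: (sa_prod cC) => q _; apply: (saX cC); apply: Calg_var.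
Qed.
Lemma Calg_mon_inv s r g : g r = 0%N -> Calg s r (xmon s g)^-1.
Proof.
have cC := Calg_closed s r.
move=> gr; rewrite /xmon -prodfV; apply: (sa_prod cC) => q _.
rewrite -exprVn; case: (eqVneq q r) => [->|qr].
  by rewrite gr expr0; apply: (sa1 cC).
by apply: (saX cC); apply: Calg_inv.
Qed.

Lemma xmon_neq0 s g : (forall r, svar s r != 0) -> xmon s g != 0.
Proof. by move=> x0; apply/prodf_neq0 => r _; apply: expf_neq0. Qed.

(** Full rank over the integers: every choice of degrees for the ratios M^+_j / M^-_j comes from a
    grading of the extended cluster. *)
Definition lin s := forall v : I -> int, exists d : idx -> int,
  forall j, \sum_r d r * smat s r j = v j.

Section Grading.
Variables (s : seed) (x0 : forall r, svar s r != 0).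
Variables (ix : indep iota (svar s)) (lx : lin s).

(** The ratio of the exchange monomials has degree 1 at k and degree 0 at every j != k, so that all
    exchange binomials but the one at k are homogeneous. *)
Lemma grading k : exists (D : F -> F) (d : idx -> int) (m : I -> int),
  [/\ der iota D, forall r, eigen D (d r) (svar s r),
      forall j, eigen D (m j + (j == k)%:Z) (Mp s j)
    & forall j, eigen D (m j) (Mm s j)].
Proof.
have [d hd] := lx (fun j => (j == k)%:Z).
have [D dD hD] := ix (fun r => (d r)%:~R * svar s r).
exists D, d, (fun j => \sum_r (ppart (- smat s r j))%:Z * d r); split=> // j.
  have -> : \sum_r (ppart (- smat s r j))%:Z * d r + (j == k)%:Z =
      \sum_r (ppart (smat s r j))%:Z * d r.
    rewrite -hd -big_split /=; apply: eq_bigr => r _; rewrite !ppartE.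
    by case: (ltrgt0P (smat s r j)) => h; rewrite ?h; lia.
  exact: (eigen_prod dD _ hD).
exact: (eigen_prod dD _ hD).
Qed.

(** The two exchange monomials have different degrees for some grading, so they cannot cancel. *)
Lemma nx_neq0 k : nx s k != 0.
Proof.
have [D [d [m [dD _ hp hm]]]] := grading k.
rewrite nxE mulf_neq0 ?invr_eq0 // addr_eq0; apply/eqP => e.
have := hp k; rewrite /eigen {1}e (derN dD) (hm k) eqxx intrD mulrDl mul1r.
rewrite {1}e mulrN => /eqP; rewrite -subr_eq0 opprD addrA subrr add0r oppr_eq0.
by apply/negP; apply: xmon_neq0.
Qed.

(** If x_r occurs in the exchange relation, it divides one monomial and the other is a unit of
    [Calg s r]. If not, both monomials are units, and the binomial is a unit times 1 + u, where u
    has degree 1 for a grading in which all generators of [Calg s r] are homogeneous. *)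
Lemma cop_exchange k r : r != inl k ->
  cop (Calg s r) (svar s r) (Mp s k + Mm s k).
Proof.
move=> rk; have cC := Calg_closed s r.
have fac (g : idx -> nat) : (0 < g r)%N -> exists2 z, Calg s r z &
    \prod_q svar s q ^+ g q = svar s r * z.
  move=> gr; exists (xmon s (fun q => if q == r then (g r).-1 else g q)).
    exact: Calg_mon.
  rewrite /xmon (bigD1 r) //= [in RHS](bigD1 r) //= eqxx mulrA -exprS prednK //.
  by congr (_ * _); apply: eq_bigr => q /negPf ->.
have unit (g : idx -> nat) : g r = 0%N ->
    cop (Calg s r) (svar s r) (\prod_q svar s q ^+ g q).
  move=> gr; apply: (cop_inv cC); [exact: xmon_neq0|exact: Calg_mon_inv].
have := ppartE (smat s r k); have := ppartE (- smat s r k).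
case: (ltrgt0P (smat s r k)) => h hm hp.
- have [|z Cz ez] := fac (fun q => ppart (smat s q k)); first by lia.
  rewrite /Mp ez addrC; apply: (cop_addl cC) => //; apply: unit; lia.
- have [|z Cz ez] := fac (fun q => ppart (- smat s q k)); first by lia.
  rewrite /Mm ez; apply: (cop_addl cC) => //; apply: unit; lia.
have [D [d [m [dD hd hpk hmk]]]] := grading k.
have m0 : Mm s k != 0 by apply: xmon_neq0.
have -> : Mp s k + Mm s k = Mm s k * (1 + Mp s k / Mm s k) by field.
have Cm : Calg s r (Mm s k)^-1 by apply: Calg_mon_inv; lia.
apply: (copM cC); first exact: Calg_mon.
  by apply: (cop_inv cC).
apply: (graded_cop dD cC (d := d r)) => //; try exact: Calg_var.
- have cH := homsum_closed dD cC; apply: alg_min => // z.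
  case=> [[[q qr [->|->]]|->]|[j jr ->]].
  + by apply: (homsum_eigen (n := d q)); [exact: Calg_var|exact: hd].
  + apply: (homsum_eigen (n := - d q)); first exact: Calg_inv.
    exact: (eigenV dD).
  + by apply: (homsum_eigen (n := d r)); [exact: Calg_var|exact: hd].
  + apply: (homsum_eigen (n := m j + - d (inl j))).
      by rewrite jr; exact: Calg_nx.
    rewrite nxE; apply: (eigenM dD); last exact: (eigenV dD).
    apply: (eigenD dD) => //; have := hpk j; case: eqP => [e|_]; last by rewrite addr0.
    by move: rk; rewrite jr e eqxx.
- by apply: (saM cC) => //; apply: Calg_mon.
- have -> : 1 = (m k + (k == k)%:Z) + - m k by rewrite eqxx addrC addKr.
  by apply: (eigenM dD) => //; apply: (eigenV dD).
Qed.
End Grading.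
End Invariant.

(** * Inheritance of the conditions under mutation *)

Section Step.
Variables (K : numFieldType) (F : fieldType) (iota : {rmorphism K -> F}).
Variables (I J : finType).
Local Notation idx := (I + J)%type.
Local Notation seed := (seed F I J).
Implicit Type s : seed.

Lemma Calg_clear (B : set F) s r : Ksubalg iota B -> (forall q, B (svar s q)) ->
  (forall j, B (nx s j)) -> (forall r, svar s r != 0) -> forall z, Calg iota s r z ->
  exists2 g : idx -> nat, g r = 0%N & B (xmon s g * z).
Proof.
move=> cB Bx Bn x0.
have BM g : B (xmon s g) by apply: (sa_prod cB) => q _; apply: (saX cB).
apply: alg_min => [|z].
  split=> [c|y z [g gr hg] [h hr hh]|y z [g gr hg] [h hr hh]].
  - exists (fun=> 0%N) => //.
    by apply: (saM cB) => //; apply: (sa_const cB).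
  - exists (fun q => g q + h q)%N; first by rewrite gr hr.
    have -> : xmon s (fun q => g q + h q)%N * (y + z) =
       xmon s h * (xmon s g * y) + xmon s g * (xmon s h * z) by rewrite xmonD; ring.
    by apply: (saD cB); apply: (saM cB).
  - exists (fun q => g q + h q)%N; first by rewrite gr hr.
    have -> : xmon s (fun q => g q + h q)%N * (y * z) =
       (xmon s g * y) * (xmon s h * z) by rewrite xmonD; ring.
    exact: (saM cB).
have triv w : B w -> exists2 g : idx -> nat, g r = 0%N & B (xmon s g * w).
  by move=> Bw; exists (fun=> 0%N) => //; apply: (saM cB).
case=> [[[q qr [->|->]]|->]|[j jr ->]]; try exact: triv.
exists (fun p => if p == q then 1%N else 0%N); first by rewrite eq_sym (negPf qr).
by rewrite xmon1 expr1 divff //; apply: (sa1 cB).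
Qed.

(** Mutation multiplies the matrix on both sides by matrices invertible over the integers. The
    column operations change the target into [v]; the row operations give k the new degree
    [T p - d (inl k)], which is the degree of M^+_k / x_k. *)
Lemma lin_mutate s k : sskew s -> lin s -> lin (mutate k s).
Proof.
move=> sk ls v'; have bkk := sskew_diag k sk.
pose v j := if j == k then - v' k
  else v' j - (if 0 <= smat s (inl k) j then 0 else smat s (inl k) j * v' k).
have [d hd] := ls v.
pose T b := \sum_(r | r != inl k) b r * d r : int.
pose p r := (ppart (smat s r k))%:Z : int.
pose m r := (ppart (- smat s r k))%:Z : int.
exists (fun r => if r == inl k then T p - d (inl k) else d r) => j.
have pm r : smat s r k = p r - m r by rewrite /p /m !ppartE; lia.
have dk : T p - T m = - v' k.
  have := hd k; rewrite /v eqxx => <-.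
  rewrite [RHS](bigD1 (inl k)) //= bkk mulr0 add0r /T -sumrB.
  by apply: eq_bigr => r _; rewrite pm; ring.
rewrite (bigD1 (inl k)) //= eqxx.
have [jk|jk] := eqVneq j k.
  rewrite jk bkk oppr0 mulr0 add0r.
  transitivity (- (T p - T m)); last by rewrite dk opprK.
  rewrite /T -sumrB -sumrN; apply: eq_bigr => r /negPf rk.
  by rewrite rk /= ?eqxx pm; ring.
have hj := hd j; rewrite (bigD1 (inl k)) //= /v (negPf jk) in hj.
have bmutE a b : bmut a b =
  if 0 <= b then (ppart a)%:Z * b else (ppart (- a))%:Z * b.
  rewrite !ppartE; have [a0|a0] := leP 0 a; have [b0|b0] := leP 0 b.
  - by rewrite bmut_pp // max_r.
  - by rewrite (bmut_pn a0 (ltW b0)); lia.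
  - by rewrite (bmut_np (ltW a0) b0); lia.
  - by rewrite (bmut_nn (ltW a0) (ltW b0)); lia.
pose b0 := 0 <= smat s (inl k) j.
have e : (\sum_(i | i != inl k) d i * smat s i j) +
    (if b0 then T p else T m) * smat s (inl k) j =
  \sum_(i | i != inl k) (d i * smat s i j +
    (if b0 then p i * d i else m i * d i) * smat s (inl k) j).
  rewrite big_split; congr (_ + _); rewrite -mulr_suml; congr (_ * _).
  by case: ifP.
rewrite [X in _ + X](eq_bigr (fun i => d i * smat s i j +
    (if b0 then p i * d i else m i * d i) * smat s (inl k) j)); last first.
  move=> r /negPf rk; rewrite rk /= -/(bmut _ _) bmutE -/b0.
  by case: ifP => _; rewrite /p /m; ring.
rewrite -e /=; move: hj; rewrite -/b0; case: ifP => h hj.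
  by rewrite -[v' j]subr0 -hj; ring.
rewrite -[v' j](subrK (smat s (inl k) j * v' k)) -hj.
by rewrite -[T p](subrK (T m)) dk; ring.
Qed.

(** Neither exchange monomial contains x_k, so the partial derivative of x_k' along x_k is - x_k' /
    x_k. *)
Lemma indep_mutate s k : sskew s -> (forall r, svar s r != 0) ->
  indep iota (svar s) -> nx s k != 0 -> indep iota (svar (mutate k s)).
Proof.
move=> sk x0 ix nk; have bkk := sskew_diag k sk.
have -> : svar (mutate k s) = (fun r => if r == inl k then nx s k else svar s r).
  by apply/funext => r; case: eqP => [->//|/eqP h]; rewrite svar_mut.
apply: indep_replace => // D dD hD.
have D0 (f : int -> int) : f 0 = 0 -> D (\prod_r svar s r ^+ ppart (f (smat s r k))) = 0.
  move=> f0; apply: (eigen0_prod dD) => r; rewrite hD.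
  by case: eqP => [->|_]; [right; rewrite bkk f0|left].
rewrite nxE (derM dD) (derD dD) (D0 id) // (D0 -%R) ?oppr0 // addr0 mul0r add0r.
rewrite (derV dD) // hD eqxx.
move: nk; rewrite nxE mulf_eq0 negb_or => /andP[p0 _].
by rewrite mulf_neq0 // mulf_neq0 ?invr_eq0 ?expf_neq0 // oppr_eq0 oner_eq0.
Qed.

(** L is the set of inverted coefficients. For j in L the inverse of x_j lies in B, so the inclusion
    of B is not asked for the algebra in which x_j is not inverted; coprimality to x_j is
    automatic. *)
Record seed_invariant (B : set F) (L : set J) s : Prop := SeedInvariant {
  inv_skew : sskew s;
  inv_lin : lin s;
  inv_indep : indep iota (svar s);
  inv_neq0 : forall r, svar s r != 0;
  inv_var : forall r, B (svar s r);
  inv_nx : forall k, B (nx s k);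
  inv_frozen : forall j, L j -> B (svar s (inr j))^-1;
  inv_cop : forall r q, r != q -> cop B (svar s r) (svar s q);
  inv_Calg : forall r, (forall j, r = inr j -> ~ L j) -> B `<=` Calg iota s r }.

Lemma invariant_mutate (B : set F) L s k : Ksubalg iota B ->
  seed_invariant B L s -> seed_invariant B L (mutate k s).
Proof.
move=> cB [sk ls ix x0 Bx Bn BL Bcop BC]; set s' := mutate k s.
have nx0 := nx_neq0 x0 ix ls.
have sk' : sskew s' by apply: sskew_mutate.
have ls' : lin s' by apply: lin_mutate.
have ix' : indep iota (svar s') by apply: indep_mutate.
have x'E r : r != inl k -> svar s' r = svar s r by apply: svar_mut.
have x'k : svar s' (inl k) = nx s k by [].
have x0' r : svar s' r != 0.
  by case: (eqVneq r (inl k)) => [->|h]; [exact: nx0|rewrite x'E].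
have Bx' r : B (svar s' r).
  by case: (eqVneq r (inl k)) => [->|h]; [exact: Bn|rewrite x'E].
have ss' : mutate k s' = s by apply: mutateK => //; exact: sskew_diag.
have nx'k : nx s' k = svar s (inl k) by rewrite /nx ss'.
(* In [Calg s r], which contains B, x_r is coprime to the exchange binomial x_k x_k'. The quotient
   found there has a monomial denominator without x_r, which is removed by coprimality in the old
   seed. *)
have copk r : r != inl k -> cop B (svar s r) (nx s k).
  move=> rk p Bp h.
  have [[j rj Lj]|nL] := pselect (exists2 j, r = inr j & L j).
    by apply: (saM cB) => //; rewrite rj; apply: BL.
  have {}nL j : r = inr j -> ~ L j by move=> rj Lj; apply: nL; exists j.
  have cC := Calg_closed iota s r.
  have Cp : Calg iota s r (p / svar s r).
    apply: (cop_exchange x0 ix ls rk); first exact: (BC _ nL).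
    apply: (BC _ nL).
    have -> : Mp s k + Mm s k = svar s (inl k) * nx s k.
      by rewrite nxE mulrC divfK.
    have -> : p * (svar s (inl k) * nx s k) / svar s r =
      svar s (inl k) * (p * nx s k / svar s r) by ring.
    exact: (saM cB).
  have [g gr] := Calg_clear cB Bx Bn x0 Cp; rewrite mulrA [_ * p]mulrC.
  suff hg : cop B (svar s r) (xmon s g) by apply: hg.
  apply: (cop_prod cB) => q _; first exact: (saX cB).
  case: (eqVneq q r) => [->|qr]; first by rewrite gr expr0; apply: cop1.
  by apply: (copX cB) => //; apply: Bcop; rewrite eq_sym.
have copB' r q : r != q -> cop B (svar s' r) (svar s' q).
  move=> rq; case: (eqVneq q (inl k)) => [e|qk].
    have rk : r != inl k by rewrite -e.
    by rewrite e x'k x'E //; apply: copk.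
  case: (eqVneq r (inl k)) => [->|rk]; last by rewrite !x'E //; apply: Bcop.
  by rewrite x'k x'E //; apply: cop_sym; [exact: x0|exact: nx0|exact: copk].
(* By [rank2_mutation] the new neighbour of x_j lies in B after multiplication by a monomial without
   x_j. Its product with x_j, the exchange binomial, lies in B as well, and coprimality of x_j to
   the monomial removes the latter. *)
have Bn' j : B (nx s' j).
  have [->|jk] := eqVneq j k; first by rewrite nx'k.
  have [g gj hg] := rank2_mutation iota sk jk x0.
  have BA : alg iota (range (svar s) `|` [set nx s j]) `<=` B.
    by apply: alg_min => // z [[r _ <-]|->].
  have xj : svar s' (inl j) = svar s (inl j) by rewrite x'E.
  have hc : cop B (svar s (inl j)) (xmon s g).
    apply: (cop_prod cB) => q _; first exact: (saX cB).
    case: (eqVneq q (inl j)) => [->|qr]; first by rewrite gj expr0; apply: cop1.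
    by apply: (copX cB) => //; apply: Bcop; rewrite eq_sym.
  have e : nx s' j = (nx s' j * svar s (inl j)) / svar s (inl j) by rewrite mulfK.
  rewrite e; apply: hc.
    rewrite nxE -xj divfK //.
    by apply: (saD cB); apply: (sa_prod cB) => q _; apply: (saX cB).
  by rewrite mulrAC mulfK // mulrC; apply: BA.
split=> //.
move=> r nL; have cC' := Calg_closed iota s' r.
(* At r = k the old and the new algebra have the same generators: x_k and x_k' exchange their
   roles. *)
have [rk|rk] := eqVneq r (inl k).
  move=> z /(BC _ nL); rewrite rk; apply: alg_min; first exact: alg_closed.
  move=> y [[[q qr [->|->]]|->]|[j jr ->]].
  - by rewrite -x'E //; apply: Calg_var.
  - by rewrite -x'E //; apply: Calg_inv.
  - by rewrite -nx'k; apply: Calg_nx.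
  - by case: jr => <-; rewrite -x'k; apply: Calg_var.
have Cxr : Calg iota s' r (svar s r) by rewrite -x'E //; apply: Calg_var.
have xrE : svar s' r = svar s r by rewrite x'E.
have xkE : svar s (inl k) = (Mp s' k + Mm s' k) / nx s k by rewrite -nx'k nxE.
have CP : Calg iota s' r (Mp s' k + Mm s' k).
  by apply: (saD cC'); apply: Calg_mon.
have Cnk : Calg iota s' r (nx s k)^-1.
  by rewrite -x'k; apply: Calg_inv; rewrite eq_sym.
have Cxk : Calg iota s' r (svar s (inl k)) by rewrite xkE; apply: (saM cC').
have Cq q : Calg iota s' r (svar s q).
  by case: (eqVneq q (inl k)) => [->//|qk]; rewrite -x'E //; apply: Calg_var.
have cl y x : Calg iota s' r x -> y != 0 ->
    (forall z, Calg iota s' r z -> exists N, Calg iota s' r (z * x ^+ N)).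
  by move=> Cx y0 z Cz; exists 0%N; rewrite expr0 mulr1.
have pow_closed x : Calg iota s' r x ->
    Ksubalg iota [set z | exists N, Calg iota s' r (z * x ^+ N)].
  move=> Cx; split=> [c|y z [N hN] [M hM]|y z [N hN] [M hM]].
  - by exists 0%N; rewrite expr0 mulr1; apply: (sa_const cC').
  - exists (N + M)%N; have -> : (y + z) * x ^+ (N + M) =
      (y * x ^+ N) * x ^+ M + (z * x ^+ M) * x ^+ N by rewrite exprD; ring.
    by apply: (saD cC'); apply: (saM cC') => //; apply: (saX cC').
  - exists (N + M)%N; have -> : (y * z) * x ^+ (N + M) =
      (y * x ^+ N) * (z * x ^+ M) by rewrite exprD; ring.
    exact: (saM cC').
(* Reading z in [Calg s (inl k)] costs a power of x_r, and reading it in [Calg s r] costs a power of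
   x_k. In the new algebra x_k is the exchange binomial divided by the unit x_k', hence coprime to
   x_r, and the factors x_r are removed one at a time. *)
move=> z Bz.
have pow0 x y : Calg iota s' r y -> exists N, Calg iota s' r (y * x ^+ N).
  by move=> Cy; exists 0%N; rewrite expr0 mulr1.
have [N hN] : exists N, Calg iota s' r (z * svar s r ^+ N).
  have := BC (inl k) (fun j e => ltac:(by [])) _ Bz; move: z {Bz}.
  apply: alg_min; first exact: pow_closed.
  move=> y [[[q qk [->|->]]|->]|[j [<-] ->]]; try exact: pow0.
  - have [->|qr] := eqVneq q r.
      by exists 1%N; rewrite expr1 mulVf //; apply: (sa1 cC').
    by apply: pow0; rewrite -x'E //; apply: Calg_inv.
  - by apply: pow0; rewrite -x'k; apply: Calg_var.
have [M hM] : exists M, Calg iota s' r (z * svar s (inl k) ^+ M).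
  have := BC _ nL _ Bz; move: z {Bz hN}; apply: alg_min; first exact: pow_closed.
  move=> y [[[q qr [->|->]]|->]|[j rj ->]]; try exact: pow0.
    have [->|qk] := eqVneq q (inl k).
      by exists 1%N; rewrite expr1 mulVf //; apply: (sa1 cC').
    by apply: pow0; rewrite -x'E //; apply: Calg_inv.
  (* The old neighbour of x_j is obtained from the new seed by mutating back at k and then at j. *)
  apply: pow0; have jk : j != k by apply: contra rk => /eqP <-; rewrite rj.
  have [g gj] := rank2_mutation iota sk' jk x0'; rewrite ss' => hg.
  have -> : nx s j = (xmon s' g)^-1 * (xmon s' g * nx s j).
    by rewrite mulKf // xmon_neq0.
  apply: (saM cC'); first by apply: Calg_mon_inv; rewrite rj.
  move: hg; apply: alg_min => // y' [[q _ <-]|->]; first exact: Calg_var.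
  by rewrite rj; apply: Calg_nx.
have hc : cop (Calg iota s' r) (svar s r) (svar s (inl k) ^+ M).
  apply: (copX cC') => //; rewrite xkE; apply: (copM cC') => //.
    by rewrite -xrE; apply: cop_exchange.
  by apply: (cop_inv cC'); rewrite ?invr_eq0 // invrK -x'k; apply: Calg_var.
elim: N hN => [|N IH] hN; first by move: hN; rewrite expr0 mulr1.
apply: IH; have -> : z * svar s r ^+ N = z * svar s r ^+ N.+1 / svar s r.
  by rewrite exprSr mulrA mulfK.
apply: hc => //; have -> : z * svar s r ^+ N.+1 * svar s (inl k) ^+ M / svar s r =
   (z * svar s (inl k) ^+ M) * svar s r ^+ N by rewrite exprSr; field.
by apply: (saM cC') => //; apply: (saX cC').
Qed.

Lemma invariant_mutations (B : set F) L s w : Ksubalg iota B ->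
  seed_invariant B L s -> seed_invariant B L (mutations w s).
Proof.
by move=> cB; elim: w s => [//|k w IH] s hs; apply: IH; apply: invariant_mutate.
Qed.

Lemma cluster_algebra_sub (B : set F) (L : {set J}) s : Ksubalg iota B ->
  seed_invariant B [set` L] s -> cluster_algebra_ext iota L s `<=` B.
Proof.
move=> cB hs; apply: smallest_sub.
  split; [exact: (sa0 cB)|exact: (saD cB)|move=> c x Bx].
  by apply: (saM cB) => //; apply: (sa_const cB).
apply: smallest_sub.
  by split; [exact: (sa1 cB)|exact: (saB cB)|exact: (saM cB)].
move=> x [[[j ->]|[j jL ->]]|[w [i ->]]].
- exact: (inv_var hs).
- exact: (inv_frozen hs).
- exact: (inv_var (invariant_mutations w cB hs)).
Qed.
End Step.

(** * The initial seeds *)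

Section Coordinates.
Variables (K : numFieldType) (F : fieldType) (iota : {rmorphism K -> F}).

Lemma indep_neq0 (T : eqType) (x : T -> F) r : indep iota x -> x r != 0.
Proof.
move=> /(_ (fun=> 1))[D dD /(_ r)]; apply: contra_eq_neq => ->.
by rewrite (der0 dD) eq_sym oner_eq0.
Qed.

Definition laurent (T : eqType) (t : F) (x : T -> F) :=
  alg iota ([set t] `|` [set t^-1] `|` range x).

Definition laurent_but (T : eqType) (t : F) (x : T -> F) r0 :=
  alg iota ([set t] `|` [set t^-1] `|` [set x r | r in [set r | r != r0]]).

Lemma laurent_closed (T : eqType) t (x : T -> F) : Ksubalg iota (laurent t x).
Proof. exact: alg_closed. Qed.

Lemma laurent_but_closed (T : eqType) t (x : T -> F) r0 :
  Ksubalg iota (laurent_but t x r0).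
Proof. exact: alg_closed. Qed.

Section Poly.
Variables (A : set F) (cA : Ksubalg iota A) (a : F) (D : F -> F).
Variables (dD : der iota D) (DA : forall z, A z -> D z = 0) (Da : D a = a).
Variable (a0 : a != 0).

(** The terms of p.[a] are eigenvectors of D for distinct eigenvalues, so a vanishing sum has
    vanishing terms. *)
Lemma transcendental (p : {poly F}) : (forall i, A p`_i) -> p.[a] = 0 -> p = 0.
Proof.
move=> hp pa; pose q i := p`_i * a ^+ i.
have ea : eigen D 1 a by rewrite /eigen mul1r.
have hq i : eigen D (0 + i%:Z) (q i).
  rewrite /q; apply: (eigenM dD); first by rewrite /eigen DA // mul0r.
  by have := eigenX dD i ea; rewrite mulr1.
have h0 : forall i, (i < size p)%N -> [set 0] (q i).
  apply: (eigen_components dD _ _ _ hq).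
  - by move=> x y -> ->; rewrite addr0.
  - by move=> c x ->; rewrite mulr0.
  - by move=> x ->; rewrite (der0 dD).
  - by rewrite /q -horner_coef.
apply/polyP => i; rewrite coef0; have [/h0 /eqP|] := ltnP i (size p).
  by rewrite /q mulf_eq0 expf_eq0 (negPf a0) andbF orbF => /eqP.
by move=> /leq_sizeP ->.
Qed.

Definition polyin (z : F) := exists2 p : {poly F}, forall i, A p`_i & z = p.[a].

Lemma polyin_closed : Ksubalg iota polyin.
Proof.
split=> [c|_ _ [p hp ->] [q hq ->]|_ _ [p hp ->] [q hq ->]].
- exists (iota c)%:P; rewrite ?hornerC // => i; rewrite coefC.
  by case: ifP => _; [exact: (sa_const cA)|exact: (sa0 cA)].
- exists (p + q); rewrite ?hornerD // => i; rewrite coefD.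
  exact: (saD cA).
- exists (p * q); rewrite ?hornerM // => i; rewrite coefM.
  by apply: (sa_sum cA) => j _; apply: (saM cA).
Qed.

Lemma polyin_const z : A z -> polyin z.
Proof.
move=> Az; exists z%:P; rewrite ?hornerC // => i; rewrite coefC.
by case: ifP => _ //; exact: (sa0 cA).
Qed.

Lemma polyin_gen : polyin a.
Proof.
exists 'X; rewrite ?hornerX // => i; rewrite coefX.
by case: eqP => _; [exact: (sa1 cA)|exact: (sa0 cA)].
Qed.

(** B is the polynomial ring A[a] over a domain: if a divides z b, then the constant term of z,
    multiplied by b, is zero, and a divides z. *)
Lemma polyin_cop (B : set F) b : Ksubalg iota B -> B `<=` polyin -> A `<=` B ->
  B a -> A b -> b != 0 -> cop B a b.
Proof.
move=> cB BP AB Ba Ab b0 z Bz Bw.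
have [p hp zE] := BP _ Bz; have [q hq wE] := BP _ Bw.
have e : p * b%:P = q * 'X.
  apply/eqP; rewrite -subr_eq0; apply/eqP; apply: transcendental => [i|].
    rewrite coefB coefMC coefMX; apply: (saB cA); first exact: (saM cA).
    by case: eqP => _ //; exact: (sa0 cA).
  by rewrite hornerD hornerN !hornerM hornerC hornerX -zE -wE divfK // subrr.
have p0 : root p 0.
  apply/eqP; rewrite horner_coef0; apply: (mulIf b0).
  by rewrite -coefMC e coefMX mul0r.
have [r pE] := factor_theorem _ _ p0; rewrite subr0 in pE.
have Br : B r.[a].
  rewrite horner_coef; apply: (sa_sum cB) => i _.
  apply: (saM cB); last exact: (saX cB).
  by have := hp i.+1; rewrite pE coefMX /= => /AB.
by rewrite zE pE hornerM hornerX mulfK.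
Qed.
End Poly.

Lemma coord_cop (T : eqType) t (x : T -> F) r0 b0 b' :
  indep iota (fun r => if r is Some i then x i else t) ->
  laurent_but t x r0 b0 -> b0 != 0 -> laurent t x b' ->
  cop (laurent t x) (x r0) (b0 + x r0 * b').
Proof.
move=> ix Ab b00 Bb'; set B := laurent t x; set A := laurent_but t x r0.
have cB : Ksubalg iota B by apply: laurent_closed.
have cA : Ksubalg iota A by apply: laurent_but_closed.
have x0 : x r0 != 0 by have := indep_neq0 (Some r0) ix.
have t0 : t != 0 by have := indep_neq0 None ix.
(* The Euler field of the variable x r0. *)
have [D dD hD] := ix (fun r => if r == Some r0 then x r0 else 0).
have Dt : D t = 0 by have := hD None.
have DA z : A z -> D z = 0.
  suff : A `<=` [set z | D z = 0] by apply.
  apply: alg_min => [|{}z [[->|->]|[r rr0 <-]]] //.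
  - split=> [c|y w hy hw|y w hy hw]; first exact: (derC dD).
      by rewrite /= (derD dD) hy hw addr0.
    by rewrite /= (derM dD) hy hw mul0r mulr0 addr0.
  - by rewrite /= (derV dD) // Dt oppr0 mul0r.
  - by have := hD (Some r); rewrite (inj_eq Some_inj) (negPf rr0).
have Da : D (x r0) = x r0 by have := hD (Some r0); rewrite eqxx.
have Ba : B (x r0) by apply: alg_gen; right; exists r0.
apply: (cop_addl cB) => //; apply: (polyin_cop cA dD DA Da) => //.
  apply: alg_min; first exact: polyin_closed.
  move=> z [[->|->]|[r _ <-]].
  - by apply: polyin_const => //; apply: alg_gen; left; left.
  - by apply: polyin_const => //; apply: alg_gen; left; right.
  - have [->|rr0] := eqVneq r r0; first exact: polyin_gen.
    by apply: polyin_const => //; apply: alg_gen; right; exists r.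
apply: alg_min => // z [[->|->]|[r _ <-]]; apply: alg_gen.
- by left; left.
- by left; right.
- by right; exists r.
Qed.
End Coordinates.

Definition o0 : 'I_3 := @Ordinal 3 0 isT.
Definition o1 : 'I_3 := @Ordinal 3 1 isT.
Definition o2 : 'I_3 := @Ordinal 3 2 isT.

Lemma ord3P (i : 'I_3) : [\/ i = o0, i = o1 | i = o2].
Proof.
by case: i => [[|[|[|//]]] p]; [apply: Or31|apply: Or32|apply: Or33]; apply: val_inj.
Qed.

Lemma big6 (R : Type) (id : R) (op : Monoid.com_law id) (f : 'I_3 + 'I_3 -> R) :
  \big[op/id]_i f i = op (op (f (inl o0)) (op (f (inl o1)) (f (inl o2))))
    (op (f (inr o0)) (op (f (inr o1)) (f (inr o2)))).
Proof.
rewrite big_sumType !big_ord_recl !big_ord0 !Monoid.mulm1.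
have -> : ord0 = o0 by apply: val_inj.
have -> : lift o0 ord0 = o1 :> 'I_3 by apply: val_inj.
by have -> : lift o0 (lift ord0 ord0) = o2 :> 'I_3 by apply: val_inj.
Qed.

Section Seed3.
Variables (F : fieldType).

Definition mkseed (xs ys : seq F) (b : seq (seq int)) : seed F 'I_3 'I_3 :=
  Seed (fun k : 'I_3 + 'I_3 =>
      match k with inl i => nth 0 xs i | inr j => nth 0 ys j end)
    (fun k (l : 'I_3) =>
      nth 0 (nth [::] b match k with inl i => i | inr j => (3 + j)%N end) l).

(** A form of [ppart] that reduces on integer literals. *)
Definition pp (b : int) : nat := if b is Posz n then n else 0%N.

Lemma pp_ppart b : ppart b = pp b.
Proof.
case: b => n; first exact: ppart_nat.
by apply/eqP; rewrite -eqz_nat ppartE NegzE /pp; lia.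
Qed.

Lemma mkseed_Mp xs ys b k : Mp (mkseed xs ys b) k =
  (nth 0 xs 0 ^+ pp (nth 0 (nth [::] b 0) k) *
   (nth 0 xs 1 ^+ pp (nth 0 (nth [::] b 1) k) *
    nth 0 xs 2 ^+ pp (nth 0 (nth [::] b 2) k))) *
  (nth 0 ys 0 ^+ pp (nth 0 (nth [::] b 3) k) *
   (nth 0 ys 1 ^+ pp (nth 0 (nth [::] b 4) k) *
    nth 0 ys 2 ^+ pp (nth 0 (nth [::] b 5) k))).
Proof. by rewrite /Mp big6 !pp_ppart. Qed.

Lemma mkseed_Mm xs ys b k : Mm (mkseed xs ys b) k =
  (nth 0 xs 0 ^+ pp (- nth 0 (nth [::] b 0) k) *
   (nth 0 xs 1 ^+ pp (- nth 0 (nth [::] b 1) k) *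
    nth 0 xs 2 ^+ pp (- nth 0 (nth [::] b 2) k))) *
  (nth 0 ys 0 ^+ pp (- nth 0 (nth [::] b 3) k) *
   (nth 0 ys 1 ^+ pp (- nth 0 (nth [::] b 4) k) *
    nth 0 ys 2 ^+ pp (- nth 0 (nth [::] b 5) k))).
Proof. by rewrite /Mm big6 !pp_ppart. Qed.
End Seed3.

Section Ind6.
Variables (K : numFieldType) (F : fieldType) (iota : {rmorphism K -> F}).

(** [indep] for six elements by name, so that partial derivatives are found by rewriting. *)
Definition ind6 (t a b c d e : F) := forall et ea eb ec ed ee : F,
  exists2 D, der iota D & [/\ D t = et, D a = ea, D b = eb, D c = ec
    & D d = ed /\ D e = ee].

Lemma ind6_replace t a b c d e y : ind6 t a b c d e ->
  (forall D, der iota D -> D t = 0 -> D a = 1 -> D b = 0 -> D c = 0 -> D d = 0 ->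
    D e = 0 -> D y != 0) -> ind6 t y b c d e.
Proof.
move=> ix hy et ea eb ec ed ee.
have [D0 dD0 [t0 a0 b0 c0 [d0 e0]]] := ix et 0 eb ec ed ee.
have [D1 dD1 [t1 a1 b1 c1 [d1 e1]]] := ix 0 1 0 0 0 0.
have y0 := hy _ dD1 t1 a1 b1 c1 d1 e1.
exists (fun z => 1 * D0 z + ((ea - D0 y) / D1 y) * D1 z); first exact: der_sum.
rewrite t1 b1 c1 d1 e1 t0 b0 c0 d0 e0 !mulr0 !addr0 !mul1r; split=> //.
by rewrite divfK // addrC subrK.
Qed.

Lemma ind6_neq0 t a b c d e y : ind6 t a b c d e ->
  (forall D, der iota D -> D t = 0 -> D a = 1 -> D b = 0 -> D c = 0 -> D d = 0 ->
    D e = 0 -> D y != 0) -> y != 0.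
Proof.
move=> /(_ 0 1 0 0 0 0)[D dD [t1 a1 b1 c1 [d1 e1]]] /(_ _ dD t1 a1 b1 c1 d1 e1).
by apply: contraNneq => ->; rewrite (der0 dD).
Qed.

(** The invertible t keeps its place; rotations bring any other variable into the slot in which
    [ind6_replace] and [laurent5_cop] work. *)
Lemma ind6_rot t a b c d e : ind6 t a b c d e -> ind6 t b c d e a.
Proof.
move=> h et ea eb ec ed ee.
by have [D dD [? ? ? ? [? ?]]] := h et ee ea eb ec ed; exists D.
Qed.

Definition vec5 (a b c d e : F) (i : 'I_5) : F := nth 0 [:: a; b; c; d; e] i.

Lemma ind6_indep t a b c d e : ind6 t a b c d e ->
  indep iota (fun r => if r is Some i then vec5 a b c d e i else t).
Proof.
move=> h f; pose g k (p : (k < 5)%N) := f (Some (Ordinal p)).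
have [D dD [h0 h1 h2 h3 [h4 h5]]] := h (f None) (@g 0 isT) (@g 1 isT) (@g 2 isT)
  (@g 3 isT) (@g 4 isT).
exists D => // -[[[|[|[|[|[|//]]]]] p]|//]; rewrite /vec5 /= ?h0 ?h1 ?h2 ?h3 ?h4 ?h5 /g;
  by congr (f (Some _)); apply: val_inj.
Qed.

Lemma ind6_seed xs ys b x0 x1 x2 y0 y1 y2 : xs = [:: x0; x1; x2] ->
  ys = [:: y0; y1; y2] -> ind6 x0 x1 x2 y0 y1 y2 ->
  indep iota (svar (mkseed xs ys b)).
Proof.
move=> -> -> h f.
have [D dD [h0 h1 h2 h3 [h4 h5]]] := h (f (inl o0)) (f (inl o1)) (f (inl o2))
  (f (inr o0)) (f (inr o1)) (f (inr o2)).
by exists D => // -[i|j]; [have [->|->|->] := ord3P i|have [->|->|->] := ord3P j].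
Qed.

Definition laurent5 t a b c d e := laurent iota t (vec5 a b c d e).

Lemma laurent5_closed t a b c d e : Ksubalg iota (laurent5 t a b c d e).
Proof. exact: laurent_closed. Qed.

Lemma laurent5_gen t a b c d e (B := laurent5 t a b c d e) :
  [/\ B t, B t^-1, B a, B b & [/\ B c, B d & B e]].
Proof.
have hv i : B (vec5 a b c d e i) by apply: alg_gen; right; exists i.
split; [by apply: alg_gen; left; left|by apply: alg_gen; left; right| | |split].
- exact: (hv (@Ordinal 5 0 isT)).
- exact: (hv (@Ordinal 5 1 isT)).
- exact: (hv (@Ordinal 5 2 isT)).
- exact: (hv (@Ordinal 5 3 isT)).
- exact: (hv (@Ordinal 5 4 isT)).
Qed.

Lemma laurent5_min t a b c d e (A : set F) : Ksubalg iota A -> A t -> A t^-1 ->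
  A a -> A b -> A c -> A d -> A e -> laurent5 t a b c d e `<=` A.
Proof.
move=> cA At Ati *; apply: alg_min => // z [[->|->]|[i _ <-]] //.
by case: i => [[|[|[|[|[|//]]]]] p].
Qed.

Lemma laurent5_rot t a b c d e :
  laurent5 t a b c d e = laurent5 t b c d e a.
Proof.
rewrite eqEsubset; split.
  have [? ? ? ? [? ? ?]] := laurent5_gen t b c d e a.
  by apply: laurent5_min => //; apply: laurent5_closed.
have [? ? ? ? [? ? ?]] := laurent5_gen t a b c d e.
by apply: laurent5_min => //; apply: laurent5_closed.
Qed.

Definition laurent4 t b c d e := alg iota [set z | z \in [:: t; t^-1; b; c; d; e]].

Lemma laurent4_closed t b c d e : Ksubalg iota (laurent4 t b c d e).
Proof. exact: alg_closed. Qed.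

Lemma laurent4_gen t b c d e (A := laurent4 t b c d e) :
  [/\ A t, A t^-1, A b, A c & A d /\ A e].
Proof. by split; [..|split]; apply: alg_gen; rewrite /= !inE eqxx ?orbT. Qed.

Lemma laurent5_cop t a b c d e b0 b' : ind6 t a b c d e ->
  laurent4 t b c d e b0 -> b0 != 0 -> laurent5 t a b c d e b' ->
  cop (laurent5 t a b c d e) a (b0 + a * b').
Proof.
move=> h A0 b00 Bb'; have cL := laurent_but_closed iota t (vec5 a b c d e) (@Ordinal 5 0 isT).
apply: (coord_cop (r0 := @Ordinal 5 0 isT) (ind6_indep h)) => //.
have hv i : i != @Ordinal 5 0 isT ->
    laurent_but iota t (vec5 a b c d e) (@Ordinal 5 0 isT) (vec5 a b c d e i).
  by move=> hi; apply: alg_gen; right; exists i.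
move: A0; apply: alg_min; first exact: cL.
move=> z; rewrite /= !inE => /or4P[/eqP ->|/eqP ->|/eqP ->|/or3P[] /eqP ->].
- by apply: alg_gen; left; left.
- by apply: alg_gen; left; right.
- exact: (hv (@Ordinal 5 1 isT)).
- exact: (hv (@Ordinal 5 2 isT)).
- exact: (hv (@Ordinal 5 3 isT)).
- exact: (hv (@Ordinal 5 4 isT)).
Qed.
End Ind6.

Ltac samem cA := repeat first
  [ assumption | apply: (saX cA) | apply: (saN cA) | apply: (saM cA)
  | apply: (saD cA) | apply: (sa1 cA) | apply: (sa0 cA) | apply: (sa_nat cA) ].

Ltac dersimp dD := rewrite ?(derB dD, derD dD, derN dD, derM dD, derX dD, der_nat dD, der1 dD).

Section Frozen.
Variables (K : numFieldType) (F : fieldType) (iota : {rmorphism K -> F}).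
Variables (B : set F) (cB : Ksubalg iota B).

(** Coprimality is symmetric, and trivial with the inverted coefficient; ten pairs remain. *)
Lemma cop_list3 (s : seed F 'I_3 'I_3) : (forall r, svar s r != 0) ->
  B (svar s (inr o2))^-1 ->
  cop B (svar s (inl o0)) (svar s (inl o1)) ->
  cop B (svar s (inl o0)) (svar s (inl o2)) ->
  cop B (svar s (inl o0)) (svar s (inr o0)) ->
  cop B (svar s (inl o0)) (svar s (inr o1)) ->
  cop B (svar s (inl o1)) (svar s (inl o2)) ->
  cop B (svar s (inl o1)) (svar s (inr o0)) ->
  cop B (svar s (inl o1)) (svar s (inr o1)) ->
  cop B (svar s (inl o2)) (svar s (inr o0)) ->
  cop B (svar s (inl o2)) (svar s (inr o1)) ->
  cop B (svar s (inr o0)) (svar s (inr o1)) ->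
  forall r q, r != q -> cop B (svar s r) (svar s q).
Proof.
move=> x0 Bu ? ? ? ? ? ? ? ? ? ? r q.
have hs a b : cop B (svar s a) (svar s b) -> cop B (svar s b) (svar s a).
  by apply: cop_sym.
have ul a : cop B (svar s (inr o2)) a by apply: (cop_invl cB).
have ur a : cop B a (svar s (inr o2)) by apply: (cop_inv cB).
by case: r => i; case: q => j; have [->|->|->] := ord3P i;
  have [->|->|->] := ord3P j; rewrite ?eqxx // => _; apply: hs.
Qed.
End Frozen.

Section Extension.
Variables (K : numFieldType) (F : fieldType) (iota : {rmorphism K -> F}).
Variables (I J : finType) (L : {set J}) (s : seed F I J).
Let A := cluster_algebra_ext iota L s.

Lemma cluster_sub_ext x : cluster_algebra L s x -> A x.
Proof. by move=> hx M [_ hM]; apply: hM. Qed.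

Lemma cluster_ext_closed : Ksubalg iota A.
Proof.
have A1 : cluster_algebra L s 1 by move=> M [[]].
have AM x y : cluster_algebra L s x -> cluster_algebra L s y ->
    cluster_algebra L s (x * y).
  move=> hx hy M [cM hM]; have [_ _ MM] := cM.
  by apply: MM; [exact: hx|exact: hy].
have Z c x : A x -> A (iota c * x).
  by move=> hx M [cM hM]; have [_ _ MZ] := cM; apply: MZ; apply: hx.
have S x y : A x -> A y -> A (x + y).
  move=> hx hy M [cM hM]; have [_ MD _] := cM.
  by apply: MD; [exact: hx|exact: hy].
have A0 : A 0 by move=> M [[]].
split=> [c|x y|x y hx]; [|exact: S|move: x hx].
  by rewrite -[iota c]mulr1; apply: Z; apply: cluster_sub_ext.
move=> x hx hy; move: x hx; apply: smallest_sub.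
  split=> [|x z|c x]; rewrite /= ?mul0r ?mulrDl -?mulrA; [exact: A0|exact: S|exact: Z].
move=> x hx /=; move: y hy; apply: smallest_sub.
  split=> [|y z|c y]; rewrite /= ?mulr0 ?mulrDr 1?mulrCA; [exact: A0|exact: S|exact: Z].
by move=> y hy /=; apply: cluster_sub_ext; apply: AM.
Qed.

Lemma ext_var w i : A (svar (mutations w s) (inl i)).
Proof.
by apply: cluster_sub_ext => M [_]; apply; right; exists w, i.
Qed.
Lemma ext_frozen j : A (svar s (inr j)).
Proof. by apply: cluster_sub_ext => M [_]; apply; left; left; exists j. Qed.
Lemma ext_frozen_inv j : j \in L -> A (svar s (inr j))^-1.
Proof. by move=> h; apply: cluster_sub_ext => M [_]; apply; left; right; exists j. Qed.
End Extension.

(** A boolean test of matrix mutation, so that explicit mutations are verified by computation. *)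
Definition mx_mut (k : 'I_3) (b b' : seq (seq int)) : bool :=
  all (fun i => all (fun l => nth 0 (nth [::] b' i) l ==
    if (i == k) || (l == k) then - nth 0 (nth [::] b i) l
    else nth 0 (nth [::] b i) l
      + bmut (nth 0 (nth [::] b i) k) (nth 0 (nth [::] b k) l))
    (seq.iota 0 3)) (seq.iota 0 6).

Lemma mutate_mkseed (F : fieldType) k (xs ys xs' : seq F) b b' :
  mx_mut k b b' ->
  (forall i : 'I_3, nth 0 xs' i = if i == k then nx (mkseed xs ys b) k else nth 0 xs i) ->
  mutate k (mkseed xs ys b) = mkseed xs' ys b'.
Proof.
move=> /allP hb hx; apply: seed_eq; apply/funext => -[i|j].
- rewrite -[RHS]/(nth 0 xs' i) hx; case: (eqVneq i k) => [->|ik] //.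
  by rewrite svar_mut.
- by rewrite svar_mut.
- apply/funext => l; rewrite smat_mut.
  have /hb/allP/(_ l) : nat_of_ord i \in seq.iota 0 6.
    by rewrite mem_iota; have := ltn_ord i; lia.
  by rewrite mem_iota ltn_ord => /(_ isT)/eqP.
- apply/funext => l; rewrite smat_mut.
  have /hb/allP/(_ l) : (3 + j)%N \in seq.iota 0 6.
    by rewrite mem_iota; have := ltn_ord j; lia.
  rewrite mem_iota ltn_ord => /(_ isT)/eqP e.
  transitivity (nth 0 (nth [::] b' (3 + j)) l); last by [].
  rewrite e.
  by have -> : (3 + j == k)%N = false by have := ltn_ord k; lia.
Qed.

Ltac dernz dD := dersimp dD;
  repeat match goal with e : ?D ?x = _ |- _ => rewrite !e; clear e end;
  rewrite ?(mulr0, mul0r, addr0, add0r, sub0r, subr0, mulr1, mul1r, oppr0).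

(** * The seed of the short root in coordinates *)

Section ShortRoot.
Variables (K : numFieldType) (F : fieldType) (iota : {rmorphism K -> F}).
Variables (t x1 x2 h x4 x5 : F).
Hypothesis ind : ind6 iota t x1 x2 h x4 x5.

Definition short_mx : seq (seq int) :=
  [:: [:: 0; -3; 1]; [:: 1; 0; -1]; [:: -1; 3; 0];
      [:: 1; 0; 0]; [:: -1; 1; 0]; [:: 0; -3; 2]].

(** Here h stands for X_0, that is x_3 / 2, and the invariant quadric reads t x_6 = x_1 x_5 - x_2
    x_4 + h^2. Thus [short_F1] is x_6 = X_(-1), and the other two functions are X_2 and X_(-2). *)
Definition short_X2 := x1 * x2 ^+ 2 - t * x2 * h - t ^+ 2 * x5.
Definition short_F1 := (x1 * x5 - x2 * x4 + h ^+ 2) / t.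
Definition short_F2 := h * (t * short_F1 + x1 * x5)
  - t * x4 * x5 - x1 * x2 * short_F1.
Local Notation X2 := short_X2.
Local Notation F1 := short_F1.
Local Notation F2 := short_F2.

Definition short_seed := mkseed [:: x5; X2; x2] [:: F1; F2; t] short_mx.

Let B := laurent5 iota t x1 x2 h x4 x5.
Let cB : Ksubalg iota B. Proof. exact: laurent5_closed. Qed.

Let t0 : t != 0.
Proof. by have := indep_neq0 None (ind6_indep ind). Qed.
Let nzc i := indep_neq0 (Some i) (ind6_indep ind).
Let x10 : x1 != 0. Proof. exact: (nzc (@Ordinal 5 0 isT)). Qed.
Let x20 : x2 != 0. Proof. exact: (nzc (@Ordinal 5 1 isT)). Qed.
Let h0 : h != 0. Proof. exact: (nzc (@Ordinal 5 2 isT)). Qed.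
Let x40 : x4 != 0. Proof. exact: (nzc (@Ordinal 5 3 isT)). Qed.
Let x50 : x5 != 0. Proof. exact: (nzc (@Ordinal 5 4 isT)). Qed.

Let ind_x5 : ind6 iota t x5 x1 x2 h x4.
Proof. by do 4 apply: ind6_rot. Qed.
Let ind_x4 : ind6 iota t x4 x5 x1 x2 h.
Proof. by do 3 apply: ind6_rot. Qed.
Let ind_x2 : ind6 iota t x2 h x4 x5 x1.
Proof. by apply: ind6_rot. Qed.

(** The constant terms that occur in the coprimality proofs. Each is affine in one coordinate, with
    nonzero derivative along it. *)
Let nz1 : x1 * x2 - t * h != 0.
Proof.
apply: (ind6_neq0 ind) => D dD e0 e1 e2 e3 e4 e5.
by dernz dD.
Qed.
Let nz2 : h ^+ 2 - x2 * x4 != 0.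
Proof.
apply: (ind6_neq0 ind_x4) => D dD e0 e1 e2 e3 e4 e5.
by dernz dD; rewrite oppr_eq0.
Qed.
Let nz3 : x1 * x5 + h ^+ 2 != 0.
Proof.
apply: (ind6_neq0 ind) => D dD e0 e1 e2 e3 e4 e5.
by dernz dD.
Qed.
Let nz4 : 2 * x1 * h * x5 + h ^+ 3 - t * x4 * x5 != 0.
Proof.
apply: (ind6_neq0 ind_x4) => D dD e0 e1 e2 e3 e4 e5.
by dernz dD; rewrite oppr_eq0 mulf_neq0.
Qed.
Let nz5 : (x1 * x5 + h ^+ 2) * t - x2 * x1 * h != 0.
Proof.
apply: (ind6_neq0 ind_x5) => D dD e0 e1 e2 e3 e4 e5.
by dernz dD; rewrite mulf_neq0.
Qed.
Let nz6 : x1 * (x1 * x2 ^+ 2 - t * x2 * h) + (h ^+ 2 - x2 * x4) * t ^+ 2 != 0.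
Proof.
apply: (ind6_neq0 ind_x4) => D dD e0 e1 e2 e3 e4 e5.
by dernz dD; rewrite mulNr oppr_eq0 mulf_neq0 ?expf_neq0.
Qed.
Let nz7 : h * t - x1 * x2 != 0.
Proof. by rewrite [h * t]mulrC -oppr_eq0 opprB. Qed.

(** In the exchange relations the denominators x5, X2 and x2 cancel, and the neighbours are
    polynomials in the coordinates and 1 / t. *)
Let n1 : nx short_seed o0 = - t * x1 * x5 - t * h ^+ 2 + x1 * x2 * h.
Proof.
rewrite nxE mkseed_Mp mkseed_Mm /=; rewrite /F2 /F1 /X2; field.
by rewrite t0 x50.
Qed.
Let X20 : X2 != 0.
Proof.
apply: (ind6_neq0 ind_x5) => D dD e0 e1 e2 e3 e4 e5.
by rewrite /X2; dernz dD; rewrite oppr_eq0 expf_neq0.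
Qed.
Let n2 : nx short_seed o1 = - t * x5 ^+ 2 + x2 * h * x5
  - (x1 * x5 - x2 * x4 + h ^+ 2) * x2 ^+ 2 / t.
Proof.
rewrite nxE mkseed_Mp mkseed_Mm /=; move: X20; rewrite /F2 /F1 /X2 => ?.
by field; apply/andP.
Qed.
Let n3 : nx short_seed o2 = x1 * x2 - t * h.
Proof.
rewrite nxE mkseed_Mp mkseed_Mm /= /X2; field.
by rewrite x20.
Qed.

Let B_x5 : B = laurent5 iota t x5 x1 x2 h x4.
Proof. by rewrite /B; do 4 rewrite laurent5_rot. Qed.
Let B_x2 : B = laurent5 iota t x2 h x4 x5 x1.
Proof. by rewrite /B laurent5_rot. Qed.

Let Bgen : [/\ B t, B t^-1, B x1, B x2 & [/\ B h, B x4 & B x5]].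
Proof. exact: laurent5_gen. Qed.
Ltac gens x y z u v := have [? ? ? ? [? ? ?]] := Bgen;
  have cL := laurent4_closed iota x y z u v;
  have [? ? ? ? [? ?]] := laurent4_gen iota x y z u v.
Let BF1 : B F1.
Proof. by have [? ? ? ? [? ? ?]] := Bgen; rewrite /F1; samem cB. Qed.
Let BF2 : B F2.
Proof. by have [? ? ? ? [? ? ?]] := Bgen; rewrite /F2; samem cB. Qed.
Let BX2 : B X2.
Proof. by have [? ? ? ? [? ? ?]] := Bgen; rewrite /X2; samem cB. Qed.

Let F10 : F1 != 0.
Proof.
rewrite /F1 mulf_neq0 ?invr_eq0 //.
apply: (ind6_neq0 ind) => D dD e0 e1 e2 e3 e4 e5.
by dernz dD.
Qed.

Let c_x5 b : (exists b0 b', [/\ laurent4 iota t x1 x2 h x4 b0, b0 != 0, B b' &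
  b = b0 + x5 * b']) -> cop B x5 b.
Proof.
by move=> [b0 [b' [h1 h2]]]; rewrite B_x5 => h3 ->; apply: laurent5_cop.
Qed.
Let c_x2 b : (exists b0 b', [/\ laurent4 iota t h x4 x5 x1 b0, b0 != 0, B b' &
  b = b0 + x2 * b']) -> cop B x2 b.
Proof.
by move=> [b0 [b' [h1 h2]]]; rewrite B_x2 => h3 ->; apply: laurent5_cop.
Qed.

Let c12 : cop B x5 X2.
Proof.
gens t x1 x2 h x4.
apply: c_x5; exists (x2 * (x1 * x2 - t * h)), (- t ^+ 2); split.
- by samem cL.
- by rewrite mulf_neq0.
- by samem cB.
- by rewrite /X2; ring.
Qed.
Let c13 : cop B x5 x2.
Proof.
gens t x1 x2 h x4.
by apply: c_x5; exists x2, 0; split; rewrite ?mulr0 ?addr0 //; samem cB.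
Qed.
Let c1F : cop B x5 F1.
Proof.
gens t x1 x2 h x4.
apply: c_x5; exists ((h ^+ 2 - x2 * x4) / t), (x1 / t); split.
- by samem cL.
- by rewrite mulf_neq0 ?invr_eq0.
- by samem cB.
- by rewrite /F1; field.
Qed.
Let c1G : cop B x5 F2.
Proof.
gens t x1 x2 h x4.
apply: c_x5; exists ((h ^+ 2 - x2 * x4) * (h * t - x1 * x2) / t),
  (- t * x4 + 2 * x1 * h - x1 ^+ 2 * x2 / t); split.
- by samem cL.
- by rewrite !mulf_neq0 ?invr_eq0.
- by samem cB.
- by rewrite /F2 /F1; field.
Qed.
Let c32 : cop B x2 X2.
Proof.
gens t h x4 x5 x1.
apply: c_x2; exists (- t ^+ 2 * x5), (x1 * x2 - t * h); split.
- by samem cL.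
- by rewrite mulf_neq0 ?oppr_eq0 ?expf_neq0.
- by samem cB.
- by rewrite /X2; ring.
Qed.
Let c3F : cop B x2 F1.
Proof.
gens t h x4 x5 x1.
apply: c_x2; exists ((x1 * x5 + h ^+ 2) / t), (- x4 / t); split.
- by samem cL.
- by rewrite mulf_neq0 ?invr_eq0.
- by samem cB.
- by rewrite /F1; field.
Qed.
Let c3G : cop B x2 F2.
Proof.
gens t h x4 x5 x1.
apply: c_x2; exists (2 * x1 * h * x5 + h ^+ 3 - t * x4 * x5),
  (- h * x4 - (x1 * x5 - x2 * x4 + h ^+ 2) * x1 / t); split.
- by samem cL.
- by [].
- by samem cB.
- by rewrite /F2 /F1; field.
Qed.

(** A coordinate that can replace x4, chosen because F2 is x5 v modulo F1. It is also a cluster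
    variable, at two mutations from the initial seed. *)
Let v := x1 * h - t * x4.

Let cvF : cop B v F1.
Proof.
gens t x5 x1 x2 h.
have [? ? ? ? [? ? ?]] := laurent5_gen iota t v x5 x1 x2 h.
have Bv : B = laurent5 iota t v x5 x1 x2 h.
  have x4E : x4 = (x1 * h - v) / t by rewrite /v; field.
  rewrite /B eqEsubset; split; apply: laurent5_min => //; try exact: laurent5_closed.
    have cV := laurent5_closed iota t v x5 x1 x2 h.
    by rewrite x4E; samem cV.
  by rewrite /v; samem cB.
rewrite Bv; set L5 := laurent5 _ _ _ _ _ _ _.
have cV : Ksubalg iota L5 by apply: laurent5_closed.
have -> : F1 = ((x1 * x5 + h ^+ 2) * t - x2 * x1 * h) / t ^+ 2 + v * (x2 / t ^+ 2).
  by rewrite /F1 /v; field.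
apply: laurent5_cop.
- apply: (ind6_replace ind_x4) => D dD e0 e1 e2 e3 e4 e5.
  by rewrite /v; dernz dD; rewrite oppr_eq0.
- have ? : laurent4 iota t x5 x1 x2 h (t ^+ 2)^-1 by rewrite -exprVn; samem cL.
  by samem cL.
- by rewrite mulf_neq0 ?invr_eq0 ?expf_neq0.
- have ? : L5 (t ^+ 2)^-1 by rewrite -exprVn; samem cV.
  by samem cV.
Qed.

Let v0 : v != 0.
Proof.
apply: (ind6_neq0 ind_x4) => D dD e0 e1 e2 e3 e4 e5.
by rewrite /v; dernz dD; rewrite oppr_eq0.
Qed.

Let cFG : cop B F1 F2.
Proof.
have [? ? ? ? [? ? ?]] := Bgen.
have -> : F2 = x5 * v + F1 * (h * t - x1 * x2).
  by rewrite /F2 /F1 /v; field.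
apply: (cop_addl cB) => //; first by samem cB.
by apply: (copM cB) => //; apply: cop_sym.
Qed.

(** The extended cluster is reached from the coordinates by replacing x1 by X2, then x4 by F1, then
    h by F2. *)
Let ind_X2 : ind6 iota t X2 x2 h x4 x5.
Proof.
apply: (ind6_replace ind) => D dD e0 e1 e2 e3 e4 e5.
by rewrite /X2; dernz dD; rewrite expf_neq0.
Qed.

(** As t is invertible, X2 can replace x5 as a coordinate of B, and F1 is reduced modulo it. *)
Let c2F : cop B X2 F1.
Proof.
gens t x1 x2 h x4.
have [? ? ? ? [? ? ?]] := laurent5_gen iota t X2 x1 x2 h x4.
have Lt : laurent4 iota t x1 x2 h x4 (t ^+ 2)^-1 by rewrite -exprVn; samem cL.
have Bv : B = laurent5 iota t X2 x1 x2 h x4.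
  have x5E : x5 = (x1 * x2 ^+ 2 - t * x2 * h - X2) * t^-1 ^+ 2 by rewrite /X2; field.
  rewrite /B eqEsubset; split; apply: laurent5_min => //; try exact: laurent5_closed.
  have cV := laurent5_closed iota t X2 x1 x2 h x4.
  by rewrite x5E; samem cV.
rewrite Bv; set L5 := laurent5 _ _ _ _ _ _ _.
have cV : Ksubalg iota L5 by apply: laurent5_closed.
have -> : F1 = (x1 * (x1 * x2 ^+ 2 - t * x2 * h) + (h ^+ 2 - x2 * x4) * t ^+ 2)
    * t^-1 ^+ 3 + X2 * (- x1 * t^-1 ^+ 3).
  by rewrite /F1 /X2; field.
apply: laurent5_cop.
- apply: (ind6_replace ind_x5) => D dD e0 e1 e2 e3 e4 e5.
  by rewrite /X2; dernz dD; rewrite oppr_eq0 expf_neq0.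
- by samem cL.
- by rewrite mulf_neq0 ?expf_neq0 ?invr_eq0.
- by samem cV.
Qed.

Let F20 : F2 != 0.
Proof.
suff : t * F2 != 0 by rewrite mulf_eq0 negb_or => /andP[].
have -> : t * F2 = x4 * X2 + (h ^+ 3 * t + 2 * x1 * h * x5 * t
    - x1 ^+ 2 * x2 * x5 - x1 * x2 * h ^+ 2).
  by rewrite /F2 /F1 /X2; field.
apply: (ind6_neq0 ind_x4) => D dD e0 e1 e2 e3 e4 e5; move: X20.
by rewrite /X2; dernz dD.
Qed.

(** X2 is a factor of its exchange binomial, which is x5^3 t^3 modulo F2; x5 is coprime to F2 and t
    is a unit. *)
Let c2G : cop B X2 F2.
Proof.
have [? ? ? ? [? ? ?]] := Bgen.
apply: cop_sym => //; apply: (cop_factor (c := nx short_seed o1) cB).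
  by rewrite n2; samem cB.
have -> : X2 * nx short_seed o1 = x5 ^+ 3 * t ^+ 3 + F2 * x2 ^+ 3.
  rewrite nxE mkseed_Mp mkseed_Mm /=; field; exact: X20.
apply: (cop_addl cB) => //; first by samem cB.
apply: (copM cB); first by samem cB.
  by apply: (copX cB) => //; apply: cop_sym.
by apply: (copX cB) => //; apply: (cop_inv cB).
Qed.

Let ind_F1 : ind6 iota t F1 x5 X2 x2 h.
Proof.
apply: (ind6_replace (a := x4)); first by do 3 apply: ind6_rot.
move=> D dD e0 e1 e2 e3 e4 e5.
(* With x1 eliminated in favour of X2, this is affine in x4 with slope - x2^3. *)
have : D (t * x2 ^+ 2 * F1) = D ((X2 + t * x2 * h + t ^+ 2 * x5) * x5
   - x2 ^+ 3 * x4 + h ^+ 2 * x2 ^+ 2).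
  by congr (D _); rewrite /F1 /X2; field.
move: F1 X2 e3 => f x e3; dernz dD => e; apply: contra_eq_neq e => ->.
by rewrite mulr0 eq_sym oppr_eq0 expf_neq0.
Qed.

Let ind_F2 : ind6 iota t F2 F1 x5 X2 x2.
Proof.
apply: (ind6_replace (a := h)); first by do 4 apply: ind6_rot.
move=> D dD e0 e1 e2 e3 e4 e5.
(* With x1 and x4 eliminated in favour of X2 and F1, this is affine in h with slope x2 x5 X2. *)
have : D (x2 ^+ 3 * F2) = D (- (x2 ^+ 2 * F1 * (X2 + t ^+ 2 * x5))
   + h * x5 * X2 * x2 - t * x5 ^+ 2 * (X2 + t ^+ 2 * x5) + t ^+ 2 * x2 ^+ 2 * x5 * F1).
  by congr (D _); rewrite /F2 /F1 /X2; field.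
move: F1 F2 (X2) X20 e2 e4 => f g x xn0 e2 e4.
dernz dD => e; apply: contra_eq_neq e => ->.
by rewrite mulr0 eq_sym !mulf_neq0.
Qed.

Let xn0 r : svar short_seed r != 0.
Proof. by case: r => i; have [->|->|->] := ord3P i. Qed.

Let Svar r q : Calg iota short_seed r (svar short_seed q).
Proof. exact: Calg_var. Qed.
Let Sinv r q : q != r -> Calg iota short_seed r (svar short_seed q)^-1.
Proof. exact: Calg_inv. Qed.

Lemma short_invariant : seed_invariant iota B [set j | j = o2] short_seed.
Proof.
have [? ? ? ? [? ? ?]] := Bgen; split.
- exists (fun i : 'I_3 => nth 0 [:: 1; 3; 1] i) => [i|i j].
    by have [->|->|->] := ord3P i.
  by have [->|->|->] := ord3P i; have [->|->|->] := ord3P j.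
(* The rows of indices 1, -2 and -1 form a unimodular triangular block; the other degrees are
   zero. *)
- move=> w; exists (fun r : 'I_3 + 'I_3 => match r with
    | inl i => nth 0 [:: w o2; 0; 0] i
    | inr j => nth 0 [:: w o0 + w o1 + 3 * w o2; w o1 + 3 * w o2; 0] j end) => j.
  by rewrite big6; have [->|->|->] := ord3P j => /=; ring.
- apply: (ind6_seed _ erefl erefl) => e0 e1 e2 e3 e4 e5.
  by have [D dD [? ? ? ? [? ?]]] := ind_F2 e5 e4 e3 e0 e1 e2; exists D.
- exact: xn0.
- by case=> i; have [->|->|->] := ord3P i.
- by move=> i; have [->|->|->] := ord3P i; rewrite ?n1 ?n2 ?n3; samem cB.
- by move=> j ->.
- by apply: (cop_list3 cB) => //; apply: cop_sym.
move=> r nL; pose S := Calg iota short_seed r.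
have cS : Ksubalg iota S by apply: Calg_closed.
have Sx5 : S x5 := @Svar r (inl o0).
have SX2 : S X2 := @Svar r (inl o1).
have Sx2 : S x2 := @Svar r (inl o2).
have SF1 : S F1 := @Svar r (inr o0).
have SF2 : S F2 := @Svar r (inr o1).
have St : S t := @Svar r (inr o2).
have ti : S t^-1.
  apply: (@Calg_inv _ _ iota _ _ short_seed r (inr o2)).
  by apply/eqP => e; apply: (nL o2).
have i1 : r != inl o0 -> S x5^-1 by rewrite eq_sym; exact: Sinv.
have i2 : r != inl o1 -> S X2^-1 by rewrite eq_sym; exact: Sinv.
have i3 : r != inl o2 -> S x2^-1 by rewrite eq_sym; exact: Sinv.
(* a and c are the neighbours of x5 and x2. For each r the coordinates are recovered by formulas
   that avoid the inverse of x_r and use its neighbour instead. *)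
pose a := - t * x1 * x5 - t * h ^+ 2 + x1 * x2 * h.
pose c := x1 * x2 - t * h.
have Sa : r != inl o1 -> S a.
  move=> r1; have [r0|r0] := eqVneq r (inl o0).
    by rewrite /a -n1 /S r0; apply: Calg_nx.
  have -> : a = (X2 * F1 + x2 * F2) / x5 by rewrite /a /F2 /F1 /X2; field; rewrite ?x20 ?x50 ?t0.
  by have ? := i1 r0; samem cS.
have Sc : S c.
  have [r0|r0] := eqVneq r (inl o2).
    by rewrite /c -n3 /S r0; apply: Calg_nx.
  have -> : c = (x5 * t ^+ 2 + X2) / x2 by rewrite /c /X2; field.
  by have ? := i3 r0; samem cS.
have Sh : S h.
  have [r1|r1] := eqVneq r (inl o1).
    have -> : h = x2 * F1 / x5 + t * x5 / x2 + nx short_seed o1 / (x2 * x5).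
      by rewrite n2 /F1; field; rewrite ?x20 ?x50 ?t0.
    have ? : S (nx short_seed o1) by rewrite /S r1; apply: Calg_nx.
    have ? : S x5^-1 by apply: i1; rewrite r1.
    have ? : S x2^-1 by apply: i3; rewrite r1.
    have ? : S (x2 * x5)^-1 by rewrite invfM; samem cS.
    by samem cS.
  have -> : h = (x2 * a + t * x5 * c) / X2.
    by move: X20; rewrite /a /c /X2 => ?; field.
  by have ? := i2 r1; have ? := Sa r1; samem cS.
have Sx1 : S x1.
  have [r2|r2] := eqVneq r (inl o2).
    have -> : x1 = (c ^+ 2 + t * a) / X2.
      by move: X20; rewrite /a /c /X2 => ?; field.
    have ? : S X2^-1 by apply: i2; rewrite r2.
    have ? : S a by apply: Sa; rewrite r2.
    by samem cS.
  have -> : x1 = (c + t * h) / x2 by rewrite /c; field.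
  by have ? := i3 r2; samem cS.
have Sx4 : S x4.
  have [r2|r2] := eqVneq r (inl o2).
    have -> : x4 = (x1 * h - (F1 * c + F2) / x5) / t.
      by rewrite /c /F2 /F1; field; rewrite ?x20 ?x50 ?t0.
    have ? : S x5^-1 by apply: i1; rewrite r2.
    by samem cS.
  have -> : x4 = (x1 * x5 + h ^+ 2 - t * F1) / x2 by rewrite /F1; field; rewrite ?x20 ?x50 ?t0.
  by have ? := i3 r2; samem cS.
exact: laurent5_min.
Qed.

Lemma short_upper : B `<=` cluster_algebra_ext iota [set o2]%SET short_seed.
Proof.
pose A := cluster_algebra_ext iota [set o2]%SET short_seed.
have cA : Ksubalg iota A by apply: cluster_ext_closed.
(* Mutation at 3, 1, 2 produces c, v and w in turn, and a further mutation at 3 gives x1. Then h and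
   x4 are read off from c and v, where their coefficient is the unit - t. *)
pose c := x1 * x2 - t * h.
pose w := t ^+ 2 * x4 - 2 * t * x1 * h + x1 ^+ 2 * x2.
have m1 : mutate o2 short_seed = mkseed [:: x5; X2; c] [:: F1; F2; t]
    [:: [:: 0; 0; -1]; [:: 0; 0; 1]; [:: 1; -3; 0];
        [:: 1; 0; 0]; [:: -1; 1; 0]; [:: 0; 3; -2]].
  by apply: mutate_mkseed => // i; have [->|->|->] := ord3P i => //=; rewrite n3.
have m2 : mutations [:: o2; o0] short_seed = mkseed [:: v; X2; c] [:: F1; F2; t]
    [:: [:: 0; 0; 1]; [:: 0; 0; 1]; [:: -1; -3; 0];
        [:: -1; 0; 0]; [:: 1; 1; -1]; [:: 0; 3; -2]].
  rewrite /mutations /= m1; apply: mutate_mkseed => // i.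
  have [->|->|->] := ord3P i => //=.
  rewrite nxE mkseed_Mp mkseed_Mm /= /v /c /F2 /F1; field.
  by rewrite ?t0 ?x50.
have m3 : mutations [:: o2; o0; o1] short_seed = mkseed [:: v; w; c] [:: F1; F2; t]
    [:: [:: 0; 0; 1]; [:: 0; 0; -1]; [:: -1; 3; 0];
        [:: -1; 0; 0]; [:: 1; -1; 0]; [:: 0; -3; 1]].
  have -> : mutations [:: o2; o0; o1] short_seed =
    mutate o1 (mutations [:: o2; o0] short_seed) by [].
  rewrite m2; apply: mutate_mkseed => // i; have [->|->|->] := ord3P i => //=.
  rewrite nxE mkseed_Mp mkseed_Mm /=; move: X20; rewrite /w /X2 /c /F2 /F1 => ?.
  by field; apply/andP.
have m4 : svar (mutations [:: o2; o0; o1; o2] short_seed) (inl o2) = x1.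
  have -> : mutations [:: o2; o0; o1; o2] short_seed =
    mutate o2 (mutations [:: o2; o0; o1] short_seed) by [].
  rewrite m3 -/(nx _ _) nxE mkseed_Mp mkseed_Mm /=.
  by move: nz1; rewrite /v /w /c => ?; field.
have Ax1 : A x1 by rewrite -m4; apply: ext_var.
have Ac : A c by have := @ext_var _ _ iota _ _ [set o2]%SET short_seed [:: o2] o2; rewrite [mutations _ _]m1.
have Av : A v by have := @ext_var _ _ iota _ _ [set o2]%SET short_seed [:: o2; o0] o0; rewrite m2.
have At : A t by have := @ext_frozen _ _ iota _ _ [set o2]%SET short_seed o2.
have Ati : A t^-1.
  have := @ext_frozen_inv _ _ iota _ _ [set o2]%SET short_seed o2.
  by apply; rewrite inE.
have Ax2 : A x2 by have := @ext_var _ _ iota _ _ [set o2]%SET short_seed [::] o2.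
have Ax5 : A x5 by have := @ext_var _ _ iota _ _ [set o2]%SET short_seed [::] o0.
have Ah : A h.
  have -> : h = (x1 * x2 - c) / t by rewrite /c; field.
  by samem cA.
apply: laurent5_min => //; have -> : x4 = (x1 * h - v) / t by rewrite /v; field.
by samem cA.
Qed.
End ShortRoot.

(** * The seed of the long root in coordinates *)

Section LongRoot.
Variables (K : numFieldType) (F : fieldType) (iota : {rmorphism K -> F}).
Variables (t a b c d h : F).
Hypothesis ind : ind6 iota t a b c d h.

Definition long_mx : seq (seq int) :=
  [:: [:: 0; -1; 1]; [:: 3; 0; -3]; [:: -1; 1; 0];
      [:: 1; 0; 0]; [:: -3; 1; 0]; [:: 0; -1; 2]].

(** With t, a, b, c, d, h the Pluecker coordinates p_01, p_02, p_03 / 2, p_04, p_14, p_06, these are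
    p_16, p_46 and p_56. *)
Definition long_p16 := (b * d - c ^+ 2) / t.
Definition long_Y1 := (c * long_p16 - h * d) / t.
Definition long_F1 := ((a * c - b ^+ 2) / t * long_p16
  - h * ((a * d - b * c) / t - h)) / t.
Local Notation Y1 := long_Y1.
Local Notation F1 := long_F1.
Local Notation p16 := long_p16.

Definition long_seed := mkseed [:: Y1; c; d] [:: F1; h; t] long_mx.

Let B := laurent5 iota t a b c d h.
Let cB : Ksubalg iota B. Proof. exact: laurent5_closed. Qed.

Let t0 : t != 0.
Proof. by have := indep_neq0 None (ind6_indep ind). Qed.
Let nzc i := indep_neq0 (Some i) (ind6_indep ind).
Let a0 : a != 0. Proof. exact: (nzc (@Ordinal 5 0 isT)). Qed.
Let b0 : b != 0. Proof. exact: (nzc (@Ordinal 5 1 isT)). Qed.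
Let c0 : c != 0. Proof. exact: (nzc (@Ordinal 5 2 isT)). Qed.
Let d0 : d != 0. Proof. exact: (nzc (@Ordinal 5 3 isT)). Qed.
Let h0 : h != 0. Proof. exact: (nzc (@Ordinal 5 4 isT)). Qed.

Let ind_b : ind6 iota t b c d h a.
Proof. by apply: ind6_rot. Qed.
Let ind_c : ind6 iota t c d h a b.
Proof. by do 2 apply: ind6_rot. Qed.
Let ind_d : ind6 iota t d h a b c.
Proof. by do 3 apply: ind6_rot. Qed.
Let ind_h : ind6 iota t h a b c d.
Proof. by do 4 apply: ind6_rot. Qed.

Let nz1 : b * d - c ^+ 2 != 0.
Proof.
apply: (ind6_neq0 ind_b) => D dD e0 e1 e2 e3 e4 e5.
by dernz dD.
Qed.
Let nz2 : a * c - b ^+ 2 != 0.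
Proof.
apply: (ind6_neq0 ind) => D dD e0 e1 e2 e3 e4 e5.
by dernz dD.
Qed.
Let nz3 : - (b ^+ 3 * d) - h * t * (a * d - t * h) != 0.
Proof.
apply: (ind6_neq0 ind) => D dD e0 e1 e2 e3 e4 e5.
by dernz dD; rewrite oppr_eq0 !mulf_neq0.
Qed.
Let nz4 : - ((a * c - b ^+ 2) * c ^+ 2) + h * t * (b * c + t * h) != 0.
Proof.
apply: (ind6_neq0 ind) => D dD e0 e1 e2 e3 e4 e5.
by dernz dD; rewrite oppr_eq0 mulf_neq0 ?expf_neq0.
Qed.
Let Y10 : Y1 != 0.
Proof.
rewrite /Y1 mulf_neq0 ?invr_eq0 // /p16.
have -> : c * ((b * d - c ^+ 2) / t) - h * d =
  (c * (b * d - c ^+ 2) - t * h * d) / t by field.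
rewrite mulf_neq0 ?invr_eq0 //.
apply: (ind6_neq0 ind_b) => D dD e0 e1 e2 e3 e4 e5.
by dernz dD; rewrite mulf_neq0.
Qed.
Let F1E : t ^+ 3 * F1 =
  (a * c - b ^+ 2) * (b * d - c ^+ 2) - h * t * (a * d - b * c - t * h).
Proof. by rewrite /F1 /p16; field. Qed.
(** F1 is affine in a with slope Y1 / t; where Y1 is inverted, a is recovered from this. *)
Let F1aE : t ^+ 2 * F1 = a * t * Y1 - b ^+ 2 * p16 + h * b * c + t * h ^+ 2.
Proof. by rewrite /F1 /Y1 /p16; field. Qed.
Let F10 : F1 != 0.
Proof.
suff : t ^+ 3 * F1 != 0 by rewrite mulf_eq0 negb_or => /andP[].
rewrite F1E.
have -> : (a * c - b ^+ 2) * (b * d - c ^+ 2) - h * t * (a * d - b * c - t * h)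
  = a * (Y1 * t ^+ 2) + (h * t * (b * c + t * h) - b ^+ 2 * (b * d - c ^+ 2)).
  by rewrite /Y1 /p16; field.
have -> : Y1 * t ^+ 2 = c * (b * d - c ^+ 2) - t * h * d.
  by rewrite /Y1 /p16; field.
apply: (ind6_neq0 ind) => D dD e0 e1 e2 e3 e4 e5.
dernz dD; move: Y10.
have -> : Y1 = (c * (b * d - c ^+ 2) - t * h * d) / t ^+ 2.
  by rewrite /Y1 /p16; field.
by apply: contraNneq => ->; rewrite mul0r.
Qed.

Let n1 : nx long_seed o0 =
  - t * h ^+ 2 - b * c * h + a * c ^+ 3 / t - b ^+ 2 * c ^+ 2 / t.
Proof.
rewrite nxE mkseed_Mp mkseed_Mm /=; move: Y10; rewrite /F1 /Y1 /p16 => hY.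
have hY' : (c * (b * d - c ^+ 2) - t * h * d) != 0.
  apply: contraNneq hY => e; apply/eqP.
  by transitivity ((c * (b * d - c ^+ 2) - t * h * d) / t ^+ 2);
    [field|rewrite e mul0r].
by apply: (mulIf hY); rewrite divfK //; field.
Qed.
Let n2 : nx long_seed o1 = p16.
Proof.
by rewrite nxE mkseed_Mp mkseed_Mm /= /Y1 /p16; field; rewrite ?t0 ?c0.
Qed.
Let n3 : nx long_seed o2 = b * c - t * h.
Proof.
by rewrite nxE mkseed_Mp mkseed_Mm /= /Y1 /p16; field; rewrite ?t0 ?d0.
Qed.

Let B_c : B = laurent5 iota t c d h a b.
Proof. by rewrite /B; do 2 rewrite laurent5_rot. Qed.
Let B_d : B = laurent5 iota t d h a b c.
Proof. by rewrite /B; do 3 rewrite laurent5_rot. Qed.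
Let B_h : B = laurent5 iota t h a b c d.
Proof. by rewrite /B; do 4 rewrite laurent5_rot. Qed.

Let Bgen : [/\ B t, B t^-1, B a, B b & [/\ B c, B d & B h]].
Proof. exact: laurent5_gen. Qed.
Ltac gens x y z u v := have [? ? ? ? [? ? ?]] := Bgen;
  have cL := laurent4_closed iota x y z u v;
  have [? ? ? ? [? ?]] := laurent4_gen iota x y z u v.
Let Bp16 : B p16.
Proof. by have [? ? ? ? [? ? ?]] := Bgen; rewrite /p16; samem cB. Qed.
Let BF1 : B F1.
Proof. by have [? ? ? ? [? ? ?]] := Bgen; rewrite /F1; samem cB. Qed.
Let BY1 : B Y1.
Proof. by have [? ? ? ? [? ? ?]] := Bgen; rewrite /Y1; samem cB. Qed.

Let c_c z : (exists z0 z', [/\ laurent4 iota t d h a b z0, z0 != 0, B z' &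
  z = z0 + c * z']) -> cop B c z.
Proof.
by move=> [z0 [z' [h1 h2]]]; rewrite B_c => h3 ->; apply: laurent5_cop.
Qed.
Let c_d z : (exists z0 z', [/\ laurent4 iota t h a b c z0, z0 != 0, B z' &
  z = z0 + d * z']) -> cop B d z.
Proof.
by move=> [z0 [z' [h1 h2]]]; rewrite B_d => h3 ->; apply: laurent5_cop.
Qed.
Let c_h z : (exists z0 z', [/\ laurent4 iota t a b c d z0, z0 != 0, B z' &
  z = z0 + h * z']) -> cop B h z.
Proof.
by move=> [z0 [z' [h1 h2]]]; rewrite B_h => h3 ->; apply: laurent5_cop.
Qed.

Let c2G : cop B c h.
Proof.
have [? ? ? ? [? ? ?]] := Bgen.
have [? ? ? ? [? ?]] := laurent4_gen iota t d h a b.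
by apply: c_c; exists h, 0; split; rewrite ?mulr0 ?addr0 //; samem cB.
Qed.
Let c23 : cop B c d.
Proof.
have [? ? ? ? [? ? ?]] := Bgen.
have [? ? ? ? [? ?]] := laurent4_gen iota t d h a b.
by apply: c_c; exists d, 0; split; rewrite ?mulr0 ?addr0 //; samem cB.
Qed.
Let c3G : cop B d h.
Proof.
have [? ? ? ? [? ? ?]] := Bgen.
have [? ? ? ? [? ?]] := laurent4_gen iota t h a b c.
by apply: c_d; exists h, 0; split; rewrite ?mulr0 ?addr0 //; samem cB.
Qed.
Let c21 : cop B c Y1.
Proof.
gens t d h a b.
apply: c_c; exists (- (h * d) / t), (p16 / t); split.
- by samem cL.
- by rewrite !mulf_neq0 ?invr_eq0 ?oppr_eq0 // mulf_neq0.
- by samem cB.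
- by rewrite /Y1; field.
Qed.
Let c31 : cop B d Y1.
Proof.
gens t h a b c.
apply: c_d; exists (- c ^+ 3 * t^-1 ^+ 2), (c * b * t^-1 ^+ 2 - h / t); split.
- by samem cL.
- by rewrite !mulf_neq0 ?expf_neq0 ?invr_eq0 ?oppr_eq0 ?expf_neq0.
- by samem cB.
- by rewrite /Y1 /p16; field.
Qed.
Let cG1 : cop B h Y1.
Proof.
gens t a b c d.
apply: c_h; exists (c * (b * d - c ^+ 2) * t^-1 ^+ 2), (- d / t); split.
- by samem cL.
- by rewrite !mulf_neq0 ?expf_neq0 ?invr_eq0.
- by samem cB.
- by rewrite /Y1 /p16; field.
Qed.
Let c2F : cop B c F1.
Proof.
gens t d h a b.
apply: c_c; exists ((- (b ^+ 3 * d) - h * t * (a * d - t * h)) * t^-1 ^+ 3),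
  ((a * b * d - a * c ^+ 2 + b ^+ 2 * c + h * t * b) * t^-1 ^+ 3); split.
- by samem cL.
- by rewrite !mulf_neq0 ?expf_neq0 ?invr_eq0.
- by samem cB.
- by rewrite /F1 /p16; field.
Qed.
Let c3F : cop B d F1.
Proof.
gens t h a b c.
apply: c_d; exists ((- ((a * c - b ^+ 2) * c ^+ 2) + h * t * (b * c + t * h)) * t^-1 ^+ 3),
  (((a * c - b ^+ 2) * b - h * t * a) * t^-1 ^+ 3); split.
- by samem cL.
- by rewrite !mulf_neq0 ?expf_neq0 ?invr_eq0.
- by samem cB.
- by rewrite /F1 /p16; field.
Qed.
Let cGF : cop B h F1.
Proof.
gens t a b c d.
apply: c_h; exists ((a * c - b ^+ 2) * (b * d - c ^+ 2) * t^-1 ^+ 3),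
  (- t * (a * d - b * c - t * h) * t^-1 ^+ 3); split.
- by samem cL.
- by rewrite !mulf_neq0 ?expf_neq0 ?invr_eq0.
- by samem cB.
- by rewrite /F1 /p16; field.
Qed.

(** Y1 is a factor of its exchange binomial, which is d h^3 modulo F1. *)
Let cF1 : cop B F1 Y1.
Proof.
have [? ? ? ? [? ? ?]] := Bgen.
apply: (cop_factor (c := nx long_seed o0) cB); first by rewrite n1; samem cB.
have -> : Y1 * nx long_seed o0 = d * h ^+ 3 + F1 * c ^+ 3.
  by rewrite nxE mkseed_Mp mkseed_Mm /=; field; exact: Y10.
apply: (cop_addl cB) => //; first by samem cB.
apply: (copM cB) => //; first by apply: cop_sym.
by apply: (copX cB) => //; apply: cop_sym.
Qed.

(** Y1 replaces b, and then F1 replaces a; the other coordinates already belong to the extended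
    cluster. *)
Let ind_Y1 : ind6 iota t Y1 c d h a.
Proof.
apply: (ind6_replace ind_b) => D dD e0 e1 e2 e3 e4 e5.
have : D (t ^+ 2 * Y1) = D (c * (b * d - c ^+ 2) - t * h * d).
  by congr (D _); rewrite /Y1 /p16; field.
move: Y1 => y; dernz dD => e; apply: contra_eq_neq e => ->.
by rewrite mulr0 eq_sym mulf_neq0.
Qed.

Let ind_F1 : ind6 iota t F1 Y1 c d h.
Proof.
apply: (ind6_replace (a := a)); first by do 4 apply: ind6_rot.
move=> D dD e0 e1 e2 e3 e4 e5.
(* Since b c d = t^2 Y1 + t h d + c^3, the coordinate b can be eliminated; what results is affine in
   a, with slope a monomial multiple of Y1. *)
have : D (t ^+ 2 * d ^+ 2 * c * F1) = D (a * t * d ^+ 2 * c * Y1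
   - (t ^+ 2 * Y1 + t * h * d + c ^+ 3) ^+ 2 / c ^+ 2 * (t * Y1 + h * d)
   + (h * c * d) * (t ^+ 2 * Y1 + t * h * d + c ^+ 3) + t * h ^+ 2 * d ^+ 2 * c).
  by congr (D _); rewrite /Y1 /F1 /p16; field; rewrite ?t0 ?c0.
have Dci : D (c^-1 ^+ 2) = 0 by rewrite (derX dD) (derV dD) // e3; ring.
rewrite -exprVn.
move: F1 (Y1) Y10 e2 (c^-1 ^+ 2) Dci => f x xn0 e2 ci Dci.
dernz dD => e; apply: contra_eq_neq e => ->.
by rewrite mulr0 eq_sym !mulf_neq0 ?expf_neq0.
Qed.

Let xn0 r : svar long_seed r != 0.
Proof. by case: r => i; have [->|->|->] := ord3P i. Qed.

Let Svar r q : Calg iota long_seed r (svar long_seed q).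
Proof. exact: Calg_var. Qed.
Let Sinv r q : q != r -> Calg iota long_seed r (svar long_seed q)^-1.
Proof. exact: Calg_inv. Qed.

Lemma long_invariant : seed_invariant iota B [set j | j = o2] long_seed.
Proof.
have [? ? ? ? [? ? ?]] := Bgen; split.
- exists (fun i : 'I_3 => nth 0 [:: 3; 1; 3] i) => [i|i j].
    by have [->|->|->] := ord3P i.
  by have [->|->|->] := ord3P i; have [->|->|->] := ord3P j.
- move=> w; exists (fun r : 'I_3 + 'I_3 => match r with
    | inl i => nth 0 [:: w o2; 0; 0] i
    | inr j => nth 0 [:: w o0 + 3 * (w o1 + w o2); w o1 + w o2; 0] j end) => j.
  by rewrite big6; have [->|->|->] := ord3P j => /=; ring.
- apply: (ind6_seed _ erefl erefl) => e0 e1 e2 e3 e4 e5.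
  by have [D dD [? ? ? ? [? ?]]] := ind_F1 e5 e3 e0 e1 e2 e4; exists D.
- exact: xn0.
- by case=> i; have [->|->|->] := ord3P i.
- by move=> i; have [->|->|->] := ord3P i; rewrite ?n1 ?n2 ?n3; samem cB.
- by move=> j ->.
- by apply: (cop_list3 cB) => //; apply: cop_sym.
move=> r nL; pose S := Calg iota long_seed r.
have cS : Ksubalg iota S by apply: Calg_closed.
have SY1 : S Y1 := @Svar r (inl o0).
have Sc : S c := @Svar r (inl o1).
have Sd : S d := @Svar r (inl o2).
have SF1 : S F1 := @Svar r (inr o0).
have Sh : S h := @Svar r (inr o1).
have St : S t := @Svar r (inr o2).
have ti : S t^-1.
  apply: (@Calg_inv _ _ iota _ _ long_seed r (inr o2)).
  by apply/eqP => e; apply: (nL o2).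
have i1 : r != inl o0 -> S Y1^-1 by rewrite eq_sym; exact: Sinv.
have i2 : r != inl o1 -> S c^-1 by rewrite eq_sym; exact: Sinv.
have i3 : r != inl o2 -> S d^-1 by rewrite eq_sym; exact: Sinv.
have Sp16 : S p16.
  have [r1|r1] := eqVneq r (inl o1).
    by rewrite -n2 /S r1; apply: Calg_nx.
  have -> : p16 = (Y1 * t + d * h) / c by rewrite /Y1; field; rewrite ?t0 ?c0.
  by have ? := i2 r1; samem cS.
have Sb : S b.
  have [r2|r2] := eqVneq r (inl o2).
    have -> : b = ((b * c - t * h) + t * h) / c by field.
    have ? : S (b * c - t * h) by rewrite -n3 /S r2; apply: Calg_nx.
    have ? : S c^-1 by apply: i2; rewrite r2.
    by apply: (saM cS) => //; apply: (saD cS) => //; samem cS.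
  have -> : b = (t * p16 + c ^+ 2) / d by rewrite /p16; field; rewrite ?t0 ?d0.
  by have ? := i3 r2; samem cS.
have Sa : S a.
  have [r0|r0] := eqVneq r (inl o0).
    have -> : a = t * (nx long_seed o0 + t * h ^+ 2 + b * c * h
      + b ^+ 2 * c ^+ 2 / t) * c^-1 ^+ 3 by rewrite n1; field; rewrite ?t0 ?c0.
    have ? : S (nx long_seed o0) by rewrite /S r0; apply: Calg_nx.
    have ? : S c^-1 by apply: i2; rewrite r0.
    by samem cS.
  have -> : a = (t ^+ 2 * F1 + b ^+ 2 * p16 - h * b * c - t * h ^+ 2) / (t * Y1).
    by rewrite F1aE; move: Y10 => ?; field; apply/andP.
  have ? := i1 r0.
  have ? : S (t * Y1)^-1 by rewrite invfM; samem cS.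
  by samem cS.
exact: laurent5_min.
Qed.

Lemma long_upper : B `<=` cluster_algebra_ext iota [set o2]%SET long_seed.
Proof.
pose A := cluster_algebra_ext iota [set o2]%SET long_seed.
have cA : Ksubalg iota A by apply: cluster_ext_closed.
(* Mutation at 3, 1, 2, 3 produces u, w, b and a in turn; the other generators of B are in the
   initial seed. *)
pose u := b * c - t * h.
pose w := - a * h + (a * b * c - b ^+ 3) / t.
have u0 : u != 0.
  apply: (ind6_neq0 ind_b) => D dD e0 e1 e2 e3 e4 e5.
  by rewrite /u; dernz dD.
have m1 : mutate o2 long_seed = mkseed [:: Y1; c; u] [:: F1; h; t]
    [:: [:: 0; 0; -1]; [:: 0; 0; 3]; [:: 1; -1; 0];
        [:: 1; 0; 0]; [:: -3; 1; 0]; [:: 0; 1; -2]].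
  by apply: mutate_mkseed => // i; have [->|->|->] := ord3P i => //=; rewrite n3.
have m2 : mutations [:: o2; o0] long_seed = mkseed [:: w; c; u] [:: F1; h; t]
    [:: [:: 0; 0; 1]; [:: 0; 0; 3]; [:: -1; -1; 0];
        [:: -1; 0; 0]; [:: 3; 1; -3]; [:: 0; 1; -2]].
  rewrite /mutations /= m1; apply: mutate_mkseed => // i.
  have [->|->|->] := ord3P i => //=.
  rewrite nxE mkseed_Mp mkseed_Mm /=; apply: (mulIf Y10); rewrite divfK //.
  by rewrite /w /u /F1 /Y1 /p16; field.
have m3 : mutations [:: o2; o0; o1] long_seed = mkseed [:: w; b; u] [:: F1; h; t]
    [:: [:: 0; 0; 1]; [:: 0; 0; -3]; [:: -1; 1; 0];
        [:: -1; 0; 0]; [:: 3; -1; 0]; [:: 0; -1; 1]].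
  have -> : mutations [:: o2; o0; o1] long_seed =
    mutate o1 (mutations [:: o2; o0] long_seed) by [].
  rewrite m2; apply: mutate_mkseed => // i; have [->|->|->] := ord3P i => //=.
  by rewrite nxE mkseed_Mp mkseed_Mm /= /u; field.
have m4 : svar (mutations [:: o2; o0; o1; o2] long_seed) (inl o2) = a.
  have -> : mutations [:: o2; o0; o1; o2] long_seed =
    mutate o2 (mutations [:: o2; o0; o1] long_seed) by [].
  rewrite m3 -/(nx _ _) nxE mkseed_Mp mkseed_Mm /=.
  by move: u0; rewrite /w /u => ?; field; apply/andP.
have Aa : A a by rewrite -m4; apply: ext_var.
have Ab : A b.
  by have := @ext_var _ _ iota _ _ [set o2]%SET long_seed [:: o2; o0; o1] o1; rewrite m3.
have At : A t by have := @ext_frozen _ _ iota _ _ [set o2]%SET long_seed o2.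
have Ati : A t^-1.
  have := @ext_frozen_inv _ _ iota _ _ [set o2]%SET long_seed o2.
  by apply; rewrite inE.
have Ac : A c by have := @ext_var _ _ iota _ _ [set o2]%SET long_seed [::] o1.
have Ad : A d by have := @ext_var _ _ iota _ _ [set o2]%SET long_seed [::] o2.
have Ah : A h by have := @ext_frozen _ _ iota _ _ [set o2]%SET long_seed o1.
exact: laurent5_min.
Qed.
End LongRoot.

(** * Regular functions on G *)

Section Sparse.
Variable K : numFieldType.

(* Matrices given by the list of their nonzero entries, so that products can be
   computed symbolically. *)
Definition sp (s : seq (nat * nat * K)) : 'M[K]_7 :=
  \sum_(x <- s) x.2 *: Emx K x.1.1 x.1.2.

Definition spok (s : seq (nat * nat * K)) :=
  all (fun x => (x.1.1 < 7) && (x.1.2 < 7))%N s.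

Definition spcoef (s : seq (nat * nat * K)) (i j : nat) : K :=
  foldr (fun x a => if (x.1.1 == i) && (x.1.2 == j) then x.2 + a else a) 0 s.

Definition spmul (s t : seq (nat * nat * K)) : seq (nat * nat * K) :=
  flatten [seq [seq (a.1.1, b.1.2, a.2 * b.2) | b <- t & a.1.2 == b.1.1]
          | a <- s].

Lemma spM s t : spok s -> spok t -> sp s * sp t = sp (spmul s t).
Proof.
elim: s => [|[[i j] a] s IH] /=; first by rewrite /sp big_nil mul0r.
move=> /andP[/andP[hi hj] hs] ht.
have {IH hs} := IH hs ht; rewrite /sp /spmul /= big_cons big_cat /= mulrDl => ->.
congr (_ + _); rewrite big_map big_filter mulr_sumr [RHS]big_mkcond /=.
elim: t ht => [|[[k l] b] t IHt] /=; first by rewrite !big_nil.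
move=> /andP[/andP[hk hl] ht]; rewrite !big_cons IHt //=; congr (_ + _).
rewrite -scalerAl -scalerAr EE // scalerA.
by case: ifP => //; rewrite scaler0.
Qed.

Lemma spE s (i j : 'I_7) : spok s -> sp s i j = spcoef s i j.
Proof.
elim: s => [|[[k l] a] s IH] /=; first by rewrite /sp big_nil mxE.
move=> /andP[/andP[hk hl] hs].
rewrite /sp big_cons mxE -/(sp s) IH // !mxE /=.
rewrite -!(inj_eq val_inj) /= !inordK // (eq_sym k) (eq_sym l).
by case: ifP => _; rewrite ?mulr1 ?mulr0 ?add0r.
Qed.

Lemma sp_eq s t : spok s -> spok t -> (forall i, (i < 7)%N -> forall j, (j < 7)%N ->
  spcoef s i j = spcoef t i j) -> sp s = sp t.
Proof. by move=> hs ht h; apply/matrixP => i j; rewrite !spE // h. Qed.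

Lemma lc_sp s : lc K s = sp [seq (x.1, x.2%:~R) | x <- s].
Proof. by rewrite /sp big_map. Qed.

Lemma spZ c s : c *: sp s = sp [seq (x.1, c * x.2) | x <- s].
Proof.
rewrite /sp big_map scaler_sumr; apply: eq_bigr => x _ /=.
by rewrite scalerA.
Qed.

Lemma spD s t : sp s + sp t = sp (s ++ t).
Proof. by rewrite /sp big_cat. Qed.

Lemma sp1 : 1 = sp [seq (i, i, 1) | i <- iota 0 7].
Proof.
apply/matrixP => i j; rewrite spE // mxE.
by case: i => [[|[|[|[|[|[|[|//]]]]]]] hi]; case: j => [[|[|[|[|[|[|[|//]]]]]]] hj] //=;
  rewrite mulr1n addr0.
Qed.
End Sparse.

Ltac entries := apply: sp_eq; [by [] | by [] |
  case=> [|[|[|[|[|[|[|//]]]]]]] _; case=> [|[|[|[|[|[|[|//]]]]]]] _; rewrite /=].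

(** * Commutation rules for one-parameter subgroups and torus *)

Section Group.
Variable K : numFieldType.
Local Notation G := (G2 K).
Local Notation sp := (@sp K).

Definition at_ (i j : nat) (a : K) := (i, j, a).
Definition idl : seq (nat * nat * K) := [seq at_ i i 1 | i <- iota 0 7].

Definition xl (i : 'I_2) (t : K) := idl ++
  if i == i1 then [:: at_ 0 1 t; at_ 2 3 (2 * t); at_ 3 4 t; at_ 5 6 t; at_ 2 4 (t ^+ 2)]
  else [:: at_ 1 2 t; at_ 4 5 t].

Definition yl (i : 'I_2) (t : K) := idl ++
  if i == i1 then [:: at_ 1 0 t; at_ 3 2 t; at_ 4 3 (2 * t); at_ 6 5 t; at_ 4 2 (t ^+ 2)]
  else [:: at_ 2 1 t; at_ 5 4 t].

Lemma xE i t : root_mx true i t = sp (xl i t).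
Proof.
rewrite root_mxE cheE [lc _ _ ^+ 2]expr2 lc_sp spM; last 2 first.
- by have [->|->] := ord2P i.
- by have [->|->] := ord2P i.
rewrite sp1 !spZ !spD.
by have [->|->] := ord2P i; entries; rewrite ?mulr1n; field.
Qed.

Lemma yE i t : root_mx false i t = sp (yl i t).
Proof.
rewrite root_mxE chfE [lc _ _ ^+ 2]expr2 lc_sp spM; last 2 first.
- by have [->|->] := ord2P i.
- by have [->|->] := ord2P i.
rewrite sp1 !spZ !spD.
by have [->|->] := ord2P i; entries; rewrite ?mulr1n; field.
Qed.

Definition dl (l : seq K) := [seq at_ i i (nth 0 l i) | i <- iota 0 7].

(* The torus element of coordinates (c1, c2). *)
Definition tl (c1 c2 : K) := dl
  [:: c1; c2 / c1; c1 ^+ 2 / c2; 1; c2 / c1 ^+ 2; c1 / c2; c1^-1].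

Definition nl (i : 'I_2) (c : K) := if i == i1 then
   [:: at_ 0 1 c; at_ 1 0 (- c^-1); at_ 2 4 (c ^+ 2); at_ 3 3 (-1);
       at_ 4 2 ((c ^+ 2)^-1); at_ 5 6 c; at_ 6 5 (- c^-1)]
  else
   [:: at_ 0 0 1; at_ 1 2 c; at_ 2 1 (- c^-1); at_ 3 3 1; at_ 4 5 c;
       at_ 5 4 (- c^-1); at_ 6 6 1].

Lemma ok_x i t : spok (xl i t). Proof. by have [->|->] := ord2P i. Qed.
Lemma ok_y i t : spok (yl i t). Proof. by have [->|->] := ord2P i. Qed.
Lemma xyxE i c : c != 0 -> root_mx true i c * root_mx false i (- c^-1) *
  root_mx true i c = sp (nl i c).
Proof.
move=> c0; rewrite !xE yE.
by have [->|->] := ord2P i; rewrite !spM //; entries; field.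
Qed.

Lemma sbarE i : \val (sbar K i) = sp (nl i (-1)).
Proof.
rewrite -[LHS]/(root_mx true i (-1) * root_mx false i 1 * root_mx true i (-1)).
have n0 : -1 != 0 :> K by rewrite oppr_eq0 oner_eq0.
by have := xyxE i n0; rewrite invrN1 opprK.
Qed.

Definition cl (i : 'I_2) c := if i == i1 then tl c 1 else tl 1 c.

Lemma coroot_diag i c : c != 0 -> \val (coroot i c) = sp (cl i c).
Proof.
move=> c0; rewrite -[LHS]/(root_mx true i c * root_mx false i (- c^-1) *
  root_mx true i c * \val (sbar K i)) sbarE xyxE //.
by have [->|->] := ord2P i; rewrite !spM //; entries; field.
Qed.

Lemma torus_diag (a : 'I_2 -> K) : (forall i, a i != 0) ->
  \val (torus a) = sp (tl (a i1) (a i2)).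
Proof.
move=> a0; rewrite -[LHS]/(\val (coroot i1 (a i1)) * \val (coroot i2 (a i2))).
have := a0 i1; have := a0 i2; rewrite !coroot_diag // spM // => ? ?.
by entries; field; rewrite ?a0.
Qed.

(** The Gauss decomposition in the image of SL_2. *)
Lemma yxE i (s t : K) : 1 + s * t != 0 -> root_mx true i s * root_mx false i t =
  root_mx false i (t / (1 + s * t)) * \val (coroot i (1 + s * t)) *
  root_mx true i (s / (1 + s * t)).
Proof.
move=> u0; rewrite (coroot_diag i u0) !xE !yE.
by have [->|->] := ord2P i; rewrite !spM //; entries; field.
Qed.

Lemma xy_comm i j (s t : K) : i != j ->
  root_mx true j s * root_mx false i t = root_mx false i t * root_mx true j s.
Proof.
move=> ij; have [/(_ j i) + _ _ _ _] := chevalley_serre K.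
rewrite eq_sym (negPf ij) /brk => /eqP; rewrite subr_eq0 => /eqP ef.
have cZ (X Y : 'M[K]_7) c : GRing.comm X Y -> GRing.comm X (c *: Y).
  by move=> XY; rewrite /GRing.comm -scalerAr XY scalerAl.
have cR b k u (X : 'M[K]_7) : GRing.comm X (if b then che K k else chf K k) ->
    GRing.comm X (root_mx b k u).
  move=> h; rewrite root_mxE; apply: commrD; last by apply: cZ; apply: commrX.
  by apply: commrD; [exact: commr1|exact: cZ].
by apply: (cR false); apply: commr_sym; apply: (cR true); apply: commr_sym.
Qed.

(* Inverse of the simple root alpha_i at a torus element. *)
Definition iroot (i : 'I_2) (a : 'I_2 -> K) : K :=
  if i == i1 then a i2 / a i1 ^+ 2 else a i1 ^+ 3 / a i2 ^+ 2.

Lemma x_torus i (s : K) a : (forall i, a i != 0) -> root_mx true i s * \val (torus a) =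
  \val (torus a) * root_mx true i (iroot i a * s).
Proof.
move=> a0; have := a0 i1; have := a0 i2; rewrite torus_diag // !xE /iroot => ? ?.
by have [->|->] := ord2P i; rewrite !spM //; entries; field; rewrite ?a0.
Qed.

Lemma torus_y i (s : K) a : (forall i, a i != 0) -> \val (torus a) * root_mx false i s =
  root_mx false i (iroot i a * s) * \val (torus a).
Proof.
move=> a0; have := a0 i1; have := a0 i2; rewrite torus_diag // !yE /iroot => ? ?.
by have [->|->] := ord2P i; rewrite !spM //; entries; field; rewrite ?a0.
Qed.

Lemma torusM (a b : 'I_2 -> K) : (forall i, a i != 0) -> (forall i, b i != 0) ->
  (torus a * torus b)%g = torus (fun i => a i * b i).
Proof.
move=> a0 b0; apply: val_inj; rewrite -[LHS]/(\val (torus a) * \val (torus b)).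
have := a0 i1; have := a0 i2; have := b0 i1; have := b0 i2; rewrite !torus_diag // => [? ? ? ?|i].
  by rewrite spM //; entries; field; rewrite ?a0 ?b0.
by rewrite mulf_neq0.
Qed.

Lemma coroot_torus i (c : K) : c != 0 ->
  coroot i c = torus (fun j => if j == i then c else 1).
Proof.
move=> c0; apply: val_inj; rewrite coroot_diag // torus_diag; last first.
  by move=> j; case: ifP => _ //; exact: oner_neq0.
by have [->|->] := ord2P i.
Qed.

End Group.

(** * Density of the big cell *)

Section Density.
Variable K : numFieldType.
Local Notation G := (G2 K).

Definition xword (w : seq ('I_2 * K)) : G := (\big[*%g/1]_(p <- w) xG p.1 p.2)%g.

Lemma xword_nil : xword [::] = 1%g. Proof. by rewrite /xword big_nil. Qed.
Lemma xword_rcons w p : xword (rcons w p) = (xword w * xG p.1 p.2)%g.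
Proof. by rewrite /xword -cats1 big_cat big_seq1. Qed.
Lemma xword_cat w v : xword (w ++ v) = (xword w * xword v)%g.
Proof. by rewrite /xword big_cat. Qed.

Lemma yG0 i : yG i 0 = 1%g :> G.
Proof.
by apply: val_inj; rewrite /= root_mxE scale0r expr0n mul0r scale0r !addr0.
Qed.

Lemma xGV i (t : K) : ((xG i t)^-1 = xG i (- t))%g.
Proof.
apply: (mulgI (xG i t)); rewrite mulgV; apply: val_inj.
by rewrite -[RHS]/(root_mx true i t * root_mx true i (- t)) root_mxNr.
Qed.
Lemma Nplus_xword u : Nplus u -> exists w, u = xword w.
Proof.
move=> /(_ [set u | exists w, u = xword w]); apply; split; last first.
  by move=> _ [i [t ->]]; exists [:: (i, t)]; rewrite /xword big_seq1.
split.
- by exists [::]; rewrite xword_nil.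
- by move=> _ _ [w ->] [v ->]; exists (w ++ v); rewrite xword_cat.
- move=> _ [w ->]; exists [seq (p.1, - p.2) | p <- rev w].
  elim/last_ind: w => [|w p IH]; first by rewrite /= !xword_nil invg1.
  by rewrite xword_rcons invgM rev_rcons IH /= /xword big_cons xGV.
Qed.

Lemma subgroup_smallest (S : set G) : subgroup_closed (smallest (@subgroup_closed K) S).
Proof.
split=> [A [[]] //|g h hg hh A hA|g hg A hA].
  by have [[_ AM _] _] := hA; apply: AM; [exact: hg|exact: hh].
by have [[_ _ AV] _] := hA; apply: AV; exact: hg.
Qed.

Lemma xword_Nplus w : Nplus (xword w).
Proof.
have [N1 NM _] := subgroup_smallest [set g | exists i t, g = xG i t].
elim/last_ind: w => [|w [i t] IH]; first by rewrite xword_nil.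
by rewrite xword_rcons; apply: NM => // A [_]; apply; exists i, t.
Qed.

Lemma Nminus_closed : subgroup_closed (@Nminus K).
Proof. exact: subgroup_smallest. Qed.

Lemma yG_Nminus i (t : K) : Nminus (yG i t).
Proof. by move=> A [_]; apply; exists i, t. Qed.

Lemma mulg_swap (w x y y' a w' : G) : (x * y = y * x)%g ->
  (w * y = y' * a * w')%g -> (w * x * y = y' * a * (w' * x))%g.
Proof. by move=> c e; rewrite -mulgA c mulgA e mulgA. Qed.

Lemma mulg_chain (w x y y1 c x1 y' a w' w'' : G) : (x * y = y1 * c * x1)%g ->
  (w * y1 = y' * a * w')%g -> (w' * c = c * w'')%g ->
  (w * x * y = y' * (a * c) * (w'' * x1))%g.
Proof.
move=> h1 h2 h3; rewrite -mulgA h1 !mulgA h2 -[(_ * w' * c)%g]mulgA h3.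
by rewrite !mulgA.
Qed.

Lemma mulg_cell (n a w y y' c w' y'' : G) : (w * y = y' * c * w')%g ->
  (a * y' = y'' * a)%g -> (n * a * w * y = n * y'' * (a * c) * w')%g.
Proof.
move=> h1 h2; rewrite -mulgA h1 !mulgA -[(n * a * y')%g]mulgA h2.
by rewrite !mulgA.
Qed.

Lemma xword_torus w (a : 'I_2 -> K) : (forall i, a i != 0) ->
  exists w', (xword w * torus a = torus a * xword w')%g.
Proof.
move=> a0; elim/last_ind: w => [|w [i t] [w' IH]].
  by exists [::]; rewrite xword_nil mulg1 mul1g.
exists (rcons w' (i, iroot i a * t)); rewrite !xword_rcons /=.
have e : (xG i t * torus a = torus a * xG i (iroot i a * t))%g.
  by apply: val_inj; rewrite -[LHS]/(root_mx true i t * _) x_torus.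
by rewrite -mulgA e mulgA IH mulgA.
Qed.

(** The factor y_i(t) moves to the left: it commutes with x_j(s) for j != i, and passes x_i(s) by
    the Gauss decomposition, at the price of finitely many values of t. *)
Lemma xword_y w i : exists bad : seq K, forall t, t \notin bad ->
  exists t' (a : 'I_2 -> K) w', (forall j, a j != 0) /\
    (xword w * yG i t = yG i t' * torus a * xword w')%g.
Proof.
elim/last_ind: w => [|w [j s] [bad IH]].
  exists [::] => t _; exists t, (fun=> 1), [::]; split; first by move=> j; apply: oner_neq0.
  have -> : torus (fun=> 1) = 1%g :> G.
    apply: (mulgI (torus (fun=> 1))); rewrite mulg1 torusM.
    - by congr torus; apply/funext => k; rewrite mulr1.
    - by move=> k; apply: oner_neq0.
    - by move=> k; apply: oner_neq0.
  by rewrite xword_nil mul1g !mulg1.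
have [ij|ij] := eqVneq i j; last first.
  exists bad => t /IH[t' [a [w' [a0 e]]]].
  exists t', a, (rcons w' (j, s)); split=> //; rewrite !xword_rcons /=.
  have c : (xG j s * yG i t = yG i t * xG j s)%g.
    by apply: val_inj; rewrite -[LHS]/(root_mx true j s * root_mx false i t) xy_comm.
  exact: mulg_swap c e.
(* The parameter t must avoid -1 / s, and t / (1 + s t) must avoid the exceptional values b of the
   shorter word, that is t = b / (1 - s b). When a denominator vanishes, the list just receives the
   extra value 0. *)
rewrite -{}ij {j}; exists (- s^-1 :: [seq b / (1 - s * b) | b <- bad]) => t.
rewrite inE negb_or => /andP[ts tb].
have u0 : 1 + s * t != 0.
  apply: contra ts => /eqP e; have s0 : s != 0.
    by apply: contra_eq_neq e => ->; rewrite mul0r addr0 oner_eq0.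
  apply/eqP; apply: (mulfI s0); rewrite mulrN divff //.
  by apply/eqP; rewrite -addr_eq0 addrC e.
have [|t' [a [w' [a0 e]]]] := IH (t / (1 + s * t)).
  apply: contra tb => tb; apply/mapP; exists (t / (1 + s * t)) => //.
  field; rewrite u0 /=; have -> : 1 + s * t - s * t = 1 by ring.
  by rewrite oner_neq0.
pose c : 'I_2 -> K := fun j => if j == i then 1 + s * t else 1.
have c0 j : c j != 0 by rewrite /c; case: ifP => _ //; apply: oner_neq0.
have [w'' ew] := xword_torus w' c0.
exists t', (fun j => a j * c j), (rcons w'' (i, s / (1 + s * t))); split.
  by move=> j; rewrite mulf_neq0.
rewrite !xword_rcons /=.
have yx : (xG i s * yG i t = yG i (t / (1 + s * t)) * torus c * xG i (s / (1 + s * t)))%g.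
  rewrite -coroot_torus //; apply: val_inj.
  rewrite -[LHS]/(root_mx true i s * root_mx false i t) yxE //.
by rewrite -torusM //; exact: mulg_chain yx e ew.
Qed.

Lemma poly_zeros (p : {poly K}) (bad : seq K) :
  (forall t, t \notin bad -> p.[t] = 0) -> p = 0.
Proof.
move=> h; pose q := \prod_(b <- bad) ('X - b%:P).
have q0 : q != 0 by rewrite monic_neq0 // monic_prod_XsubC.
apply/eqP; have : p * q == 0; last by rewrite mulf_eq0 (negPf q0) orbF.
apply: contraT => pq0.
pose r := [seq (k%:R : K) | k <- iota 0 (size (p * q))].
have : (size r < size (p * q)%R)%N.
  apply: max_poly_roots => //.
    apply/allP => _ /mapP[k _ ->]; rewrite /root hornerM.
    have [kb|kb] := boolP (k%:R \in bad); last by rewrite h // mul0r.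
    have /rootP -> : root q k%:R by rewrite root_prod_XsubC.
    by rewrite mulr0.
  rewrite map_inj_uniq ?iota_uniq // => a b /eqP.
  by rewrite eqr_nat => /eqP.
by rewrite size_map size_iota ltnn.
Qed.

Definition big_cell : set G := [set g | exists n a u,
  [/\ Nminus n, forall i, a i != 0, Nplus u & g = (n * torus a * u)%g]].

(** Vanishing on the big cell is inherited by translates under generators: the cell is stable under
    x_i(s), and for y_i(t) the value at a point is a polynomial in t that vanishes outside a finite
    set. The generators then lead from the point 1 of the cell to all of G. *)
Lemma big_cell_dense (f : CG K) : (forall g, big_cell g -> f g = 0) -> forall g, f g = 0.
Proof.
move=> hf; have [_ NM _] := Nminus_closed.
have step (f' : CG K) b i s : (forall g, big_cell g -> f' g = 0) ->
    forall g, big_cell g -> f' (g * (if b then xG i s else yG i s))%g = 0.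
  move=> hf' _ [n [a [u [hn a0 /Nplus_xword[w ->] ->]]]]; case: b.
    apply: hf'; exists n, a, (xword (rcons w (i, s))); split=> //.
      exact: xword_Nplus.
    by rewrite xword_rcons (mulgA (n * torus a)%g).
  have [f1 _ /(_ (n * torus a * xword w)%g)[p [hp _]]] := fdag_poly i (valP f').
  have [bad hbad] := xword_y w i.
  suff p0 : p = 0 by rewrite hp p0 horner0.
  apply: (poly_zeros (bad := bad)) => t /hbad[t' [c [w' [c0 e]]]].
  rewrite -hp; apply: hf'.
  exists (n * yG i (iroot i a * t'))%g, (fun j => a j * c j), (xword w'); split.
  - by apply: NM => //; apply: yG_Nminus.
  - by move=> j; rewrite mulf_neq0.
  - exact: xword_Nplus.
  rewrite -torusM //; apply: mulg_cell e _; apply: val_inj.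
  by rewrite -[LHS]/(\val (torus a) * root_mx false i t') torus_y.
have key (w : seq (bool * 'I_2 * K)) (h : G) :
    \val h = \prod_(l <- w) root_mx l.1.1 l.1.2 l.2 ->
    forall g, big_cell g -> f (g * h)%g = 0.
  elim: w h => [|[[b i] s] w IH] h.
    by rewrite big_nil => h1 g hg; have -> : h = 1%g; [exact: val_inj|rewrite mulg1; apply: hf].
  rewrite big_cons /= => hE g hg.
  pose x : G := if b then xG i s else yG i s.
  have xh : \val (x^-1 * h)%g = \prod_(l <- w) root_mx l.1.1 l.1.2 l.2.
    have xE : \val x = root_mx b i s by rewrite /x; case: b {hE x}.
    rewrite -[LHS]/((\val x)^-1 * G2val h) hE xE mulrA mulVr ?mul1r //.
    by rewrite -xE; case: (G2_unitV (valP x)).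
  have := step (rtrans (x^-1 * h)%g f) b i s _ g hg; rewrite /= -/x -mulgA mulVKg.
  by apply; exact: IH.
move=> g; have /asboolP[w hw] := valP g.
rewrite -[g]mul1g; apply: (key w) => //.
exists 1%g, (fun=> 1), 1%g; split.
- by have [] := Nminus_closed.
- by move=> i; apply: oner_neq0.
- by rewrite -xword_nil; apply: xword_Nplus.
rewrite mulg1 mul1g; apply: (mulgI (torus (fun=> 1))); rewrite mulg1 torusM.
- by congr torus; apply/funext => k; rewrite mulr1.
- by move=> k; apply: oner_neq0.
- by move=> k; apply: oner_neq0.
Qed.
End Density.

(** * Minors and lowering operators in terms of matrix rows *)

Section Functions.
Variable K : numFieldType.
Local Notation G := (G2 K).
Local Notation CG := (CG K).

Lemma CG_eq (f h : CG) : (forall g, f g = h g) -> f = h.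
Proof. by move=> fh; apply: val_inj; apply/funext. Qed.

Lemma CGD (f h : CG) g : (f + h) g = f g + h g. Proof. by []. Qed.
Lemma CGM (f h : CG) g : (f * h) g = f g * h g. Proof. by []. Qed.
Lemma CGN (f : CG) g : (- f) g = - f g. Proof. by []. Qed.
Lemma CGC (c : K) g : cstG c g = c. Proof. by []. Qed.
Lemma CG0 g : (0 : CG) g = 0. Proof. by []. Qed.
Lemma CGX (f : CG) n g : (f ^+ n) g = f g ^+ n.
Proof. by elim: n => [//|n IH]; rewrite !exprS CGM IH. Qed.
Lemma CG_nat n g : (n%:R : CG) g = n%:R.
Proof. by elim: n => [//|n IH]; rewrite -!natr1 CGD IH. Qed.

Lemma minor_unique i (f : CG) : minor_spec i f -> minor K i = f.
Proof.
move=> hf; apply/CG_eq => g; apply/eqP; rewrite -subr_eq0; apply/eqP.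
apply: (big_cell_dense (f := minor K i - f)) => {}g [n [a [u [hn a0 hu ->]]]].
by rewrite CGD CGN minorP // hf // subrr.
Qed.

Lemma big_cell_rows (n : G) a (u : G) : Nminus n -> (forall j, a j != 0) -> Nplus u ->
  exists c d, [/\ entry K 0 0 (n * torus a * u)%g = a i1,
      entry K 0 1 (n * torus a * u)%g = c * a i1,
      entry K 1 0 (n * torus a * u)%g = d * a i1 &
      entry K 1 1 (n * torus a * u)%g = (a i1)^-1 * a i2 + d * c * a i1].
Proof.
move=> /Nminus_rows[n0 [d nd]] a0 /Nplus_cols[u0 [c uc]].
have [t0 t1] := torus_cols a0; exists c, d.
exact: (big_cell_entries n0 nd t0 t1 u0 uc).
Qed.

Lemma weight1 (a : 'I_2 -> K) i : weight (omega 1 i) a = a i.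
Proof.
rewrite /weight (bigD1 i) //= {1}/omega eqxx expr1 big1 ?mulr1 // => j /negPf h.
by rewrite /omega h expr0.
Qed.

Definition row_ (a b : nat) : CG := entry K a b.
Local Notation x := (row_ 0).
Local Notation z := (row_ 1).
(** Pluecker coordinates of the first two rows: V_(omega_2) occurs in the exterior square of the
    7-dimensional representation, with highest weight vector [pl 0 1]. *)
Definition pl (j k : nat) : CG := x j * z k - x k * z j.

Lemma minor1 : minor K i1 = x 0.
Proof.
apply: minor_unique => n a u hn a0 hu.
by have [c [d []]] := big_cell_rows hn a0 hu; rewrite weight1.
Qed.

Lemma minor2 : minor K i2 = pl 0 1.
Proof.
apply: minor_unique => n a u hn a0 hu.
have [c [d [h1 h2 h3 h4]]] := big_cell_rows hn a0 hu; rewrite weight1.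
rewrite /pl CGD CGN !CGM /row_ h1 h2 h3 h4; field; exact: a0.
Qed.

(** The sum is written out so that [ring] and [field] can work on its terms. *)
Definition rowsum a g (f : nat -> K) := row_ a 0 g * f 0%N + row_ a 1 g * f 1%N
  + row_ a 2 g * f 2 + row_ a 3 g * f 3 + row_ a 4 g * f 4 + row_ a 5 g * f 5 + row_ a 6 g * f 6.

Lemma row_mulmx a b (g : G) (M : 'M[K]_7) (f : nat -> K) :
  (forall j : 'I_7, M j b = f j) -> (\val g * M) (inord a) b = rowsum a g f.
Proof.
move=> Mf; rewrite mxE (eq_bigr (fun j : 'I_7 => row_ a j g * f j)) => [|j _].
  by rewrite !big_ord_recr big_ord0 /= add0r.
by rewrite Mf /= inord_val.
Qed.

Lemma row_mulG a b (g h : G) (s : seq (nat * nat * K)) : (b < 7)%N ->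
  spok s -> \val h = sp s -> row_ a b (g * h)%g = rowsum a g (fun c => spcoef s c b).
Proof.
move=> b7 ok hE; rewrite -[LHS]/((\val g * \val h) (inord a) (inord b)) hE.
by apply: row_mulmx => j; rewrite spE // inordK.
Qed.

Lemma row_one a b : (a < 7)%N -> (b < 7)%N -> row_ a b 1%g = (a == b)%:R.
Proof.
move=> a7 b7; rewrite -[LHS]/((1 : 'M[K]_7) (inord a) (inord b)) mxE.
by rewrite -val_eqE /= !inordK.
Qed.

Lemma rowG_mul a b (g h : G) : row_ a b (g * h)%g =
  (\val g * \val h) (inord a) (inord b).
Proof. by []. Qed.

(* The lists of entries of sbar i and of chf i. *)
Definition sl (i : 'I_2) : seq (nat * nat * int) := if i == i1 then
   [:: ent 0 1 (-1); ent 1 0 1; ent 2 4 1; ent 3 3 (-1);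
       ent 4 2 1; ent 5 6 (-1); ent 6 5 1]
  else
   [:: ent 0 0 1; ent 1 2 (-1); ent 2 1 1; ent 3 3 1; ent 4 5 (-1);
       ent 5 4 1; ent 6 6 1].

Definition fl (i : 'I_2) : seq (nat * nat * K) := if i == i1 then
   [:: at_ 1 0 1; at_ 3 2 1; at_ 4 3 2; at_ 6 5 1]
  else [:: at_ 2 1 1; at_ 5 4 1].

Lemma sbar_sl i : \val (sbar K i) = lc K (sl i).
Proof.
rewrite sbarE /nl /sl invrN1 opprK sqrrN expr1n invr1 lc_sp.
by have [->|->] := ord2P i.
Qed.

Lemma chf_fl i : chf K i = sp (fl i).
Proof. by rewrite chfE lc_sp; have [->|->] := ord2P i. Qed.

Definition wl (w : seq 'I_2) : seq (nat * nat * int) :=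
  foldr (fun i l => lcmul (sl i) l) [seq ent i i 1 | i <- iota 0 7] w.

Lemma lcok_mul s t : lcok s -> lcok t -> lcok (lcmul s t).
Proof.
move=> /allP hs /allP ht; apply/allP => x /flattenP[_ /mapP[a sa ->]] /mapP[b].
rewrite mem_filter => /andP[_ tb] ->.
have /andP[-> _] := hs _ sa; by have /andP[_ ->] := ht _ tb.
Qed.

Lemma wl_ok w : lcok (wl w).
Proof.
elim: w => [//|i w IH]; apply: lcok_mul => //.
by have [->|->] := ord2P i.
Qed.

Lemma wbarE w : \val (wbar K w) = lc K (wl w).
Proof.
elim: w => [|i w IH]; first by rewrite /wbar big_nil /= sp1 lc_sp.
rewrite /wbar big_cons -[LHS]/(\val (sbar K i) * \val (wbar K w)) IH sbar_sl lcM //.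
  by have [->|->] := ord2P i.
exact: wl_ok.
Qed.

Lemma row_wbar a b (g : G) w : (b < 7)%N ->
  row_ a b (g * wbar K w)%g = rowsum a g (fun c => (lccoef (wl w) c b)%:~R).
Proof.
move=> b7; rewrite rowG_mul wbarE; apply: row_mulmx => j.
by rewrite lcE ?wl_ok // inordK.
Qed.

Ltac coefs := cbv beta delta [rowsum]; repeat match goal with |- context [lccoef ?s ?i ?j] =>
    let v := eval vm_compute in (lccoef s i j) in
    change (lccoef s i j) with v end;
  rewrite ?NegzE ?mulrNz ?mulr1z ?mulr0z.

Ltac delta1 := let g := fresh "g" in apply/CG_eq => g; rewrite /Delta /minorw minor1;
  rewrite -[LHS]/(x 0 (g * wbar K _)%g) row_wbar; [coefs; ring | by []].

Lemma Delta1_0 : Delta K i1 [::] = x 0. Proof. delta1. Qed.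
Lemma Delta1_1 : Delta K i1 [:: 1%N] = x 1. Proof. delta1. Qed.
Lemma Delta1_2 : Delta K i1 [:: 2; 1]%N = x 2. Proof. delta1. Qed.
Lemma Delta1_3 : Delta K i1 [:: 1; 2; 1]%N = x 4. Proof. delta1. Qed.
Lemma Delta1_4 : Delta K i1 [:: 2; 1; 2; 1]%N = x 5. Proof. delta1. Qed.
Lemma Delta1_w0 : Delta K i1 w0 = x 6. Proof. delta1. Qed.

Lemma pl_eval j k g : pl j k g = x j g * z k g - x k g * z j g.
Proof. by []. Qed.

Ltac delta2 := let g := fresh "g" in apply/CG_eq => g; rewrite /Delta /minorw minor2;
  rewrite -[LHS]/(pl 0 1 (g * wbar K _)%g) !pl_eval;
  rewrite !row_wbar; [coefs; ring | by [] ..].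

Lemma Delta2_0 : Delta K i2 [::] = pl 0 1. Proof. delta2. Qed.
Lemma Delta2_2 : Delta K i2 [:: 1; 2]%N = pl 1 4. Proof. delta2. Qed.
Lemma Delta2_4 : Delta K i2 [:: 1; 2; 1; 2]%N = pl 4 6. Proof. delta2. Qed.
Lemma Delta2_w0 : Delta K i2 w0 = pl 5 6. Proof. delta2. Qed.

Lemma fdagE i (f : CG) g (q : {poly K}) :
  (forall t, f (g * yG i t)%g = q.[t]) -> fdag i f g = q^`().[0].
Proof.
move=> h; rewrite -[LHS]/(dag_fun i f g) /dag_fun.
have -> : (fun t : K => f (g * yG i t)%g) = horner q by apply/funext.
by have [] := derive_horner q 0.
Qed.

Lemma fdag_curve i (f : CG) g : exists2 q : {poly K},
  forall t, f (g * yG i t)%g = q.[t] & fdag i f g = q^`().[0].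
Proof.
have [f' _ /(_ g)[q [hq _]]] := fdag_poly i (valP f).
by exists q => //; apply: fdagE.
Qed.

Lemma fdagD i (f h : CG) : fdag i (f + h) = fdag i f + fdag i h.
Proof.
apply/CG_eq => g; have [p hp ep] := fdag_curve i f g.
have [q hq eq] := fdag_curve i h g; rewrite CGD ep eq -hornerD -derivD.
by apply: fdagE => t; rewrite hornerD -hp -hq.
Qed.

Lemma fdagM i (f h : CG) : fdag i (f * h) = fdag i f * h + f * fdag i h.
Proof.
apply/CG_eq => g; have [p hp ep] := fdag_curve i f g.
have [q hq eq] := fdag_curve i h g; rewrite CGD !CGM ep eq.
have -> : h g = q.[0] by rewrite -hq yG0 mulg1.
have -> : f g = p.[0] by rewrite -hp yG0 mulg1.
rewrite -!hornerM -hornerD -derivM.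
by apply: fdagE => t; rewrite hornerM -hp -hq.
Qed.

Lemma fdagC i (c : K) : fdag i (cstG c) = 0.
Proof.
apply/CG_eq => g; rewrite (@fdagE i _ g c%:P) ?derivC ?horner0 // => t.
by rewrite hornerC.
Qed.

Lemma fdag_row i a b g : (b < 7)%N -> fdag i (row_ a b) g =
  rowsum a g (fun c => spcoef (fl i) c b).
Proof.
move=> b7; set X := chf K i.
pose ia : 'I_7 := inord a; pose ib : 'I_7 := inord b.
rewrite (@fdagE i _ g ((\val g ia ib)%:P + ((\val g * X) ia ib) *: 'X
    + (2^-1 * (\val g * X ^+ 2) ia ib) *: 'X^2)); last first.
  move=> t; have gen (A B D : 'M[K]_7) u v :
      (A + u *: B + v *: D) ia ib = A ia ib + u * B ia ib + v * D ia ib.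
    by rewrite !mxE.
  rewrite -[LHS]/((\val g * root_mx false i t) ia ib) root_mxE -/X.
  by rewrite !mulrDr mulr1 -!scalerAr gen !hornerE /=; ring.
rewrite !derivD derivC !derivZ derivX derivXn /= !hornerE /=.
have -> : \val g * X = \val g * sp (fl i) by rewrite /X chf_fl.
have ok : spok (fl i) by have [->|->] := ord2P i.
by apply: row_mulmx => j; rewrite spE // inordK.
Qed.
End Functions.

Ltac split_all := repeat match goal with |- prod _ _ => split end.

(** * Relations between the coordinates *)

Section Relations.
Variable K : numFieldType.
Local Notation G := (G2 K).
Local Notation CG := (CG K).
Local Notation row_ := (@row_ K).
Local Notation x := (row_ 0).
Local Notation z := (row_ 1).
Local Notation pl := (@pl K).

Lemma fdagN i (f : CG) : fdag i (- f) = - fdag i f.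
Proof.
apply/eqP; rewrite -subr_eq0 opprK -fdagD addNr.
have {1}-> : (0 : CG) = cstG 0 by apply: CG_eq.
by rewrite fdagC.
Qed.
Lemma fdagB i (f h : CG) : fdag i (f - h) = fdag i f - fdag i h.
Proof. by rewrite fdagD fdagN. Qed.

Lemma fdE a :
  ((fdag i1 (row_ a 0) = row_ a 1) * (fdag i1 (row_ a 1) = 0)
   * (fdag i1 (row_ a 2) = row_ a 3) * (fdag i1 (row_ a 3) = (2 * row_ a 4)%R)
   * (fdag i1 (row_ a 4) = 0) * (fdag i1 (row_ a 5) = row_ a 6)
   * (fdag i1 (row_ a 6) = 0) * (fdag i2 (row_ a 0) = 0)
   * (fdag i2 (row_ a 1) = row_ a 2) * (fdag i2 (row_ a 2) = 0)
   * (fdag i2 (row_ a 3) = 0) * (fdag i2 (row_ a 4) = row_ a 5)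
   * (fdag i2 (row_ a 5) = 0) * (fdag i2 (row_ a 6) = 0))%type.
Proof.
split_all; apply/CG_eq => g; rewrite ?CG0 fdag_row // ?CGM ?CG_nat /rowsum /=; ring.
Qed.

Lemma G_ind (P : G -> Prop) : P 1%g -> (forall g i t, P g -> P (g * xG i t)%g) ->
  (forall g i t, P g -> P (g * yG i t)%g) -> forall g, P g.
Proof.
move=> P1 Px Py g; have /asboolP[w] := valP g.
elim/last_ind: w g => [|w [[b i] t] IH] g.
  by rewrite big_nil => h; have -> : g = 1%g by apply: val_inj.
rewrite -cats1 big_cat big_seq1 /= => hg.
pose y : G := if b then xG i t else yG i t.
have yE : \val y = root_mx b i t by rewrite /y; case: b {hg y}.
have -> : g = (g * y^-1 * y)%g by rewrite -mulgA mulVg mulg1.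
have h : P (g * y^-1)%g.
  apply: IH; rewrite -[LHS]/(G2val g * (\val y)^-1) hg yE -mulrA divrr ?mulr1 //.
  by rewrite -yE; case: (G2_unitV (valP y)).
by move: h; rewrite /y; case: (b) => h; [apply: Px|apply: Py].
Qed.

Lemma row_x a b g i t (s := xl i t) : (b < 7)%N ->
  row_ a b (g * xG i t)%g =
  rowsum a g (fun c => spcoef s c b).
Proof. by move=> b7; exact: (row_mulG a g (h := xG i t) b7 (ok_x i t) (xE i t)). Qed.

Lemma row_y a b g i t (s := yl i t) : (b < 7)%N ->
  row_ a b (g * yG i t)%g =
  rowsum a g (fun c => spcoef s c b).
Proof. by move=> b7; exact: (row_mulG a g (h := yG i t) b7 (ok_y i t) (yE i t)). Qed.

(** The quadratic form is invariant under the generators of G, and the first row of the identity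
    matrix is isotropic. *)
Lemma quadric g : x 0 g * x 6 g - x 1 g * x 5 g + x 2 g * x 4 g - x 3 g ^+ 2 / 4 = 0.
Proof.
apply: (G_ind (P := fun g => x 0 g * x 6 g - x 1 g * x 5 g + x 2 g * x 4 g
  - x 3 g ^+ 2 / 4 = 0)) g => [|g i t h|g i t h].
- by rewrite !row_one //=; field.
- rewrite !row_x; [|by []..]; rewrite -[RHS]h.
  by have [->|->] := ord2P i; rewrite /rowsum /=; field.
- rewrite !row_y; [|by []..]; rewrite -[RHS]h.
  by have [->|->] := ord2P i; rewrite /rowsum /=; field.
Qed.

(* The components of the cross product of the first two rows, an equivariant map to
   the 7-dimensional representation. *)
Definition cross (g : G) : seq K :=
  let p (j k : nat) : K := x j g * z k g - x k g * z j g in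
  [:: 2 * p 1 2 - p 0 3; p 1 3 - 2 * p 0 4; p 2 3 - 2 * p 0 5;
      2 * p 2 4 - 2 * p 1 5 - 2 * p 0 6; p 3 4 - 2 * p 1 6;
      p 3 5 - 2 * p 2 6; 2 * p 4 5 - p 3 6].

Lemma sum7 (f : nat -> K) : \sum_(j < 7) f j =
  f 0%N + f 1%N + f 2%N + f 3%N + f 4%N + f 5%N + f 6%N.
Proof. by rewrite !big_ord_recr big_ord0 /= add0r. Qed.

(** Right translation by a generator acts on [cross] through its matrix, so the vanishing at 1
    propagates to G. *)
Lemma cross0 g k : nth 0 (cross g) k = 0.
Proof.
suff : forall k, (k < 7)%N -> nth 0 (cross g) k = 0.
  by move=> h; have [/h //|k7] := ltnP k 7; rewrite nth_default.
apply: (G_ind (P := fun g => forall k, (k < 7)%N -> nth 0 (cross g) k = 0)) g => {k}.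
- rewrite /cross !row_one //.
  by case=> [|[|[|[|[|[|[|//]]]]]]] _; rewrite /=; ring.
- move=> g i t h k k7.
  have -> : nth 0 (cross (g * xG i t)%g) k = \sum_(j < 7) nth 0 (cross g) j *
      spcoef (xl i t) j k.
    rewrite (sum7 (fun j => nth 0 (cross g) j * spcoef (xl i t) j k)) /cross !row_x; try by [].
    by case: k k7 => [|[|[|[|[|[|[|//]]]]]]] _; have [->|->] := ord2P i; rewrite /rowsum /=; ring.
  by rewrite big1 // => j _; rewrite h ?mul0r.
- move=> g i t h k k7.
  have -> : nth 0 (cross (g * yG i t)%g) k = \sum_(j < 7) nth 0 (cross g) j *
      spcoef (yl i t) j k.
    rewrite (sum7 (fun j => nth 0 (cross g) j * spcoef (yl i t) j k)) /cross !row_y; try by [].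
    by case: k k7 => [|[|[|[|[|[|[|//]]]]]]] _; have [->|->] := ord2P i; rewrite /rowsum /=; ring.
  by rewrite big1 // => j _; rewrite h ?mul0r.
Qed.
End Relations.

(** * Spaces of homogeneous functions *)

(** U is only a set stable under combinations. A matrix of maximal rank with rows in U has row space
    U, and a nonzero column of its cokernel is the required linear form. *)
Lemma annihilator (K : fieldType) m (U : set 'rV[K]_m) : U 0 ->
  (forall u v, U u -> U v -> U (u + v)) -> (forall a u, U u -> U (a *: u)) ->
  (exists v, ~ U v) ->
  exists2 c : 'cV[K]_m, c != 0 & forall u, U u -> u *m c = 0.
Proof.
move=> U0 UD UZ [v nUv].
pose good r := `[< exists A : 'M[K]_m, (forall i, U (row i A)) /\ \rank A = r >].
have g0 : exists r, good r.
  exists 0%N; apply/asboolP; exists 0; split; last exact: mxrank0.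
  by move=> i; rewrite row0.
have gm r : good r -> (r <= m)%N by move=> /asboolP[A [_ <-]]; apply: rank_leq_row.
have [r /asboolP[A [hA rA]] rmax] := ex_maxnP g0 gm.
have sub w : (w <= A)%MS -> U w.
  move=> /submxP[D ->]; rewrite mulmx_sum_row.
  by elim/big_ind: _ => // i _; apply: UZ.
have in_A u : U u -> (u <= A)%MS.
  move=> Uu; pose B := (A + u)%MS.
  have hB : forall i, U (row i B).
    move=> i; have /sub_addsmxP[[D1 D2] /= ->] : (row i B <= A + u)%MS by apply: row_sub.
    apply: UD; first by apply: sub; apply: submxMl.
    by rewrite (mx11_scalar D2) mul_scalar_mx; apply: UZ.
  have rB : (\rank B <= \rank A)%N by rewrite rA; apply: rmax; apply/asboolP; exists B.
  have eAB : (A == B)%MS.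
    by rewrite -(geq_leqif (mxrank_leqif_eq (addsmxSl A u))).
  by rewrite (eqmxP eAB) addsmxSr.
have ck : cokermx A != 0.
  apply: contra_notN nUv => /eqP c0; apply: sub.
  by rewrite submxE c0 mulmx0.
have [j cj] : exists j, col j (cokermx A) != 0.
  apply: contrapT => hn; case/eqP: ck; apply/matrixP => a b.
  apply: contrapT => hab; apply: hn; exists b.
  apply/eqP => /matrixP/(_ a 0); rewrite [LHS]mxE [RHS]mxE => e; apply: hab.
  by rewrite e mxE.
exists (col j (cokermx A)) => // u /in_A; rewrite submxE => /eqP uc.
by rewrite colE mulmxA uc mul0mx.
Qed.

Section Scalars.
Variable K : numFieldType.
Local Notation CG := (CG K).

Lemma cstGD (c d : K) : cstG (c + d) = cstG c + cstG d :> CG. Proof. exact: CG_eq. Qed.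
Lemma cstGM (c d : K) : cstG (c * d) = cstG c * cstG d :> CG. Proof. exact: CG_eq. Qed.
Lemma cstG0 : cstG 0 = 0 :> CG. Proof. exact: CG_eq. Qed.
Lemma cstG1 : cstG 1 = 1 :> CG. Proof. exact: CG_eq. Qed.
Lemma cstG_prod (I : finType) (f : I -> K) : cstG (\prod_i f i) = \prod_i cstG (f i) :> CG.
Proof. exact: (big_morph _ cstGM cstG1). Qed.
Lemma rtransD h (f k : CG) : rtrans h (f + k) = rtrans h f + rtrans h k.
Proof. exact: CG_eq. Qed.
Lemma rtransM h (f k : CG) : rtrans h (f * k) = rtrans h f * rtrans h k.
Proof. exact: CG_eq. Qed.
Lemma rtransC h c : rtrans h (cstG c) = cstG c :> CG.
Proof. exact: CG_eq. Qed.
Lemma rtrans0 h : rtrans h (0 : CG) = 0. Proof. exact: CG_eq. Qed.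
Lemma rtrans1 h : rtrans h (1 : CG) = 1. Proof. exact: CG_eq. Qed.
Lemma rtrans_sum h (I : finType) (f : I -> CG) :
  rtrans h (\sum_i f i) = \sum_i rtrans h (f i).
Proof. exact: (big_morph _ (rtransD h) (rtrans0 h)). Qed.
Lemma rtrans_prod h (I : finType) (f : I -> CG) :
  rtrans h (\prod_i f i) = \prod_i rtrans h (f i).
Proof. exact: (big_morph _ (rtransM h) (rtrans1 h)). Qed.
Lemma rtransX h (f : CG) n : rtrans h (f ^+ n) = rtrans h f ^+ n.
Proof. by elim: n => [|n IH]; rewrite ?expr0 ?rtrans1 // !exprS rtransM IH. Qed.

Lemma cstGX (c : K) n : cstG (c ^+ n) = cstG c ^+ n :> CG.
Proof. by elim: n => [|n IH]; rewrite ?expr0 ?cstG1 // !exprS cstGM IH. Qed.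

Lemma CG_sum (I : finType) (P : pred I) (f : I -> CG) k :
  (\sum_(i | P i) f i) k = \sum_(i | P i) f i k.
Proof. by elim/big_rec2: _ => [//|i x z _ <-]; rewrite CGD. Qed.
Lemma CG_prod (I : finType) (f : I -> CG) k : (\prod_i f i) k = \prod_i f i k.
Proof. by elim/big_rec2: _ => [//|i x z _ <-]; rewrite CGM. Qed.

Lemma scal_is_additive : zmod_morphism (@scal K).
Proof.
move=> c d; rewrite /scal -rmorphB; congr FracField.tofrac; exact: CG_eq.
Qed.

Lemma scal_is_multiplicative : monoid_morphism (@scal K).
Proof.
split=> [|c d]; first by rewrite /scal (_ : cstG 1 = 1) ?rmorph1 //; exact: CG_eq.
by rewrite /scal -rmorphM; congr FracField.tofrac; exact: CG_eq.
Qed.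

HB.instance Definition _ := GRing.isZmodMorphism.Build K {fraction CG} (@scal K)
  scal_is_additive.
HB.instance Definition _ := GRing.isMonoidMorphism.Build K {fraction CG} (@scal K)
  scal_is_multiplicative.
End Scalars.

Section Homogeneous.
Variable K : numClosedFieldType.
Local Notation G := (G2 K).
Local Notation CG := (CG K).
Variables (A : finType) (y : A -> CG) (a0 : A) (i0 : 'I_2).
Local Notation t := (y a0).
Variables (rho : G -> A -> A -> K) (T : G) (lam : A -> K) (w : A -> K).

Hypothesis yG : forall h a, rtrans h (y a) = \sum_b cstG (rho h a b) * y b.
Hypothesis yN : forall a, CNG (y a).
Hypothesis t_minor : t = minor K i0.
Hypothesis t_Nplus : forall u, Nplus u -> rtrans u t = t.
Hypothesis t_torus : forall a, (forall i, a i != 0) ->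
  rtrans (torus a) t = cstG (weight (omega 1 i0) a) * t.
Hypothesis t1 : t 1%g = 1.
Hypothesis yT : forall a, rtrans T (y a) = cstG (lam a) * y a.
Hypothesis lam0 : forall a, 0 < lam a <= lam a0.
Hypothesis lam_top : forall a, lam a = lam a0 -> exists c, y a = cstG c * t.
Hypothesis y1 : forall a, lam a != lam a0 -> y a 1%g = 0.
Hypothesis w0 : forall a, 0 < w a.
(* The hermitian form with orthogonal basis y and squared norms w is contravariant
   for the compact form of G. *)
Hypothesis star : forall g, exists h, forall a, rho h a0 a = w a * (y a g)^*.

(** Monomials are indexed by sequences, not multisets: coefficients form the n-th tensor power, on
    which both the action of G and the hermitian form are products over the positions. *)
Definition mon n (s : {ffun 'I_n -> A}) : CG := \prod_i y (s i).
Definition lcomb n (v : {ffun 'I_n -> A} -> K) : CG := \sum_s cstG (v s) * mon s.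
Definition homog n : set CG := [set f | exists v, f = @lcomb n v].

Lemma mon_rtrans n h (s : {ffun 'I_n -> A}) : rtrans h (mon s) =
  lcomb (fun r : {ffun 'I_n -> A} => \prod_i rho h (s i) (r i)).
Proof.
rewrite /mon rtrans_prod /lcomb (eq_bigr _ (fun i _ => yG h (s i))).
rewrite bigA_distr_bigA /=; apply: eq_bigr => r _.
by rewrite big_split cstG_prod.
Qed.

Lemma lcombD n (v u : {ffun 'I_n -> A} -> K) :
  lcomb (fun s => v s + u s) = lcomb v + lcomb u.
Proof.
by rewrite /lcomb -big_split; apply: eq_bigr => s _; rewrite cstGD mulrDl.
Qed.

Lemma lcombZ n c (v : {ffun 'I_n -> A} -> K) :
  lcomb (fun s => c * v s) = cstG c * lcomb v.
Proof.
by rewrite /lcomb mulr_sumr; apply: eq_bigr => s _; rewrite cstGM mulrA.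
Qed.

Lemma lcomb_mon n (s : {ffun 'I_n -> A}) : lcomb (fun r => (r == s)%:R) = mon s.
Proof.
rewrite /lcomb (bigD1 s) //= eqxx cstG1 mul1r big1 ?addr0 // => r /negPf ->.
by rewrite cstG0 mul0r.
Qed.

Lemma lcomb0 n : lcomb (fun _ : {ffun 'I_n -> A} => 0) = 0.
Proof. by rewrite /lcomb big1 // => s _; rewrite cstG0 mul0r. Qed.

Lemma homogD n f k : homog n f -> homog n k -> homog n (f + k).
Proof. by move=> [v ->] [u ->]; exists (fun s => v s + u s); rewrite lcombD. Qed.

Lemma homogZ n c f : homog n f -> homog n (cstG c * f).
Proof. by move=> [v ->]; exists (fun s => c * v s); rewrite lcombZ. Qed.

Lemma homog0 n : homog n 0.
Proof. by exists (fun=> 0); rewrite lcomb0. Qed.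

Lemma homog_mon n (s : {ffun 'I_n -> A}) : homog n (mon s).
Proof. by exists (fun r => (r == s)%:R); rewrite lcomb_mon. Qed.

Lemma homog_sum n (I : finType) (f : I -> CG) : (forall i, homog n (f i)) ->
  homog n (\sum_i f i).
Proof. by move=> hf; elim/big_rec: _ => [|i x _ hx]; [exact: homog0|exact: homogD]. Qed.

Lemma homog_submodule n : submodule (homog n).
Proof.
split; [exact: homog0|exact: homogD|move=> c f; exact: homogZ|].
move=> h _ [v ->]; rewrite /lcomb rtrans_sum; apply: homog_sum => s.
by rewrite rtransM rtransC mon_rtrans; apply: homogZ; eexists.
Qed.

Lemma homog_CNG n : homog n `<=` @CNG K.
Proof.
move=> _ [v ->] m g hm; rewrite /lcomb !CG_sum; apply: eq_bigr => s _.
by rewrite !CGM !CGC /mon !CG_prod; congr (_ * _); apply: eq_bigr => i _; apply: yN.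
Qed.

Lemma homog_fin n : fin_dim (homog n).
Proof.
pose ss := index_enum {ffun 'I_n -> A}.
exists (map (@mon n) ss) => _ [v ->].
have [s0|] := pselect (exists s0 : {ffun 'I_n -> A}, true); last first.
  move=> hn; exists (fun=> 0); rewrite /lcomb !big1 //.
    by move=> i _; rewrite cstG0 mul0r.
  by move=> s _; case: hn; exists s.
case: s0 => s0 _; exists (fun k => v (nth s0 ss k)).
rewrite /lcomb (big_nth s0) big_mkord size_map.
by apply: eq_bigr => k _; rewrite (nth_map s0).
Qed.

Lemma t_neq0 n : t ^+ n != 0.
Proof.
rewrite expf_neq0 //; apply/eqP => e; have := t1; rewrite e => /eqP.
by rewrite CG0 eq_sym oner_eq0.
Qed.

Lemma homog_tn n : homog n (t ^+ n).
Proof.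
have -> : t ^+ n = mon [ffun _ : 'I_n => a0].
  by rewrite /mon (eq_bigr (fun=> t)) ?prodr_const ?card_ord // => i _; rewrite ffunE.
exact: homog_mon.
Qed.

Lemma weight_omega n (a : 'I_2 -> K) : weight (omega n i0) a = weight (omega 1 i0) a ^+ n.
Proof.
rewrite /weight -prodrXl; apply: eq_bigr => i _; rewrite /omega.
by case: ifP => _; rewrite ?expr1 // expr0 expr1n.
Qed.

Lemma homog_highest n : highest_weight (omega n i0) (homog n).
Proof.
exists (t ^+ n); split; [exact: homog_tn|exact: t_neq0| |].
- by move=> u hu; rewrite rtransX t_Nplus.
- by move=> a ha; rewrite rtransX t_torus // exprMn (weight_omega n) cstGX.
Qed.

Definition lams n (s : {ffun 'I_n -> A}) := \prod_i lam (s i).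

Lemma mon_T n (s : {ffun 'I_n -> A}) : rtrans T (mon s) = cstG (lams s) * mon s.
Proof.
rewrite /mon rtrans_prod /lams cstG_prod -big_split.
by apply: eq_bigr => i _; rewrite yT.
Qed.

(** A submodule is stable under T - e, hence under polynomials in T; taking the e among the
    eigenvalues removes the corresponding monomials. *)
Lemma submodule_filter n (M : set CG) (l : seq K) (v : {ffun 'I_n -> A} -> K) :
  submodule M -> M (lcomb v) ->
  M (lcomb (fun s => \prod_(e <- l) (lams s - e) * v s)).
Proof.
move=> sM; have [_ MD MZ MR] := sM; elim: l v => [|e l IH] v hv.
  suff -> : lcomb (fun s => \prod_(e <- [::]) (lams s - e) * v s) = lcomb v by [].
  by apply: eq_bigr => s _; rewrite big_nil mul1r.
have -> : lcomb (fun s => \prod_(e' <- e :: l) (lams s - e') * v s) =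
    lcomb (fun s => \prod_(e' <- l) (lams s - e') * ((lams s - e) * v s)).
  by apply: eq_bigr => s _; rewrite big_cons mulrCA mulrA.
apply: IH.
have -> : lcomb (fun s => (lams s - e) * v s) =
    rtrans T (lcomb v) + cstG (- e) * lcomb v.
  rewrite -lcombZ /lcomb rtrans_sum -big_split /=; apply: eq_bigr => s _.
  by rewrite rtransM rtransC mon_T mulrA -cstGM -mulrDl -cstGD; congr (cstG _ * _); ring.
by apply: MD; [exact: MR|exact: MZ].
Qed.

Lemma lams_top n (s : {ffun 'I_n -> A}) : lams s = lam a0 ^+ n ->
  forall i, lam (s i) = lam a0.
Proof.
move=> e i; apply/eqP; apply: contraT => hi.
have lt : lam (s i) < lam a0.
  by rewrite lt_neqAle hi; have /andP[] := lam0 (s i).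
have : lams s < lam a0 ^+ n; last by rewrite e ltxx.
rewrite /lams (bigD1 i) //= -[n in _ ^+ n]card_ord -prodr_const [ltRHS](bigD1 i) //=.
have p0 : 0 < \prod_(j | j != i) lam (s j).
  by apply: prodr_gt0 => j _; have /andP[] := lam0 (s j).
apply: (lt_le_trans (y := lam a0 * \prod_(j | j != i) lam (s j))).
  by rewrite ltr_pM2r.
rewrite ler_pM2l; last by have /andP[] := lam0 a0.
apply: ler_prod => j _; have /andP[l1 l2] := lam0 (s j).
by rewrite ltW.
Qed.

(* Projecting onto the eigenspace of T of the highest eigenvalue. *)
Lemma highest_in n (M : set CG) : submodule M -> M `<=` homog n ->
  M != [set 0] -> M (t ^+ n).
Proof.
move=> sM MH M0; have [M00 MD MZ MR] := sM.
(* A nonzero function is translated so as not to vanish at 1. *)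
have [f Mf f1] : exists2 f, M f & f 1%g != 0.
  apply: contrapT => hn; case/eqP: M0; apply/seteqP; split=> [f Mf|f ->] //.
  apply: CG_eq => g; apply: contrapT => fg; apply: hn.
  exists (rtrans g f); first exact: MR.
  by apply/eqP => e; apply: fg; rewrite CG0 -[RHS]e /= mul1g.
have [v fE] := MH _ Mf.
pose top (s : {ffun 'I_n -> A}) := lams s == lam a0 ^+ n.
have /choice[c hc] (s : {ffun 'I_n -> A}) : exists c : K, top s -> mon s = cstG c * t ^+ n.
  case: (boolP (top s)) => [/eqP hs|_]; last by exists 0.
  have /choice[d hd] i : exists d, y (s i) = cstG d * t.
    by apply: lam_top; apply: lams_top.
  exists (\prod_i d i) => _; rewrite /mon (eq_bigr _ (fun i _ => hd i)) big_split.
  by rewrite cstG_prod prodr_const card_ord.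
pose l := [seq lams s | s <- enum {ffun 'I_n -> A} & ~~ top s].
pose k := \prod_(e <- l) (lam a0 ^+ n - e).
have k0 : k != 0.
  rewrite /k; rewrite prodf_seq_neq0; apply/allP => e /mapP[s].
  by rewrite mem_filter => /andP[hs _] -> /=; rewrite subr_eq0 eq_sym.
pose m := \sum_(s | top s) v s * c s.
have flt : lcomb (fun s => \prod_(e <- l) (lams s - e) * v s) = cstG (k * m) * t ^+ n.
  rewrite /lcomb (bigID top) /= [X in _ + X]big1 ?addr0; last first.
    move=> s hs; rewrite (_ : \prod_(e <- l) _ = 0) ?mul0r ?cstG0 ?mul0r //.
    apply/eqP; rewrite prodf_seq_eq0; apply/hasP; exists (lams s).
      by apply/mapP; exists s; rewrite // mem_filter hs mem_enum.
    by rewrite /= subrr.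
  rewrite /m mulr_sumr; apply: (@etrans _ _ (\sum_(s | top s) cstG (k * (v s * c s)) * t ^+ n)).
    by apply: eq_bigr => s hs; rewrite hc // (eqP hs) mulrA -cstGM -/k mulrA.
  by rewrite -mulr_suml; congr (_ * _); rewrite (big_morph _ (@cstGD K) (@cstG0 K)).
(* The value f(1) is m, because every monomial outside the top eigenspace contains a factor that
   vanishes at 1. *)
have m0 : m != 0.
  apply: contra f1 => /eqP m0; rewrite fE /lcomb CG_sum (bigID top) /=.
  rewrite [X in _ + X]big1 ?addr0 => [|s /= hs]; last first.
    have [i hi] : exists i, lam (s i) != lam a0.
      apply: contrapT => hn; case/negP: hs; rewrite /top /lams.
      rewrite (eq_bigr (fun=> lam a0)) ?prodr_const ?card_ord // => i _.
      by apply/eqP; apply: contraT => hi; case: hn; exists i.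
    by rewrite -[LHS]/(v s * mon s 1%g) /mon CG_prod (bigD1 i) //= y1 // mul0r mulr0.
  apply/eqP; rewrite -[RHS]m0; apply: eq_bigr => s /= hs.
  by rewrite -[LHS]/(v s * mon s 1%g) hc // !CGM !CGC CGX t1 expr1n mulr1.
have := submodule_filter l sM (eq_ind _ M Mf _ fE); rewrite flt => h.
have -> : t ^+ n = cstG ((k * m)^-1) * (cstG (k * m) * t ^+ n).
  by rewrite mulrA -cstGM mulVf ?cstG1 ?mul1r // mulf_neq0.
exact: MZ.
Qed.

(* If the translates of t^n did not span, there would be a functional c vanishing
   on them; pairing it with its conjugate, which vanishes on G, gives c = 0. *)
Lemma translates_span n (M : set CG) : submodule M -> M (t ^+ n) -> homog n `<=` M.
Proof.
move=> sM Mt; have [M00 MD MZ MR] := sM.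
pose S := {ffun 'I_n -> A}.
pose of_row (u : 'rV[K]_#|S|) : S -> K := fun s => u 0 (enum_rank s).
pose U := [set u | M (lcomb (of_row u))].
apply: contrapT => hn.
have U0 : U 0.
  by rewrite /U /= (_ : of_row 0 = fun=> 0) ?lcomb0 //; apply/funext => s; rewrite /of_row mxE.
have UD u v : U u -> U v -> U (u + v).
  move=> hu hv; rewrite /U /=.
  rewrite (_ : of_row (u + v) = fun s => of_row u s + of_row v s); last first.
    by apply/funext => s; rewrite /of_row mxE.
  by rewrite lcombD; apply: MD.
have UZ b u : U u -> U (b *: u).
  move=> hu; rewrite /U /=.
  rewrite (_ : of_row (b *: u) = fun s => b * of_row u s); last first.
    by apply/funext => s; rewrite /of_row mxE.
  by rewrite lcombZ; apply: MZ.
pose to_row (v : S -> K) : 'rV[K]_#|S| := \row_j v (enum_val j).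
have to_rowK v : of_row (to_row v) = v.
  by apply/funext => s; rewrite /of_row mxE enum_rankK.
have [|c c0 hc] := annihilator U0 UD UZ.
  apply: contrapT => hv; apply: hn => _ [v ->].
  by apply: contrapT => hM; apply: hv; exists (to_row v); rewrite /U /= to_rowK.
pose d (s : S) := c (enum_rank s) 0.
have ann v : M (lcomb v) -> \sum_s v s * d s = 0.
  move=> hv; have := hc (to_row v); rewrite /U /= to_rowK => /(_ hv) /matrixP /(_ 0 0).
  rewrite !mxE => e; rewrite -[RHS]e (reindex (@enum_val S (mem S))) /=; last first.
    by apply: onW_bij; apply: enum_val_bij.
  by apply: eq_bigr => j _; rewrite mxE /d enum_valK.
pose ww (s : S) := \prod_i w (s i).
have ww0 s : 0 < ww s by apply: prodr_gt0 => i _; apply: w0.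
have cw s : (ww s)^* = ww s by apply/CrealP; apply: gtr0_real.
(* By [star], the coefficients of a suitable translate of t^n are, up to the weights, the conjugates
   of the values of the monomials at g. The conjugate of the relation saying that d kills this
   translate is therefore the value at g of the function on the left. *)
have h0 : lcomb (fun s => ww s * (d s)^*) = 0.
  apply: CG_eq => g; have [h hh] := star g.
  have tE : t ^+ n = mon ([ffun _ => a0] : S).
    by rewrite /mon (eq_bigr (fun=> t)) ?prodr_const ?card_ord // => i _; rewrite ffunE.
  have := MR h _ Mt; rewrite tE mon_rtrans => /ann /(congr1 Num.conj).
  rewrite rmorph0 rmorph_sum => e; rewrite CG0 -[RHS]e /lcomb CG_sum.
  apply: eq_bigr => s _.
  rewrite CGM CGC !rmorphM mulrAC; congr (_ * _).
  rewrite rmorph_prod /ww /mon CG_prod -big_split /=; apply: eq_bigr => i _.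
  rewrite ffunE hh rmorphM; congr (_ * _).
    by apply/esym; apply/CrealP; apply: gtr0_real.
  by rewrite -[RHS]/((y (s i) g)^*^*) conjCK.
(* The zero function lies in M, so d annihilates its coefficients too: this is a vanishing sum of
   positive multiples of the squared absolute values of d. *)
have s0 : \sum_s ww s * (d s)^* * d s = 0 by apply: ann; rewrite h0.
case/eqP: c0; apply/matrixP => j k; rewrite ord1 mxE -[j]enum_valK -/(d _).
have hs (s : S) : true -> 0 <= ww s * (d s)^* * d s.
  by move=> _; rewrite -mulrA mulr_ge0 ?(ltW (ww0 s)) // mulrC mul_conjC_ge0.
have /eqP := s0; rewrite psumr_eq0 // => /allP /(_ (enum_val j)).
rewrite mem_index_enum => /(_ isT) /=; rewrite !mulf_eq0 conjC_eq0 -orbA orbb.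
by rewrite gt_eqF //= => /eqP.
Qed.

Lemma homog_irreducible n : irreducible (homog n).
Proof.
split; first by exists (t ^+ n); [exact: homog_tn|exact: t_neq0].
move=> M sM MH; have [->|M0] := eqVneq M [set 0]; [by left|right].
by apply/seteqP; split=> //; apply: translates_span => //; apply: highest_in.
Qed.

(* On the big cell a highest weight vector of weight n omega is determined by its
   value at 1. *)
Lemma homog_Vhw n : homog n = Vhw (omega n i0).
Proof.
apply/seteqP; split=> [f hf|f [M [[sM MN _ [_ irr] [v [Mv v0 vN vT]]] Mf]]].
  exists (homog n); split=> //; split.
  - exact: homog_submodule.
  - exact: homog_CNG.
  - exact: homog_fin.
  - exact: homog_irreducible.
  - exact: homog_highest.
have [_ _ MZ _] := sM.
have vE : v = cstG (v 1%g) * t ^+ n.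
  apply/eqP; rewrite -subr_eq0; apply/eqP/CG_eq => g; rewrite CG0.
  apply: big_cell_dense g => _ [m [a [u [hm ha hu ->]]]].
  rewrite CGD CGN CGM CGC CGX t_minor minorP // -weight_omega.
  apply/eqP; rewrite subr_eq0; apply/eqP.
  have := congr1 (fun f : CG => f (m * torus a)%g) (vN _ hu) => /= ->.
  rewrite (MN _ Mv) //; have := congr1 (fun f : CG => f 1%g) (vT _ ha) => /=.
  by rewrite mul1g mulrC => ->.
have v1 : v 1%g != 0.
  by apply: contra v0 => /eqP e; rewrite vE e cstG0 mul0r.
have Mt : M (t ^+ n).
  have -> : t ^+ n = cstG ((v 1%g)^-1) * (cstG (v 1%g) * t ^+ n).
    by rewrite mulrA -cstGM mulVf // cstG1 mul1r.
  by rewrite -vE; exact: MZ.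
(* M contains t^n, hence all of [homog n], and is irreducible. *)
have [e|e] := irr (homog n) (homog_submodule n) (translates_span sM Mt).
  have := homog_tn n; rewrite e /= => /eqP.
  by rewrite (negPf (t_neq0 n)).
by rewrite e.
Qed.

Lemma homogM n m (f k : CG) : homog n f -> homog m k -> homog (n + m) (f * k).
Proof.
move=> [v ->] [u ->]; rewrite /lcomb mulr_suml; apply: homog_sum => s.
rewrite mulr_sumr; apply: homog_sum => r; rewrite mulrACA -cstGM; apply: homogZ.
have -> : mon s * mon r = mon [ffun i => match fintype.split i with inl j => s j | inr j => r j end].
  rewrite /mon big_split_ord /=; congr (_ * _); apply: eq_bigr => i _; rewrite ffunE.
    by rewrite (unsplitK (inl i)).
  by rewrite (unsplitK (inr i)).
exact: homog_mon.
Qed.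

Lemma coord_ringP f : coord_ring K i0 f <-> exists s : seq (nat * CG),
  (forall x, x \in s -> homog x.1 x.2) /\ f = \sum_(x <- s) x.2.
Proof.
by split=> -[s [hs ->]]; exists s; split=> // x /hs; rewrite homog_Vhw.
Qed.

Lemma coord_ring_homog n f : homog n f -> coord_ring K i0 f.
Proof.
move=> hf; apply/coord_ringP; exists [:: (n, f)]; rewrite big_seq1; split=> // x.
by rewrite inE => /eqP ->.
Qed.

Lemma coord_ringD f k : coord_ring K i0 f -> coord_ring K i0 k -> coord_ring K i0 (f + k).
Proof.
move=> [s [hs ->]] [r [hr ->]]; exists (s ++ r); rewrite big_cat; split=> // x.
by rewrite mem_cat => /orP[/hs|/hr].
Qed.

Lemma coord_ringM f k : coord_ring K i0 f -> coord_ring K i0 k -> coord_ring K i0 (f * k).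
Proof.
move=> /coord_ringP[s [hs ->]] /coord_ringP[r [hr ->]]; apply/coord_ringP.
exists [seq ((x.1 + z.1)%N, x.2 * z.2) | x <- s, z <- r]; split.
  by move=> _ /allpairsP[[x z] [/= /hs hx /hr hz ->]]; apply: homogM.
by rewrite big_allpairs_dep mulr_suml; apply: eq_bigr => x _; rewrite mulr_sumr.
Qed.

Local Notation "x %:F" := (FracField.tofrac x).
Local Notation S := [set f | exists n : nat, f = minor K i0 ^+ n].

Lemma localization_alg : localization (coord_ring K i0) S =
  alg (@scal K) ([set z | exists a, z = (y a)%:F] `|` [set (t%:F)^-1]).
Proof.
have F0 n : (t ^+ n)%:F != 0 by rewrite tofrac_eq0 t_neq0.
apply/seteqP; split=> [_ [f [_ [/coord_ringP[s [hs ->]] [n ->] ->]]]|].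
  set B := alg _ _; have cB : Ksubalg (@scal K) B by apply: alg_closed.
  have Bt : B (t%:F)^-1 by apply: alg_gen; right.
  apply: (saM cB); last by rewrite -t_minor tofracXn -exprVn; exact: (saX cB n Bt).
  rewrite rmorph_sum /= big_seq; apply: (sa_sum cB) => x /hs[v ->].
  rewrite /lcomb rmorph_sum; apply: (sa_sum cB) => r _; rewrite rmorphM.
  apply: (saM cB); first exact: (sa_const cB (v r)).
  rewrite rmorph_prod; apply: (sa_prod cB) => i _.
  by apply: alg_gen; left; exists (r i).
have S1 n : S (t ^+ n) by exists n; rewrite t_minor.
have Ct n : coord_ring K i0 (t ^+ n) by apply: coord_ring_homog (homog_tn n).
apply: alg_min; first split.
- move=> c; exists (cstG c * t ^+ 0), (t ^+ 0); split; last by rewrite expr0 mulr1 rmorph1 divr1.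
    exact: (coord_ring_homog (homogZ c (homog_tn 0))).
  exact: S1.
- move=> _ _ [f [_ [hf [n ->] ->]]] [k [_ [hk [m ->] ->]]].
  rewrite -t_minor; exists (f * t ^+ m + k * t ^+ n), (t ^+ (n + m)); split; last 1 first.
    by rewrite exprD rmorphD !rmorphM; apply: (addf_div _ _ (F0 n) (F0 m)).
    by apply: coord_ringD; apply: coord_ringM.
  by exists (n + m)%N.
- move=> _ _ [f [_ [hf [n ->] ->]]] [k [_ [hk [m ->] ->]]].
  rewrite -t_minor; exists (f * k), (t ^+ (n + m)); split; [exact: coord_ringM|by exists (n + m)%N|].
  by rewrite exprD !rmorphM /= invfM mulrACA.
- move=> z [[a ->]|->].
    exists (y a), (t ^+ 0); split; [|exact: S1|by rewrite expr0 rmorph1 divr1].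
    apply: (@coord_ring_homog 1).
    have -> : y a = mon [ffun _ : 'I_1 => a] by rewrite /mon big_ord1 ffunE.
    exact: homog_mon.
  exists (t ^+ 0), (t ^+ 1); split; [exact: Ct|exact: S1|].
  by rewrite expr0 expr1 rmorph1 div1r.
Qed.
End Homogeneous.

(** * Unipotent and torus action on rows *)

Section RowsColumns.
Variable K : numFieldType.
Local Notation G := (G2 K).
Local Notation row_ := (@row_ K).
Local Notation pl := (@pl K).

Lemma Emx_mull a (M : 'M[K]_7) b : (Emx K 0 a * M) (inord 0) b = M (inord a) b.
Proof.
rewrite mxE (bigD1 (inord a)) //= [X in _ + X]big1 ?addr0.
  by rewrite [Emx _ _ _ _ _]mxE !eqxx mul1r.
by move=> k ka; rewrite [Emx _ _ _ _ _]mxE (negbTE ka) andbF mul0r.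
Qed.

Lemma Emx_mulr b (M : 'M[K]_7) a : (M * Emx K b 0) a (inord 0) = M a (inord b).
Proof.
rewrite mxE (bigD1 (inord b)) //= [X in _ + X]big1 ?addr0.
  by rewrite [Emx _ _ _ _ _]mxE !eqxx mulr1.
by move=> k ka; rewrite [Emx _ _ _ _ _]mxE (negbTE ka) mulr0.
Qed.

Lemma row_Nminus n : Nminus n -> exists c, forall (g : G) b,
  row_ 0 b (n * g)%g = row_ 0 b g /\ row_ 1 b (n * g)%g = row_ 1 b g + c * row_ 0 b g.
Proof.
move=> /Nminus_rows[n0 [c n1]]; exists c => g b; rewrite !rowG_mul.
split; rewrite -Emx_mull mulrA.
  by rewrite n0 Emx_mull.
by rewrite n1 mulrDl mxE Emx_mull -scalerAl mxE Emx_mull.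
Qed.

Lemma row_Nplus u : Nplus u -> exists c, forall (g : G) a,
  row_ a 0 (g * u)%g = row_ a 0 g /\ row_ a 1 (g * u)%g = row_ a 1 g + c * row_ a 0 g.
Proof.
move=> /Nplus_cols[u0 [c u1]]; exists c => g a; rewrite !rowG_mul.
split; rewrite -Emx_mulr -mulrA.
  by rewrite u0 Emx_mulr.
by rewrite u1 mulrDr mxE Emx_mulr -scalerAr mxE Emx_mulr.
Qed.

Lemma row_torus a : (forall i, a i != 0) -> forall (g : G) b,
  row_ b 0 (g * torus a)%g = a i1 * row_ b 0 g /\
  row_ b 1 (g * torus a)%g = (a i1)^-1 * a i2 * row_ b 1 g.
Proof.
move=> /torus_cols[t0 t1] g b; rewrite !rowG_mul.
split; rewrite -Emx_mulr -mulrA.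
  by rewrite t0 -scalerAr mxE Emx_mulr.
by rewrite t1 -scalerAr mxE Emx_mulr.
Qed.

(** The torus element on which both simple roots take the value 2. It acts on v_0, ..., v_6 by 8, 4,
    2, 1, 1/2, 1/4, 1/8, so its largest eigenvalue is simple on the representation and on its
    exterior square. *)
Definition dyadic (i : 'I_2) : K := if i == i1 then 2 ^+ 3 else 2 ^+ 5.

Lemma dyadic_neq0 i : dyadic i != 0.
Proof. by rewrite /dyadic; case: ifP => _; rewrite expf_neq0 // pnatr_eq0. Qed.

Lemma row_dyadic (g : G) a (b : 'I_7) :
  row_ a b (g * torus dyadic)%g = 8 / 2 ^+ b * row_ a b g.
Proof.
have n2 : (2 : K) != 0 by rewrite pnatr_eq0.
rewrite rowG_mul torus_diag; last exact: dyadic_neq0.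
rewrite inord_val mxE (bigD1 b) //= [X in _ + X]big1 ?addr0.
  rewrite mulrC; congr (_ * _); last by rewrite -[in LHS](inord_val b).
  rewrite spE; last by [].
  by case: b => [[|[|[|[|[|[|[|//]]]]]]] p]; rewrite /tl /dyadic /=; field.
move=> k kb; rewrite spE; last by [].
suff -> : spcoef (tl (dyadic i1) (dyadic i2)) k b = 0 by rewrite mulr0.
move: kb; rewrite -val_eqE; case: k b => [[|[|[|[|[|[|[|//]]]]]]] pk] [[|[|[|[|[|[|[|//]]]]]]] pb] //= _; ring.
Qed.
End RowsColumns.

(** * The hermitian form and the two localizations *)

Section Star.
Variable K : numClosedFieldType.
Local Notation G := (G2 K).

(** Squared norms of the basis vectors for a hermitian form making f_i adjoint to e_i; the 2 at the
    vector of weight zero compensates the coefficients 2 in e_1 and f_1. *)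
Definition dd (j : nat) : K := if j == 3 then 2 else 1.

Lemma dd_gt0 j : 0 < dd j.
Proof. by rewrite /dd; case: ifP => _; rewrite ?ltr01 ?ltr0n. Qed.

Definition starmx (A : 'M[K]_7) : 'M[K]_7 :=
  \matrix_(j, k) (dd k / dd j * (A k j)^*).

Lemma starmx1 : starmx 1 = 1.
Proof.
apply/matrixP => j k; rewrite !mxE eq_sym rmorph_nat.
by case: eqP => [->|_]; rewrite ?mulr0 // mulr1 divff // gt_eqF ?dd_gt0.
Qed.

Lemma starmxD A B : starmx (A + B) = starmx A + starmx B.
Proof. by apply/matrixP => j k; rewrite !mxE rmorphD mulrDr. Qed.

Lemma starmxZ c A : starmx (c *: A) = c^* *: starmx A.
Proof. by apply/matrixP => j k; rewrite !mxE rmorphM mulrCA. Qed.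

Lemma starmxM A B : starmx (A * B) = starmx B * starmx A.
Proof.
apply/matrixP => j k; rewrite !mxE rmorph_sum mulr_sumr; apply: eq_bigr => l _.
have := dd_gt0 l => /gt_eqF/negbT l0; have := dd_gt0 j => /gt_eqF/negbT j0.
rewrite !mxE [X in _ * X](_ : _ = (A k l)^* * (B l j)^*); last exact: rmorphM.
by field; rewrite l0 j0.
Qed.

Lemma starmx_che b i : starmx (@Defs.rootX K b i) = @Defs.rootX K (~~ b) i.
Proof.
apply/matrixP => j k; rewrite mxE /Defs.rootX.
case: b; rewrite /= ?cheE ?chfE !lcE; try by have [->|->] := ord2P i.
  rewrite rmorph_int.
  have [->|->] := ord2P i; case: j k => [[|[|[|[|[|[|[|//]]]]]]] pk] [[|[|[|[|[|[|[|//]]]]]]] pb];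
    by rewrite /dd /=; field.
rewrite rmorph_int.
have [->|->] := ord2P i; case: j k => [[|[|[|[|[|[|[|//]]]]]]] pk] [[|[|[|[|[|[|[|//]]]]]]] pb];
    by rewrite /dd /=; field.
Qed.

Lemma starmx_root b i t : starmx (root_mx b i t) = root_mx (~~ b) i t^*.
Proof.
rewrite !root_mxE -!/(Defs.rootX _ _) !starmxD starmx1 !starmxZ !expr2 starmxM starmx_che.
by rewrite rmorphM fmorphV rmorph_nat rmorphM.
Qed.

(* The Cartan involution of the compact real form. *)
Lemma star_G (g : G) : exists h : G, \val h = starmx (\val g).
Proof.
elim/G_ind: g => [|g i t [h hh]|g i t [h hh]].
- by exists 1%g; rewrite /= starmx1.
- by exists (yG i t^* * h)%g; rewrite /= starmxM starmx_root hh.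
- by exists (xG i t^* * h)%g; rewrite /= starmxM starmx_root hh.
Qed.

Local Notation row_ := (@row_ K).
Local Notation pl := (@pl K).
Local Notation "x %:F" := (FracField.tofrac x).

Lemma star_rows (g : G) : exists h : G, forall a b : 'I_7,
  \val h a b = dd b / dd a * (row_ b a g)^*.
Proof.
have [h hh] := star_G g; exists h => a b; rewrite hh mxE.
by rewrite -[X in _ = _ * X^*]/(G2val g (inord b) (inord a)) !inord_val.
Qed.

Lemma dyadic_lt j k : (j < k)%N -> 8 / 2 ^+ k < 8 / 2 ^+ j :> K.
Proof.
move=> jk; rewrite ltr_pM2l ?ltr0n // ltf_pV2 ?posrE ?exprn_gt0 ?ltr0n //.
by rewrite ltr_eXn2l ?ltr1n.
Qed.

Lemma dyadic_gt0 j : 0 < 8 / 2 ^+ j :> K.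
Proof. by rewrite divr_gt0 ?exprn_gt0 ?ltr0n. Qed.

Lemma row_rtrans (g h : G) a (b : 'I_7) :
  row_ a b (g * h)%g = \sum_(c < 7) row_ a c g * \val h c b.
Proof.
rewrite rowG_mul inord_val mxE; apply: eq_bigr => c _; congr (_ * _).
by rewrite -[in LHS](inord_val c).
Qed.

Lemma short_localization :
  localization (coord_ring K i1) [set f | exists n : nat, f = minor K i1 ^+ n] =
  alg (@scal K) ([set z | exists a : 'I_7, z = (row_ 0 a)%:F] `|` [set ((row_ 0 0)%:F)^-1]).
Proof.
have := @localization_alg K _ (fun a : 'I_7 => row_ 0 a) ord0 i1
  (fun h a b => \val h b a) (torus (dyadic K)) (fun a => 8 / 2 ^+ a) (fun a => (dd a)^-1).
apply.
- move=> h a; apply: CG_eq => g; rewrite CG_sum -[LHS]/(row_ 0 a (g * h)%g) row_rtrans.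
  by apply: eq_bigr => c _; rewrite CGM CGC mulrC.
- move=> a n g hn; have [c hc] := row_Nminus hn; exact: (hc g a).1.
- by rewrite minor1.
- move=> u hu; apply: CG_eq => g; have [c hc] := row_Nplus hu; exact: (hc g _).1.
- move=> a ha; apply: CG_eq => g; rewrite CGM CGC weight1; exact: (row_torus ha g _).1.
- exact: row_one.
- move=> a; apply: CG_eq => g; rewrite CGM CGC; exact: row_dyadic.
- move=> a; rewrite dyadic_gt0 /=; have [->|a0] := posnP a; first exact: lexx.
  by rewrite ltW // dyadic_lt.
- move=> a; have [a0|a0] := posnP a; last by have := dyadic_lt a0 => /[swap] ->; rewrite ltxx.
  by move=> _; exists 1; rewrite cstG1 mul1r /= a0.
- move=> a ha; rewrite row_one // eq_sym; case: eqP => // a0.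
  by move: ha; rewrite a0 eqxx.
- by move=> a; rewrite invr_gt0 dd_gt0.
- move=> g; have [h hh] := star_rows g; exists h => a.
  by rewrite hh /dd /= mul1r.
Qed.

(** The sum runs over ordered pairs, in which every minor appears twice up to sign; hence the factor
    1/2. *)
Lemma pl_rtrans (g h : G) (j k : 'I_7) : pl j k (g * h)%g =
  \sum_(p : 'I_7 * 'I_7) 2^-1 * (\val h p.1 j * \val h p.2 k - \val h p.1 k * \val h p.2 j) *
    pl p.1 p.2 g.
Proof.
have n2 : (2 : K) != 0 by rewrite pnatr_eq0.
pose X (c d : 'I_7) : K := row_ 0 c g * row_ 1 d g *
  (\val h c j * \val h d k - \val h c k * \val h d j).
have -> : pl j k (g * h)%g = \sum_c \sum_d X c d.
  have prod (u v : 'I_7 -> K) : (\sum_c u c) * (\sum_d v d) = \sum_c \sum_d u c * v d.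
    exact: big_distrlr.
  rewrite pl_eval !row_rtrans !prod -sumrB; apply: eq_bigr => c _.
  by rewrite -sumrB; apply: eq_bigr => d _; rewrite /X; ring.
pose Y (c d : 'I_7) : K := 2^-1 * (\val h c j * \val h d k - \val h c k * \val h d j) * pl c d g.
rewrite -(pair_bigA _ Y) /=.
have -> : \sum_c \sum_d Y c d = \sum_c \sum_d 2^-1 * X c d + \sum_c \sum_d 2^-1 * X d c.
  rewrite -big_split; apply: eq_bigr => c _; rewrite -big_split; apply: eq_bigr => d _.
  by rewrite /= /Y /X pl_eval; ring.
rewrite [X in _ = _ + X]exchange_big -big_split; apply: eq_bigr => c _.
by rewrite -big_split; apply: eq_bigr => d _; rewrite /=; field.
Qed.

Lemma long_localization :
  localization (coord_ring K i2) [set f | exists n : nat, f = minor K i2 ^+ n] =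
  alg (@scal K) ([set z | exists a : 'I_7 * 'I_7, z = (pl a.1 a.2)%:F] `|`
                 [set ((pl 0 1)%:F)^-1]).
Proof.
have n2 : (2 : K) != 0 by rewrite pnatr_eq0.
(* On the diagonal the minor is 0 and its eigenvalue can be chosen. The product formula would give
   64 at the pair (0, 0), above the top eigenvalue 32 of the pair (0, 1); the value 1 is taken
   instead. *)
pose lam (a : 'I_7 * 'I_7) : K := if a.1 == a.2 then 1 else 8 / 2 ^+ a.1 * (8 / 2 ^+ a.2).
have lamE (a : 'I_7 * 'I_7) : a.1 != a.2 -> lam a = 8 / 2 ^+ (a.1 + a.2) * 8.
  by move=> /negPf h; rewrite /lam h exprD; field; rewrite !expf_neq0.
have := @localization_alg K _ (fun a : 'I_7 * 'I_7 => pl a.1 a.2) (inord 0, inord 1) i2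
  (fun h a b => 2^-1 * (\val h b.1 a.1 * \val h b.2 a.2 - \val h b.1 a.2 * \val h b.2 a.1))
  (torus (dyadic K)) lam (fun a => 2^-1 / (dd a.1 * dd a.2)).
have top : lam (inord 0, inord 1) = 8 / 2 ^+ 1 * 8.
  by rewrite lamE /= ?inordK // -val_eqE /= !inordK.
rewrite top /= !inordK //; apply.
- move=> h a; apply: CG_eq => g; rewrite CG_sum -[LHS]/(pl a.1 a.2 (g * h)%g) pl_rtrans.
  by apply: eq_bigr => c _; rewrite CGM CGC.
- move=> a n g hn; have [c hc] := row_Nminus hn; rewrite !pl_eval.
  by rewrite !(hc g _).1 !(hc g _).2; ring.
- by rewrite minor2.
- move=> u hu; apply: CG_eq => g; have [c hc] := row_Nplus hu.
  by rewrite -[LHS]/(pl 0 1 (g * u)%g) !pl_eval !(hc g _).1 !(hc g _).2; ring.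
- move=> a ha; apply: CG_eq => g; rewrite CGM CGC weight1.
  rewrite -[LHS]/(pl 0 1 (g * torus a)%g) !pl_eval !(row_torus ha g _).1 !(row_torus ha g _).2.
  by field; apply: ha.
- by rewrite -[LHS]/(pl 0 1 1%g) pl_eval !row_one //=; ring.
- move=> [a b]; apply: CG_eq => g; rewrite CGM CGC.
  rewrite -[LHS]/(pl a b (g * torus (dyadic K))%g) !pl_eval !row_dyadic /lam /=.
  by case: eqP => [->|_]; ring.
- move=> a; rewrite /lam; case: eqP => [_|/eqP ab].
    rewrite ltr01 /=; have -> : 8 / 2 ^+ 1 * 8 = 32 :> K by field.
    by rewrite ler1n.
  rewrite mulr_gt0 ?dyadic_gt0 //= -[leLHS]/(8 / 2 ^+ a.1 * (8 / 2 ^+ a.2)).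
  have := lamE _ ab; rewrite /lam (negPf ab) => ->.
  rewrite ler_pM2r ?ltr0n //; have [->|h] := eqVneq (a.1 + a.2)%N 1%N; first exact: lexx.
  rewrite ltW // dyadic_lt // ltn_neqAle eq_sym h lt0n addn_eq0.
  by apply: contra ab => /andP[/eqP e1 /eqP e2]; rewrite -val_eqE /= e1 e2.
- move=> a; rewrite /lam; case: eqP => [_ /esym/eqP|/eqP ab].
    have -> : 8 / 2 ^+ 1 * 8 = 32%:R :> K by field.
    by rewrite -[1]/(1%:R) eqr_nat.
  have := lamE _ ab; rewrite /lam (negPf ab) => -> /mulIf e.
  have s1 : (a.1 + a.2 = 1)%N.
    have [h|h|//] := ltngtP (a.1 + a.2) 1.
      have := dyadic_lt h; rewrite e ?ltxx // pnatr_eq0 //.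
    by have := dyadic_lt h; rewrite e ?ltxx // pnatr_eq0.
  case: a ab s1 {e} => a b /= ab.
  case: a b ab => [[|[|a]] pa] [[|[|b]] pb] //= _ _.
    by exists 1; rewrite cstG1 mul1r.
  exists (-1); apply: CG_eq => g; rewrite CGM CGC !pl_eval /=; ring.
- move=> a; have [aa _|ab] := eqVneq a.1 a.2.
    by rewrite -[LHS]/(pl a.1 a.2 1%g) pl_eval aa subrr.
  rewrite (lamE _ ab) => s1; rewrite -[LHS]/(pl a.1 a.2 1%g) pl_eval !row_one //.
  case: a ab s1 => [[[|[|a]] pa] [[|[|b]] pb]] //= _ s1; rewrite ?eqxx in s1 *; by [|ring].
- by move=> a; rewrite divr_gt0 ?invr_gt0 ?mulr_gt0 ?dd_gt0 ?ltr0n.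
- move=> g; have [h hh] := star_rows g; exists h => a.
  have conjE (p q r s : K) : (p * q - r * s)^* = p^* * q^* - r^* * s^*.
    by rewrite rmorphB !rmorphM.
  rewrite -[X in _ * X^*]/(pl a.1 a.2 g) pl_eval conjE !hh !inordK //.
  have -> : dd 0 = 1 by []. have -> : dd 1 = 1 by [].
  by field; rewrite !gt_eqF ?dd_gt0.
Qed.
End Star.

(** * Derivations of the field of functions on G *)

Local Notation "x %:F" := (FracField.tofrac x).

Lemma fraction_ratio (R : idomainType) (z : {fraction R}) :
  exists2 p : R * R, p.2 != 0 & z = p.1%:F / p.2%:F.
Proof.
elim/quotW: z => r; exists (frac r); first exact: denom_ratioP.
have d0 : (frac r).2%:F != 0 by rewrite tofrac_eq0 denom_ratioP.
apply: (canRL (mulfK d0)); unlock FracField.tofrac.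
rewrite -[LHS]FracField.pi_mul; apply/eqmodP; rewrite /= FracField.equivfE /FracField.mulf.
rewrite !numden_Ratio ?oner_neq0 ?mulr1 ?mul1r ?denom_ratioP //.
by rewrite mulrC.
Qed.

Section QuotientRule.
Variable F : fieldType.
Implicit Types A B C E : F.

Lemma ratio_cross A B C E : B != 0 -> E != 0 -> A / B = C / E -> A * E = C * B.
Proof. by move=> B0 E0 /eqP; rewrite eqr_div // => /eqP. Qed.

Lemma quotient_rule_uniq A B C E A' B' C' E' : B != 0 -> E != 0 ->
  A * E = C * B -> A' * E + A * E' = C' * B + C * B' ->
  (A' * B - A * B') / B ^+ 2 = (C' * E - C * E') / E ^+ 2.
Proof.
move=> B0 E0 e1 e2; apply/eqP; rewrite eqr_div ?expf_neq0 //; apply/eqP.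
have -> : (A' * B - A * B') * E ^+ 2 =
    (A' * E + A * E') * B * E - A * E * (B * E' + E * B') by ring.
by rewrite e2 e1; ring.
Qed.

Lemma quotient_ruleD A B C E A' B' C' E' : B != 0 -> E != 0 ->
  ((A' * E + A * E' + (C' * B + C * B')) * (B * E)
    - (A * E + C * B) * (B' * E + B * E')) / (B * E) ^+ 2 =
  (A' * B - A * B') / B ^+ 2 + (C' * E - C * E') / E ^+ 2.
Proof. by move=> B0 E0; field; rewrite B0 E0. Qed.

Lemma quotient_ruleM A B C E A' B' C' E' : B != 0 -> E != 0 ->
  ((A' * C + A * C') * (B * E) - A * C * (B' * E + B * E')) / (B * E) ^+ 2 =
  (A' * B - A * B') / B ^+ 2 * (C / E) + A / B * ((C' * E - C * E') / E ^+ 2).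
Proof. by move=> B0 E0; field; rewrite B0 E0. Qed.
End QuotientRule.

Section Extension.
Variable K : numFieldType.
Local Notation CG := (CG K).
Local Notation F := {fraction CG}.
Variable D : CG -> CG.
Hypothesis DD : forall f h, D (f + h) = D f + D h.
Hypothesis DM : forall f h, D (f * h) = D f * h + f * D h.
Hypothesis DC : forall c, D (cstG c) = 0.

Definition ext (z : F) : F := let p := projT1 (cid2 (fraction_ratio z)) in
  ((D p.1)%:F * p.2%:F - p.1%:F * (D p.2)%:F) / p.2%:F ^+ 2.

Lemma ext_ratio a b : b != 0 ->
  ext (a%:F / b%:F) = ((D a)%:F * b%:F - a%:F * (D b)%:F) / b%:F ^+ 2.
Proof.
move=> b0; rewrite /ext; case: cid2 => -[n d] /= d0 e.
have bF : b%:F != 0 by rewrite tofrac_eq0.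
have dF : d%:F != 0 by rewrite tofrac_eq0.
have e1 : a%:F * d%:F = n%:F * b%:F by exact: ratio_cross bF dF e.
have : D (a * d) = D (n * b).
  by congr D; apply/eqP; rewrite -tofrac_eq !rmorphM /= e1.
rewrite !DM => /(congr1 (@FracField.tofrac _)); rewrite !rmorphD !rmorphM /= => e2.
by rewrite (quotient_rule_uniq bF dF e1 e2).
Qed.

Lemma extE f : ext f%:F = (D f)%:F.
Proof.
have D1 : D 1 = 0 by rewrite -(DC 1); congr D; apply: CG_eq.
have := @ext_ratio f 1 (oner_neq0 _).
by rewrite rmorph1 divr1 D1 rmorph0 mulr0 subr0 expr1n divr1 mulr1.
Qed.

Lemma der_ext : der (@scal K) ext.
Proof.
split=> [x y|x y|c]; last by rewrite extE DC rmorph0.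
- have [[a b] /= b0 ->] := fraction_ratio x; have [[a' b'] /= b0' ->] := fraction_ratio y.
  have F0 : b%:F != 0 by rewrite tofrac_eq0.
  have F0' : b'%:F != 0 by rewrite tofrac_eq0.
  have -> : a%:F / b%:F + a'%:F / b'%:F = (a * b' + a' * b)%:F / (b * b')%:F.
    by rewrite (addf_div _ _ F0 F0') rmorphD !rmorphM.
  rewrite (ext_ratio _ (mulf_neq0 b0 b0')) (ext_ratio _ b0) (ext_ratio _ b0').
  rewrite !(DD, DM) !tofracD !tofracM.
  exact: (quotient_ruleD a%:F a'%:F (D a)%:F (D b)%:F (D a')%:F (D b')%:F F0 F0').
- have [[a b] /= b0 ->] := fraction_ratio x; have [[a' b'] /= b0' ->] := fraction_ratio y.
  have F0 : b%:F != 0 by rewrite tofrac_eq0.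
  have F0' : b'%:F != 0 by rewrite tofrac_eq0.
  have -> : a%:F / b%:F * (a'%:F / b'%:F) = (a * a')%:F / (b * b')%:F.
    by rewrite mulf_div !rmorphM.
  rewrite (ext_ratio _ (mulf_neq0 b0 b0')) (ext_ratio _ b0) (ext_ratio _ b0').
  rewrite !DM !tofracD !tofracM.
  exact: (quotient_ruleM a%:F a'%:F (D a)%:F (D b)%:F (D a')%:F (D b')%:F F0 F0').
Qed.
End Extension.

Section Triangular.
Variables (K : numFieldType) (F : fieldType) (iota : {rmorphism K -> F}).

(** Gaussian elimination: a multiple of the k-th derivation corrects the value on the k-th
    coordinate and leaves the earlier values as they are. *)
Lemma ind6_triangular t a b c d e (D0 D1 D2 D3 D4 D5 : F -> F) :
  der iota D0 -> der iota D1 -> der iota D2 -> der iota D3 -> der iota D4 -> der iota D5 ->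
  D0 t != 0 -> [/\ D1 t = 0 & D1 a != 0] -> [/\ D2 t = 0, D2 a = 0 & D2 b != 0] ->
  [/\ D3 t = 0, D3 a = 0, D3 b = 0 & D3 c != 0] ->
  [/\ D4 t = 0, D4 a = 0, D4 b = 0, D4 c = 0 & D4 d != 0] ->
  [/\ D5 t = 0, D5 a = 0, D5 b = 0, D5 c = 0 & D5 d = 0 /\ D5 e != 0] ->
  ind6 iota t a b c d e.
Proof.
move=> d0 d1 d2 d3 d4 d5 D0t [D1t D1a] [D2t D2a D2b] [D3t D3a D3b D3c] [D4t D4a D4b D4c D4d].
move=> [D5t D5a D5b D5c [D5d D5e]] et ea eb ec ed ee.
have step (E D : F -> F) v x : der iota E -> der iota D -> D v != 0 -> exists E',
    [/\ der iota E', E' v = x & forall u, D u = 0 -> E' u = E u].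
  move=> dE dD v0; exists (fun z => 1 * E z + ((x - E v) / D v) * D z); split.
  - exact: der_sum.
  - by rewrite divfK // mul1r addrC subrK.
  - by move=> u ->; rewrite mulr0 addr0 mul1r.
have [E0 [h0 q0 _]] := step D0 D0 t et d0 d0 D0t.
have [E1 [h1 q1 s1]] := step E0 D1 a ea h0 d1 D1a.
have [E2 [h2 q2 s2]] := step E1 D2 b eb h1 d2 D2b.
have [E3 [h3 q3 s3]] := step E2 D3 c ec h2 d3 D3c.
have [E4 [h4 q4 s4]] := step E3 D4 d ed h3 d4 D4d.
have [E5 [h5 q5 s5]] := step E4 D5 e ee h4 d5 D5e.
exists E5 => //; split; [| | | |split=> //].
- by rewrite s5 // s4 // s3 // s2 // s1.
- by rewrite s5 // s4 // s3 // s2.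
- by rewrite s5 // s4 // s3.
- by rewrite s5 // s4.
- by rewrite s5.
Qed.
End Triangular.

(** * Raising operators *)

Section RootVectors.
Variable K : numFieldType.
Local Notation G := (G2 K).
Local Notation CG := (CG K).
Local Notation row_ := (@row_ K).

Lemma rtransMg (g h : G) (f : CG) : rtrans g (rtrans h f) = rtrans (g * h)%g f.
Proof. by apply: CG_eq => k; rewrite /= mulgA. Qed.

Lemma rtrans1g (f : CG) : rtrans 1%g f = f.
Proof. by apply: CG_eq => k; rewrite /= mulg1. Qed.

Lemma rtransVg (h : G) (f k : CG) : rtrans h f = k -> rtrans h^-1%g k = f.
Proof. by move=> <-; rewrite rtransMg mulVg rtrans1g. Qed.

(* The raising operators are conjugate to the lowering ones: Ad(sbar i) f_i = - e_i. *)
Definition edag (i : 'I_2) (f : CG) : CG :=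
  - rtrans (sbar K i) (fdag i (rtrans (sbar K i)^-1%g f)).

Lemma edagD i f h : edag i (f + h) = edag i f + edag i h.
Proof. by rewrite /edag rtransD fdagD rtransD opprD. Qed.
Lemma edagM i f h : edag i (f * h) = edag i f * h + f * edag i h.
Proof.
have K1 k : rtrans (sbar K i) (rtrans (sbar K i)^-1%g k) = k.
  by rewrite rtransMg mulgV rtrans1g.
by rewrite /edag rtransM fdagM rtransD !rtransM !K1 opprD mulNr mulrN.
Qed.
Lemma edagC i c : edag i (cstG c) = 0.
Proof. by rewrite /edag rtransC fdagC rtrans0 oppr0. Qed.

Lemma row_sbar a i b g : (b < 7)%N ->
  row_ a b (g * sbar K i)%g = rowsum a g (fun c => (lccoef (sl i) c b)%:~R).
Proof.
move=> b7; rewrite rowG_mul sbar_sl; apply: row_mulmx => j.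
by rewrite lcE ?inordK //; have [->|->] := ord2P i.
Qed.

Lemma rsE a :
  ((rtrans (sbar K i1) (row_ a 0) = row_ a 1) * (rtrans (sbar K i1) (row_ a 1) = - row_ a 0)
   * (rtrans (sbar K i1) (row_ a 2) = row_ a 4) * (rtrans (sbar K i1) (row_ a 3) = - row_ a 3)
   * (rtrans (sbar K i1) (row_ a 4) = row_ a 2) * (rtrans (sbar K i1) (row_ a 5) = row_ a 6)
   * (rtrans (sbar K i1) (row_ a 6) = - row_ a 5) * (rtrans (sbar K i2) (row_ a 0) = row_ a 0)
   * (rtrans (sbar K i2) (row_ a 1) = row_ a 2) * (rtrans (sbar K i2) (row_ a 2) = - row_ a 1)
   * (rtrans (sbar K i2) (row_ a 3) = row_ a 3) * (rtrans (sbar K i2) (row_ a 4) = row_ a 5)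
   * (rtrans (sbar K i2) (row_ a 5) = - row_ a 4) * (rtrans (sbar K i2) (row_ a 6) = row_ a 6))%type.
Proof.
split_all; apply: CG_eq => g; rewrite ?CGN;
  rewrite -[LHS]/(row_ a _ (g * sbar K _)%g) row_sbar // /rowsum /sl /=; ring.
Qed.

Lemma rtrans_nat g n : rtrans g (n%:R : CG) = n%:R.
Proof. by apply: CG_eq => k; rewrite /= -!/((n%:R : CG) _) !CG_nat. Qed.

Lemma rtransN g (f : CG) : rtrans g (- f) = - rtrans g f.
Proof. exact: CG_eq. Qed.

Lemma edag_conj i f k : rtrans (sbar K i) f = k -> edag i k = - rtrans (sbar K i) (fdag i f).
Proof. by move=> h; rewrite /edag (rtransVg h). Qed.

Lemma edag_conjN i f k : rtrans (sbar K i) f = - k -> edag i k = rtrans (sbar K i) (fdag i f).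
Proof.
move=> h; rewrite (@edag_conj i (- f)) ?rtransN ?h ?opprK // fdagN rtransN opprK //.
Qed.

Section RaisingRows.
Variable a : nat.

Ltac ed conj b := rewrite (conj _ (row_ a b)) ?rsE //;
  by rewrite fdE ?rtrans0 ?rtransM ?rtrans_nat ?rsE ?oppr0 ?opprK.

Lemma edE :
  ((edag i1 (row_ a 0) = 0) * (edag i1 (row_ a 1) = row_ a 0)
   * (edag i1 (row_ a 2) = 0) * (edag i1 (row_ a 3) = (2 * row_ a 2)%R)
   * (edag i1 (row_ a 4) = row_ a 3) * (edag i1 (row_ a 5) = 0)
   * (edag i1 (row_ a 6) = row_ a 5) * (edag i2 (row_ a 0) = 0)
   * (edag i2 (row_ a 1) = 0) * (edag i2 (row_ a 2) = row_ a 1)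
   * (edag i2 (row_ a 3) = 0) * (edag i2 (row_ a 4) = 0)
   * (edag i2 (row_ a 5) = row_ a 4) * (edag i2 (row_ a 6) = 0))%type.
Proof.
split_all; [ed (@edag_conjN) 1%N | ed (@edag_conj) 0%N | ed (@edag_conj) 4%N | ed (@edag_conjN) 3%N
 | ed (@edag_conj) 2%N | ed (@edag_conjN) 6%N | ed (@edag_conj) 5%N | ed (@edag_conj) 0%N
 | ed (@edag_conjN) 2%N | ed (@edag_conj) 1%N | ed (@edag_conj) 3%N | ed (@edag_conjN) 5%N
 | ed (@edag_conj) 4%N | ed (@edag_conj) 6%N].
Qed.
End RaisingRows.
End RootVectors.

(** * Root vectors of the unipotent radicals *)

Section Raising.
Variables (K : numFieldType) (F : fieldType) (iota : {rmorphism K -> F}).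
Variables (E1 E2 : F -> F).
Hypotheses (dE1 : der iota E1) (dE2 : der iota E2).

Definition raising (x : nat -> F) := [/\
  [/\ E1 (x 0%N) = 0, E1 (x 1%N) = x 0%N, E1 (x 2%N) = 0 & E1 (x 3%N) = 2 * x 2%N],
  [/\ E1 (x 4%N) = x 3%N, E1 (x 5%N) = 0 & E1 (x 6%N) = x 5%N],
  [/\ E2 (x 0%N) = 0, E2 (x 1%N) = 0, E2 (x 2%N) = x 1%N & E2 (x 3%N) = 0] &
  [/\ E2 (x 4%N) = 0, E2 (x 5%N) = x 4%N & E2 (x 6%N) = 0]].

(** Root vectors, up to scalars, for alpha_1 + alpha_2, 2 alpha_1 + alpha_2, 3 alpha_1 + alpha_2 and
    3 alpha_1 + 2 alpha_2. Together with E1, respectively E2, they span the unipotent radical of a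
    maximal parabolic, which explains the five coordinates besides t. *)
Let E12 x := E1 (E2 x) - E2 (E1 x).
Let E112 x := E1 (E12 x) - E12 (E1 x).
Let E1112 x := E1 (E112 x) - E112 (E1 x).
Let E21112 x := E2 (E1112 x) - E1112 (E2 x).

Let d12 : der iota E12. Proof. exact: der_brk. Qed.
Let d112 : der iota E112. Proof. exact: der_brk. Qed.
Let d1112 : der iota E1112. Proof. exact: der_brk. Qed.
Let d21112 : der iota E21112. Proof. exact: der_brk. Qed.

Let derZ D (dD : der iota D) n y : D (n%:R * y) = n%:R * D y.
Proof. by rewrite (derM dD) (der_nat dD) mul0r add0r. Qed.

Section Table.
Variable x : nat -> F.
Hypothesis hx : raising x.

Lemma raising12 : [/\ E12 (x 0%N) = 0, E12 (x 1%N) = 0, E12 (x 2%N) = x 0%N &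
  [/\ E12 (x 3%N) = - (2 * x 1%N), E12 (x 4%N) = 0, E12 (x 5%N) = x 3%N & E12 (x 6%N) = - x 4%N]].
Proof.
case: hx => -[a0 a1 a2 a3] [a4 a5 a6] [b0 b1 b2 b3] [b4 b5 b6].
rewrite /E12 !(a0, a1, a2, a3, a4, a5, a6, b0, b1, b2, b3, b4, b5, b6) (derZ dE2).
by rewrite !(a1, a2, a4, b0, b2, b3, b5) !(der0 dE1) !(der0 dE2) !subr0 !sub0r.
Qed.

Lemma raising112 : [/\ E112 (x 0%N) = 0, E112 (x 1%N) = 0, E112 (x 2%N) = 0 &
  [/\ E112 (x 3%N) = - (4 * x 0%N), E112 (x 4%N) = 2 * x 1%N, E112 (x 5%N) = 2 * x 2%N &
      E112 (x 6%N) = - (2 * x 3%N)]].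
Proof.
case: hx => -[a0 a1 a2 a3] [a4 a5 a6] _ _; have [c0 c1 c2 [c3 c4 c5 c6]] := raising12.
rewrite /E112 !(a0, a1, a2, a3, a4, a5, a6, c0, c1, c2, c3, c4, c5, c6).
rewrite !(derN dE1) !(derZ dE1) !(derZ d12) !(a0, a1, a4, a3, c0, c2, c3, c5) !(der0 dE1) !(der0 d12).
by rewrite !subr0 !sub0r ?opprK; (split; last split); ring.
Qed.

Lemma raising1112 : [/\ E1112 (x 0%N) = 0, E1112 (x 1%N) = 0, E1112 (x 2%N) = 0 &
  [/\ E1112 (x 3%N) = 0, E1112 (x 4%N) = 6 * x 0%N, E1112 (x 5%N) = 0 &
      E1112 (x 6%N) = - (6 * x 2%N)]].
Proof.
case: hx => -[a0 a1 a2 a3] [a4 a5 a6] _ _; have [c0 c1 c2 [c3 c4 c5 c6]] := raising112.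
rewrite /E1112 !(a0, a1, a2, a3, a4, a5, a6, c0, c1, c2, c3, c4, c5, c6).
rewrite !(derN dE1) !(derZ dE1) !(derZ d112) !(a0, a1, a2, a4, a3, c0, c2, c3, c5) !(der0 dE1) !(der0 d112).
by rewrite ?mulr0 ?oppr0 ?subr0; (split; last split); ring.
Qed.

Lemma raising21112 : [/\ E21112 (x 0%N) = 0, E21112 (x 1%N) = 0, E21112 (x 2%N) = 0 &
  [/\ E21112 (x 3%N) = 0, E21112 (x 4%N) = 0, E21112 (x 5%N) = - (6 * x 0%N) &
      E21112 (x 6%N) = - (6 * x 1%N)]].
Proof.
case: hx => _ _ [b0 b1 b2 b3] [b4 b5 b6]; have [c0 c1 c2 [c3 c4 c5 c6]] := raising1112.
rewrite /E21112 !(b0, b1, b2, b3, b4, b5, b6, c0, c1, c2, c3, c4, c5, c6).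
rewrite !(derN dE2) !(derZ dE2) !(b0, b2, c1, c4) !(der0 dE2) !(der0 d1112).
by rewrite ?mulr0 ?oppr0 ?subr0 ?sub0r; (split; last split); ring.
Qed.
End Table.

Let nat_neq0 n : (n.+1%:R : F) != 0.
Proof. by rewrite -(rmorph_nat iota) fmorph_eq0 pnatr_eq0. Qed.

Let derH D (dD : der iota D) y : D (y / 2) = D y / 2.
Proof.
by rewrite (derM dD) -(rmorph_nat iota) -fmorphV (derC dD) mulr0 addr0.
Qed.

(** In the order of increasing roots, each root vector sends its own coordinate to a nonzero
    multiple of x 0 and kills the preceding ones. L moves x 0 itself, which all of them kill. *)
Lemma short_ind6 x L : raising x -> der iota L -> L (x 0%N) != 0 -> x 0%N != 0 ->
  ind6 iota (x 0%N) (x 1%N) (x 2%N) (x 3%N / 2) (x 4%N) (x 5%N).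
Proof.
move=> hx dL L0 x0.
have [[a0 a1 a2 a3] [a4 a5 a6] _ _] := hx.
have [b0 b1 b2 [b3 b4 b5 b6]] := raising12 hx.
have [c0 c1 c2 [c3 c4 c5 c6]] := raising112 hx.
have [d0 d1 d2 [d3 d4 d5 d6]] := raising1112 hx.
have [e0 e1 e2 [e3 e4 e5 e6]] := raising21112 hx.
apply: (ind6_triangular dL dE1 d12 d112 d1112 d21112) => //.
- by rewrite a1.
- by rewrite b2.
- by rewrite (derH d112) c3; split; rewrite // mulf_neq0 ?invr_eq0 ?oppr_eq0 ?mulf_neq0 ?nat_neq0.
- by rewrite (derH d1112) d3 mul0r d4; split; rewrite // mulf_neq0 ?nat_neq0.
- rewrite (derH d21112) e3 mul0r e4 e5.
  by split; rewrite // oppr_eq0 mulf_neq0 ?nat_neq0.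
Qed.

(** The same scheme for the other parabolic, starting with E2: each root vector sends its own minor
    to a nonzero multiple of p 0 1. *)
Lemma long_ind6 x z L (p := fun j k : nat => x j * z k - x k * z j) :
  raising x -> raising z -> der iota L -> L (p 0%N 1%N) != 0 -> p 0%N 1%N != 0 ->
  ind6 iota (p 0 1)%N (p 0 2)%N ((p 0 3)%N / 2) (p 0 4)%N (p 1 4)%N (p 0 6)%N.
Proof.
move=> hx hz dL L0 p0.
have derp D (dD : der iota D) j k :
    D (p j k) = D (x j) * z k + x j * D (z k) - (D (x k) * z j + x k * D (z j)).
  by rewrite /p (derB dD) !(derM dD).
have [_ _ [a0 a1 a2 a3] [a4 a5 a6]] := hx.
have [b0 b1 b2 [b3 b4 b5 b6]] := raising12 hx.
have [c0 c1 c2 [c3 c4 c5 c6]] := raising112 hx.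
have [d0 d1 d2 [d3 d4 d5 d6]] := raising1112 hx.
have [e0 e1 e2 [e3 e4 e5 e6]] := raising21112 hx.
have [_ _ [a0' a1' a2' a3'] [a4' a5' a6']] := hz.
have [b0' b1' b2' [b3' b4' b5' b6']] := raising12 hz.
have [c0' c1' c2' [c3' c4' c5' c6']] := raising112 hz.
have [d0' d1' d2' [d3' d4' d5' d6']] := raising1112 hz.
have [e0' e1' e2' [e3' e4' e5' e6']] := raising21112 hz.
have via (y c : F) : y = c -> c != 0 -> y != 0 by move=> ->.
have n2 := nat_neq0 1.
apply: (ind6_triangular dL dE2 d12 d112 d1112 d21112) => //.
- rewrite !(derp _ dE2) a0 a1 a2 a0' a1' a2'; split; first by ring.
  by apply: (via _ _ _ p0); rewrite /p; ring.
- rewrite (derH d12) !(derp _ d12) b0 b1 b2 b3 b0' b1' b2' b3'; split; try by ring.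
  by apply: (via _ (- p 0%N 1%N)); [rewrite /p; field|rewrite oppr_eq0].
- rewrite (derH d112) !(derp _ d112) c0 c1 c2 c3 c4 c0' c1' c2' c3' c4'.
  split; try by [ring | field].
  by apply: (via _ (2 * p 0%N 1%N)); [rewrite /p; ring|rewrite mulf_neq0].
- rewrite (derH d1112) !(derp _ d1112) d0 d1 d2 d3 d4 d0' d1' d2' d3' d4'.
  split; try by [ring | field].
  by apply: (via _ (- (6 * p 0%N 1%N))); [rewrite /p; ring|rewrite oppr_eq0 mulf_neq0 ?nat_neq0].
- rewrite (derH d21112) !(derp _ d21112).
  rewrite e0 e1 e2 e3 e4 e6 e0' e1' e2' e3' e4' e6'.
  split; try by [ring | field]; split; first by ring.
  by apply: (via _ (- (6 * p 0%N 1%N))); [rewrite /p; ring|rewrite oppr_eq0 mulf_neq0 ?nat_neq0].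
Qed.
End Raising.

Section Charts.
Variable K : numFieldType.
Local Notation CG := (CG K).
Local Notation row_ := (@row_ K).
Local Notation pl := (@pl K).

Definition Eder i := ext (@edag K i).
Definition Fder i := ext (@fdag K i).

Lemma der_Eder i : der (@scal K) (Eder i).
Proof. by apply: der_ext; [exact: edagD|exact: edagM|exact: edagC]. Qed.

Lemma der_Fder i : der (@scal K) (Fder i).
Proof. by apply: der_ext; [exact: fdagD|exact: fdagM|exact: fdagC]. Qed.

Lemma Eder_row i f : Eder i f%:F = (edag i f)%:F.
Proof. by apply: extE; [exact: edagM|exact: edagC]. Qed.

Lemma Fder_row i f : Fder i f%:F = (fdag i f)%:F.
Proof. by apply: extE; [exact: fdagM|exact: fdagC]. Qed.

Lemma row_raising a : raising (Eder i1) (Eder i2) (fun b => (row_ a b)%:F).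
Proof.
rewrite /raising !Eder_row !edE tofrac0 tofracM.
by rewrite tofracD tofrac1.
Qed.

Lemma row00_neq0 : (row_ 0 0)%:F != 0.
Proof.
rewrite tofrac_eq0; apply/eqP => /(congr1 (fun f : CG => f 1%g)).
by rewrite row_one // CG0 => /eqP; rewrite oner_eq0.
Qed.

Lemma pl01_neq0 : (pl 0 1)%:F != 0.
Proof.
rewrite tofrac_eq0; apply/eqP => /(congr1 (fun f : CG => f 1%g)).
by rewrite pl_eval !row_one // CG0 /= mulr0 subr0 mul1r => /eqP; rewrite oner_eq0.
Qed.

Lemma row_ind6 (x := fun b => (row_ 0 b)%:F) :
  ind6 (@scal K) (x 0%N) (x 1%N) (x 2%N) (x 3%N / 2) (x 4%N) (x 5%N).
Proof.
have hx : raising (Eder i1) (Eder i2) x by exact: row_raising.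
apply: (short_ind6 (der_Eder i1) (der_Eder i2) hx (der_Fder i1)); last exact: row00_neq0.
(* The lowering operator f_1 sends x 0 to x 1, which is not zero since e_1 sends it back to x 0. *)
rewrite Fder_row fdE -/(x 1%N); apply/eqP => e; have [[_ + _ _] _ _ _] := hx.
rewrite e (der0 (der_Eder i1)) => /esym/eqP; apply/negP; exact: row00_neq0.
Qed.

Lemma tofrac_pl j k : (pl j k)%:F =
  (row_ 0 j)%:F * (row_ 1 k)%:F - (row_ 0 k)%:F * (row_ 1 j)%:F.
Proof. by rewrite tofracB !tofracM. Qed.

Lemma fdag_pl i j k : fdag i (pl j k) =
  fdag i (row_ 0 j) * row_ 1 k + row_ 0 j * fdag i (row_ 1 k)
  - (fdag i (row_ 0 k) * row_ 1 j + row_ 0 k * fdag i (row_ 1 j)).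
Proof. by rewrite /pl fdagB !fdagM. Qed.

Lemma fdag2_pl01 : fdag i2 (pl 0 1) = pl 0 2.
Proof. by rewrite fdag_pl !fdE // !mul0r mulr0 add0r addr0. Qed.

Lemma pl02_neq0 : (pl 0 2)%:F != 0.
Proof.
apply/eqP => e; have /eqP := pl01_neq0; apply.
have [_ _ [a0 _ a2 _] _] := row_raising 0.
have [_ _ [b0 _ b2 _] _] := row_raising 1.
have h := der_Eder i2; have := congr1 (Eder i2) e; rewrite (der0 h) tofrac_pl (derB h) !(derM h) a0 a2 b0 b2.
by rewrite mul0r mulr0 add0r addr0 -tofrac_pl.
Qed.

Lemma pl_ind6 (p := fun j k => (pl j k)%:F) :
  ind6 (@scal K) (p 0 1)%N (p 0 2)%N ((p 0 3)%N / 2) (p 0 4)%N (p 1 4)%N (p 0 6)%N.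
Proof.
have hx := row_raising 0; have hz := row_raising 1.
have n0 := pl01_neq0; rewrite tofrac_pl in n0.
have L0 : Fder i2 (pl 0 1)%:F != 0 by rewrite Fder_row fdag2_pl01; exact: pl02_neq0.
rewrite tofrac_pl in L0; rewrite /p !tofrac_pl.
exact: (long_ind6 (der_Eder i1) (der_Eder i2) hx hz (der_Fder i2) L0 n0).
Qed.
End Charts.

(** * From derivations to algebraic independence *)

Section AlgebraicIndependence.
Import -(notations) mpoly.
Variables (K : numFieldType) (F : fieldType) (iota : {rmorphism K -> F}).
Variables (n : nat) (x : 'I_n -> F).
Local Notation P := (mpoly n K).
Local Notation ev := (mmap iota x).

Lemma mmap_mderiv i D (p : P) : der iota D -> (forall j, D (x j) = (j == i)%:R) ->
  D (ev p) = ev (mderiv i p).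
Proof.
move=> dD Dx; pose Q (q : P) := D (ev q) = ev (mderiv i q).
have Q0 : Q 0 by rewrite /Q !raddf0 (der0 dD).
have QD q r : Q q -> Q r -> Q (q + r).
  by rewrite /Q => hq hr; rewrite mmapD (derD dD) hq hr mderivD mmapD.
have QM q r : Q q -> Q r -> Q (q * r).
  rewrite /Q => hq hr; rewrite rmorphM /= (derM dD) hq hr mderivM.
  by rewrite mmapD !rmorphM.
have Q1 : Q 1 by rewrite /Q rmorph1 (der1 dD) -(mpolyC1) mderivC raddf0.
have QX j : Q (mpolyX _ (mnm1 j)).
  rewrite /Q mmapX mmap1U Dx mderivX mmapZ rmorph_nat.
  rewrite mnm1E eq_sym; case: eqP => [->|_]; rewrite ?mul0r //.
  rewrite (_ : mnm_sub _ _ = mnm0); last by apply/mnmP => k; rewrite !mnmE subnn.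
  by rewrite mmapX mmap11 mulr1.
elim/mpolyind: p => [//|c m p _ _ hp]; apply: QD => //.
have -> : c *: mpolyX K m = mpolyC n c * mpolyX K m.
  by rewrite mul_mpolyC.
apply: (QM).
  by rewrite /Q mmapC (derC dD) mderivC raddf0.
rewrite mpolyXE_id; elim/big_rec: _ => [//|j q _ hq]; apply: (QM) => //.
by elim: (m j) => [|k IH]; rewrite ?expr0 // exprS; apply: (QM).
Qed.

(** Induction on the degree: the partial derivatives of a relation are relations of lower degree,
    hence zero, and in characteristic 0 the relation is then a constant. *)
Lemma mmap_inj : indep iota x -> injective (ev : P -> F).
Proof.
move=> ix; suff H N : forall p : P, (forall m, (N <= mdeg m)%N -> mcoeff m p = 0) ->
    ev p = 0 -> p = 0.
  move=> p q e; apply/eqP; rewrite -subr_eq0; apply/eqP.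
  apply: (H (msize (p - q))); last by rewrite raddfB /= e subrr.
  by move=> m /msize_mdeg_ge; apply: memN_msupp_eq0.
elim: N => [|N IH] p hN e.
  by apply/mpolyP => m; rewrite mcoeff0 hN.
have dp i : mderiv i p = 0.
  have [D dD hD] := ix (fun j => (j == i)%:R).
  apply: IH => [m hm|]; last by rewrite -(mmap_mderiv _ dD hD) e (der0 dD).
  by rewrite mcoeff_deriv hN ?mul0rn // mdegD mdeg1 addn1.
have hc m : m != @mnm0 n -> mcoeff m p = 0.
  move=> m0; have [i hi] : exists i, m i != 0%N.
    apply: contrapT => hn; case/eqP: m0; apply/mnmP => i.
    by rewrite mnm0E; apply: contrapT => /eqP hi; apply: hn; exists i.
  have := congr1 (mcoeff (mnm_sub m (mnm1 i))) (dp i).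
  rewrite mcoeff_deriv mcoeff0 submK ?lep1mP //.
  by move/eqP; rewrite mulrn_eq0 /= => /eqP.
have pC : p = mpolyC n (mcoeff (@mnm0 n) p).
  apply/mpolyP => m; rewrite mcoeffC.
  by have [->|m0] := eqVneq m (@mnm0 n); rewrite ?mulr1 // mulr0 hc.
move: e; rewrite pC mmapC => /eqP; rewrite fmorph_eq0 => /eqP ->.
exact: mpolyC0.
Qed.
End AlgebraicIndependence.

Lemma invariant_is_seed (K : numFieldType) (F : fieldType) (iota : {rmorphism K -> F})
  (I J : finType) (B : set F) (L : set J) (s : seed F I J) :
  seed_invariant iota B L s -> is_seed iota s.
Proof.
move=> h; split; last exact: (inv_skew h).
apply: mmap_inj => e; have [D dD hD] := inv_indep h (fun r => e (enum_rank r)).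
by exists D => // k; rewrite hD enum_valK.
Qed.

(** * The two sides in coordinates *)

Section Plucker.
Variables (K : numFieldType) (F : fieldType) (iota : {rmorphism K -> F}).
Variable p : nat -> nat -> F.
Hypothesis p01 : p 0%N 1%N != 0.
Hypothesis plucker : forall j k,
  p 0%N 1%N * p j k = p 0%N j * p 1%N k - p 0%N k * p 1%N j.
Hypothesis anti : forall j k, p k j = - p j k.
Hypothesis c0 : 2 * p 1%N 2%N = p 0%N 3%N.
Hypothesis c1 : p 1%N 3%N = 2 * p 0%N 4%N.
Hypothesis c2 : p 2%N 3%N = 2 * p 0%N 5%N.
Hypothesis c3 : p 2%N 4%N = p 1%N 5%N + p 0%N 6%N.
Hypothesis c4 : p 3%N 4%N = 2 * p 1%N 6%N.

Local Notation t := (p 0%N 1%N).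
Local Notation a := (p 0%N 2%N).
Local Notation b := (p 0%N 3%N / 2).
Local Notation c := (p 0%N 4%N).
Local Notation d := (p 1%N 4%N).
Local Notation h := (p 0%N 6%N).

Let n2 : (2 : F) != 0.
Proof. by rewrite -(rmorph_nat iota) fmorph_eq0 pnatr_eq0. Qed.

Let divp j k : p j k = (p 0%N j * p 1%N k - p 0%N k * p 1%N j) / t.
Proof. by rewrite -plucker mulrC mulKf. Qed.

Lemma p12E : p 1%N 2%N = b.
Proof. by rewrite -c0 mulrC mulKf. Qed.

Lemma p05E : p 0%N 5%N = (a * c - b ^+ 2) / t.
Proof.
apply: (mulfI n2); rewrite -c2 divp c1 p12E; field; by rewrite p01 n2.
Qed.

Lemma p15E : p 1%N 5%N = (a * d - b * c) / t - h.
Proof.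
apply: (addIr h); rewrite subrK -c3 divp p12E; congr (_ / _); ring.
Qed.

Lemma p16E : p 1%N 6%N = long_p16 t b c d.
Proof.
apply: (mulfI n2); rewrite -c4 divp c1 /long_p16; field; by rewrite p01 n2.
Qed.

Lemma p46E : p 4%N 6%N = long_Y1 t b c d h.
Proof. by rewrite divp p16E /long_Y1; congr (_ / _); ring. Qed.

Lemma p56E : p 5%N 6%N = long_F1 t a b c d h.
Proof. by rewrite divp p16E p05E p15E /long_F1. Qed.

(** The Pluecker relations with p_01 reduce every p_jk to those with j = 0 or 1. The cross product
    relations then express p_12, p_13, p_05, p_15 and p_16 in terms of the six coordinates. *)
Lemma laurent5_plucker j k : (j < 7)%N -> (k < 7)%N -> laurent5 iota t a b c d h (p j k).
Proof.
set B := laurent5 _ _ _ _ _ _ _.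
have cB : Ksubalg iota B by apply: laurent5_closed.
have [Bt Bti Ba Bb [Bc Bd Bh]] := laurent5_gen iota t a b c d h; rewrite -/B in Bt Bti Ba Bb Bc Bd Bh.
have B2 : B 2 by apply: (sa_nat cB).
have Bdiv u : B u -> B (u / t) by move=> Bu; apply: (saM cB).
have B16 : B (p 1%N 6%N).
  by rewrite p16E; apply: Bdiv; apply: (saB cB); [apply: (saM cB)|apply: (saX cB)].
have B05 : B (p 0%N 5%N).
  by rewrite p05E; apply: Bdiv; apply: (saB cB); [apply: (saM cB)|apply: (saX cB)].
have B15 : B (p 1%N 5%N).
  by rewrite p15E; apply: (saB cB) => //; apply: Bdiv; apply: (saB cB); apply: (saM cB).
have p00 : p 0%N 0%N = 0 by rewrite divp subrr mul0r.
have B0 k' : (k' < 7)%N -> B (p 0%N k').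
  case: k' => [|[|[|[|[|[|[|//]]]]]]] _ //; first by rewrite p00; apply: (sa0 cB).
  by rewrite -[p _ _](divfK n2); apply: (saM cB).
have B1 k' : (k' < 7)%N -> B (p 1%N k').
  case: k' => [|[|[|[|[|[|[|//]]]]]]] _ //.
  - by rewrite anti; apply: (saN cB).
  - by have := divp 1%N 1%N; rewrite subrr mul0r => ->; apply: (sa0 cB).
  - by rewrite p12E.
  - by rewrite c1; apply: (saM cB).
move=> j7 k7; rewrite divp; apply: Bdiv.
by apply: (saB cB); apply: (saM cB); (apply: B0 || apply: B1).
Qed.
End Plucker.

Section Seeds.
Variable K : numFieldType.
Local Notation CG := (CG K).
Local Notation row_ := (@row_ K).
Local Notation pl := (@pl K).
Local Notation "x %:F" := (FracField.tofrac x).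
Local Notation x := (fun j => (row_ 0 j)%:F).
Local Notation p := (fun j k => (pl j k)%:F).

Lemma X0E : X0 K = cstG 2^-1 * row_ 0 3.
Proof. by rewrite /X0 minor1 !fdE. Qed.

Lemma pl_rel : [/\ 2 * pl 1 2 = pl 0 3, pl 1 3 = 2 * pl 0 4, pl 2 3 = 2 * pl 0 5,
  pl 2 4 = pl 1 5 + pl 0 6 & pl 3 4 = 2 * pl 1 6].
Proof.
have cr g k := @cross0 K g k.
have n2 : (2 : K) != 0 by rewrite pnatr_eq0.
have eq (u v : K) : u - v = 0 -> u = v by move=> /eqP; rewrite subr_eq0 => /eqP.
split; apply: CG_eq => g.
- by rewrite CGM CG_nat; apply: eq; exact: (cr g 0%N).
- by rewrite CGM CG_nat; apply: eq; exact: (cr g 1%N).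
- by rewrite CGM CG_nat; apply: eq; exact: (cr g 2%N).
- rewrite -[RHS]/(pl 1 5 g + pl 0 6 g); apply: (mulfI n2); apply: eq.
  have <- : 2 * pl 2 4 g - 2 * pl 1 5 g - 2 * pl 0 6 g = 0 := cr g 3%N.
  ring.
- by rewrite CGM CG_nat; apply: eq; exact: (cr g 4%N).
Qed.

Lemma cst_inv n : n != 0%N -> cstG n%:R^-1 * n%:R = 1 :> CG.
Proof. by move=> n0; apply: CG_eq => g; rewrite CGM CGC CG_nat mulVf // pnatr_eq0. Qed.

(** The constant 6 comes from 2 p_13 + 2 p_04 with p_13 = 2 p_04. *)
Lemma Y2E : Y2 K = pl 0 4.
Proof.
have [_ c1 _ _ _] := pl_rel.
rewrite /Y2 minor2 fdag2_pl01 fdag_pl !fdE //.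
have -> : row_ 0 1 * row_ 1 2 + row_ 0 0 * row_ 1 3 - (row_ 0 3 * row_ 1 0 + row_ 0 2 * row_ 1 1)
   = pl 1 2 + pl 0 3 by rewrite /pl; ring.
rewrite fdagD !fdag_pl !fdE //.
have -> : 0 * row_ 1 2 + row_ 0 1 * row_ 1 3 - (row_ 0 3 * row_ 1 1 + row_ 0 2 * 0) +
    (row_ 0 1 * row_ 1 3 + row_ 0 0 * (2 * row_ 1 4) - (2 * row_ 0 4 * row_ 1 0 + row_ 0 3 * row_ 1 1))
   = 2 * pl 1 3 + 2 * pl 0 4 by rewrite /pl; ring.
rewrite c1; have -> : 2 * (2 * pl 0 4) + 2 * pl 0 4 = 6 * pl 0 4 by ring.
by rewrite mulrA cst_inv // mul1r.
Qed.

(** Both terms have weight zero. The first is 2 p_15 + 2 p_06, the second p_24 + p_15, and p_24 =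
    p_15 + p_06. *)
Lemma Ym2E : 2 * fdag i1 (fdag i2 (pl 0 4)) - fdag i2 (fdag i1 (pl 0 4)) = pl 0 6.
Proof.
have [_ _ _ c3 _] := pl_rel; rewrite !fdag_pl !fdE //.
have -> : 0 * row_ 1 4 + row_ 0 0 * row_ 1 5 - (row_ 0 5 * row_ 1 0 + row_ 0 4 * 0) = pl 0 5.
  by rewrite /pl; ring.
have -> : row_ 0 1 * row_ 1 4 + row_ 0 0 * 0 - (0 * row_ 1 0 + row_ 0 4 * row_ 1 1) = pl 1 4.
  by rewrite /pl; ring.
rewrite !fdag_pl !fdE //.
have -> : row_ 0 2 * row_ 1 4 + row_ 0 1 * row_ 1 5 - (row_ 0 5 * row_ 1 1 + row_ 0 4 * row_ 1 2)
    = pl 2 4 + pl 1 5 by rewrite /pl; ring.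
by rewrite c3 /pl; ring.
Qed.

Lemma scal_inv n : @scal K n%:R^-1 = n%:R^-1.
Proof. by rewrite fmorphV rmorph_nat. Qed.

Lemma tofrac_nat n : (n%:R : CG)%:F = n%:R.
Proof. exact: rmorph_nat. Qed.

Lemma quadricF : x 6%N = short_F1 (x 0%N) (x 1%N) (x 2%N) (x 3%N / 2) (x 4%N) (x 5%N).
Proof.
have q : row_ 0 0 * row_ 0 6 = row_ 0 1 * row_ 0 5 - row_ 0 2 * row_ 0 4
    + (cstG 2^-1 * row_ 0 3) ^+ 2.
  apply: CG_eq => g; rewrite CGM -[RHS]/(row_ 0 1 g * row_ 0 5 g - row_ 0 2 g * row_ 0 4 g
    + (2^-1 * row_ 0 3 g) * (2^-1 * row_ 0 3 g)).
  have q0 := @quadric K g; apply/eqP; rewrite -subr_eq0 -[X in _ == X]q0; apply/eqP; by field.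
move: (congr1 (@FracField.tofrac _) q).
rewrite tofracM tofracD tofracXn tofracB !tofracM -/(scal 2^-1) scal_inv => e.
rewrite /short_F1 [_ / 2]mulrC -e mulrC mulKf //; exact: row00_neq0.
Qed.

Lemma Sigma_short : Sigma K i1 =
  short_seed (x 0%N) (x 1%N) (x 2%N) (x 3%N / 2) (x 4%N) (x 5%N).
Proof.
have hE : (X0 K)%:F = x 3%N / 2 by rewrite X0E tofracM -/(scal 2^-1) scal_inv mulrC.
apply: seed_eq; last by [].
apply/funext => -[] i; have [->|->|->] := ord3P i; rewrite /= ?Delta1_0 ?Delta1_1 ?Delta1_2
  ?Delta1_3 ?Delta1_4 ?Delta1_w0 //.
- by rewrite /short_X2 -hE !expr2 !tofracB !tofracM.
- by rewrite quadricF.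
- by rewrite /short_F2 -quadricF -hE !tofracB !tofracM tofracD !tofracM.
Qed.

Lemma pl_anti j k : p k j = - p j k.
Proof. by rewrite -tofracN; congr FracField.tofrac; rewrite /pl opprB. Qed.

Lemma pl_plucker j k : p 0%N 1%N * p j k = p 0%N j * p 1%N k - p 0%N k * p 1%N j.
Proof. by rewrite -!tofracM -tofracB; congr FracField.tofrac; rewrite /pl; ring. Qed.

Lemma tofrac_pl_rel : [/\ 2 * p 1%N 2%N = p 0%N 3%N, p 1%N 3%N = 2 * p 0%N 4%N,
  p 2%N 3%N = 2 * p 0%N 5%N, p 2%N 4%N = p 1%N 5%N + p 0%N 6%N & p 3%N 4%N = 2 * p 1%N 6%N].
Proof.
have [c0 c1 c2 c3 c4] := pl_rel.
split.
- by rewrite -c0 tofracM tofrac_nat.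
- by rewrite c1 tofracM tofrac_nat.
- by rewrite c2 tofracM tofrac_nat.
- by rewrite c3 tofracD.
- by rewrite c4 tofracM tofrac_nat.
Qed.

Lemma Sigma_long : Sigma K i2 =
  long_seed (p 0 1)%N (p 0 2)%N (p 0%N 3%N / 2) (p 0 4)%N (p 1 4)%N (p 0 6)%N.
Proof.
have [c0 c1 c2 c3 c4] := tofrac_pl_rel; have n0 := @pl01_neq0 K.
apply: seed_eq; last by [].
apply/funext => -[] i; have [->|->|->] := ord3P i; rewrite /= ?Y2E ?Ym2E ?Delta2_0 ?Delta2_2
  ?Delta2_4 ?Delta2_w0 //.
- exact: (p46E (@scal K) (p := p) n0 pl_plucker c1 c4).
- exact: (p56E (@scal K) (p := p) n0 pl_plucker c0 c1 c2 c3 c4).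
Qed.
End Seeds.

Section Final.
Variable K : numClosedFieldType.
Local Notation row_ := (@row_ K).
Local Notation pl := (@pl K).
Local Notation "x %:F" := (FracField.tofrac x).
Local Notation x := (fun j => (row_ 0 j)%:F).
Local Notation p := (fun j k => (pl j k)%:F).

Lemma short_localization_laurent :
  localization (coord_ring K i1) [set f | exists n : nat, f = minor K i1 ^+ n] =
  laurent5 (@scal K) (x 0%N) (x 1%N) (x 2%N) (x 3%N / 2) (x 4%N) (x 5%N).
Proof.
have n2 : (2 : {fraction (CG K)}) != 0.
  by rewrite -(rmorph_nat (@scal K)) fmorph_eq0 pnatr_eq0.
rewrite short_localization; apply/seteqP; split; last first.
  set A := alg _ _; have cA : Ksubalg (@scal K) A by apply: alg_closed.
  have Ax j : (j < 7)%N -> A (x j).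
    by move=> j7; apply: alg_gen; left; exists (Ordinal j7).
  apply: (laurent5_min cA); try exact: Ax.
    by apply: alg_gen; right.
  by apply: (saM cA); [exact: Ax|rewrite -scal_inv; exact: (sa_const cA)].
set B := laurent5 _ _ _ _ _ _ _; have cB : Ksubalg (@scal K) B by apply: laurent5_closed.
have [Bt Bti Ba Bb [Bc Bd Be]] :=
  laurent5_gen (@scal K) (x 0%N) (x 1%N) (x 2%N) (x 3%N / 2) (x 4%N) (x 5%N).
rewrite -/B in Bt Bti Ba Bb Bc Bd Be.
apply: alg_min => // z [[j ->]|->]; last by [].
case: j => [[|[|[|[|[|[|[|//]]]]]]] j7] //.
- rewrite -[X in B X](divfK n2); apply: (saM cB) => //; exact: (sa_nat cB).
- rewrite -[X in B X]/((row_ 0 6)%:F) quadricF /short_F1; apply: (saM cB) => //.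
  by apply: (saD cB); [apply: (saB cB); apply: (saM cB)|apply: (saX cB)].
Qed.

Lemma long_localization_laurent :
  localization (coord_ring K i2) [set f | exists n : nat, f = minor K i2 ^+ n] =
  laurent5 (@scal K) (p 0 1)%N (p 0 2)%N (p 0%N 3%N / 2) (p 0 4)%N (p 1 4)%N (p 0 6)%N.
Proof.
rewrite long_localization; apply/seteqP; split; last first.
  set A := alg _ _; have cA : Ksubalg (@scal K) A by apply: alg_closed.
  have Ap j k : (j < 7)%N -> (k < 7)%N -> A (p j k).
    by move=> j7 k7; apply: alg_gen; left; exists (Ordinal j7, Ordinal k7).
  apply: (laurent5_min cA); try exact: Ap.
    by apply: alg_gen; right.
  by apply: (saM cA); [exact: Ap|rewrite -scal_inv; exact: (sa_const cA)].
set B := laurent5 _ _ _ _ _ _ _; have cB : Ksubalg (@scal K) B by apply: laurent5_closed.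
have [_ Bti _ _ _] := laurent5_gen (@scal K) (p 0 1)%N (p 0 2)%N (p 0%N 3%N / 2)
  (p 0 4)%N (p 1 4)%N (p 0 6)%N.
apply: alg_min => // z [[[j k] ->]|->]; last by [].
have [c0 c1 c2 c3 c4] := tofrac_pl_rel K.
exact: (laurent5_plucker (p := p) (@pl01_neq0 K) (@pl_plucker K) (@pl_anti K)
  c0 c1 c2 c3 c4 (ltn_ord j) (ltn_ord k)).
Qed.

Lemma cluster_laurent (B : set {fraction (CG K)}) (s : seed {fraction (CG K)} 'I_3 'I_3) :
  Ksubalg (@scal K) B ->
  seed_invariant (@scal K) B [set j | j = o2] s ->
  B `<=` cluster_algebra_ext (@scal K) [set o2]%SET s ->
  is_seed (@scal K) s /\ cluster_algebra_ext (@scal K) [set ord_max]%SET s = B.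
Proof.
move=> cB hs up; split; first exact: (invariant_is_seed hs).
have -> : ord_max = o2 by apply: val_inj.
apply/seteqP; split=> //; apply: (cluster_algebra_sub cB).
suff -> : [set` [set o2]%SET] = [set j | j = o2] by [].
by apply/seteqP; split=> j; rewrite /= inE => /eqP.
Qed.

Lemma cluster_localization i :
  is_seed (@scal K) (Sigma K i) /\
  cluster_algebra_ext (@scal K) [set ord_max]%SET (Sigma K i)
  = localization (coord_ring K i) [set f | exists n : nat, f = minor K i ^+ n].
Proof.
have [->|->] := ord2P i.
  rewrite short_localization_laurent Sigma_short.
  have ind := @row_ind6 K; apply: cluster_laurent; first exact: laurent5_closed.
    exact: (short_invariant ind).
  exact: (short_upper ind).
rewrite long_localization_laurent Sigma_long.
have ind := @pl_ind6 K; apply: cluster_laurent; first exact: laurent5_closed.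
  exact: (long_invariant ind).
exact: (long_upper ind).
Qed.
End Final.

(* The only inverted coefficient is the one of index -3, the last of the three
   frozen indices. *)
Theorem theorem2p1 (R : realType) (k : 'I_2) :
  is_seed (@scal R[i]) (Sigma R[i] k) /\
  cluster_algebra_ext (@scal R[i]) [set ord_max]%SET (Sigma R[i] k)
  = localization (coord_ring R[i] k)
      [set f | exists n : nat, f = minor R[i] k ^+ n].
Proof. exact: cluster_localization. Qed.
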